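(* Let $w:[0,+\infty)\to(0,+\infty)$ be a weight function. Then the following properties are equivalent: (1) for all $d\ge 1$, the radial weight $w$ on $\mathbb{C}^d$ is approximable by a holomorphic map; (1') for some $d\ge 1$, the radial weight $w$ on $\mathbb{C}^d$ is approximable by a holomorphic map; (2) for all $d\ge 1$, $w$ is approximable by the maximum of a holomorphic function modulus on $\mathbb{C}^d$; (2') for some $d\ge 1$, $w$ is approximable by the maximum of a holomorphic function modulus on $\mathbb{C}^d$; (3) for all $d\ge 1$, $w$ is essential on $\mathbb{C}^d$; (3') for some $d\ge 1$, $w$ is essential on $\mathbb{C}^d$; (4) $w$ is equivalent to a log-tropical weight function.
   Context: A weight function $w:[0,+\infty)\to(0,+\infty)$ is a non-decreasing, continuous and unbounded function. For an integer $d\ge1$, it is extended to a radial weight on $\mathbb{C}^d$ by $w(z)=w(|z|)$, $z\in\mathbb{C}^d$, where $|\cdot|$ is the Euclidean norm. For functions $u,v:X\to(0,+\infty)$ on a set $X$, $u\asymp v$ (''$u$ and $v$ are equivalent'') means that there are constants $C_1,C_2>0$ with $C_1u(x)\le v(x)\le C_2u(x)$ for all $x\in X$. - $w$ is approximable by a holomorphic map on $\mathbb{C}^d$ if there exist $n\in\mathbb{N}$ and a holomorphic map $f:\mathbb{C}^d\to\mathbb{C}^n$ such that $|f(z)|\asymp w(z)$, $z\in\mathbb{C}^d$. - $w$ is approximable by the maximum of a holomorphic function modulus on $\mathbb{C}^d$ if there exists a holomorphic function $f:\mathbb{C}^d\to\mathbb{C}$ such that $M_f(t)\asymp w(t)$,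 $0\le t<+\infty$, where $M_f(t)=\max\{|f(z)|: z\in\mathbb{C}^d,\ |z|=t\}$. - The associated weight on $\mathbb{C}^d$ is $\widetilde{w}(z)=\sup\{|f(z)|: f:\mathbb{C}^d\to\mathbb{C}\text{ holomorphic},\ |f|\le w\text{ on }\mathbb{C}^d\}$; it is radial, so it defines a function $\widetilde{w}(t)$, $t\ge0$. The weight $w$ is essential on $\mathbb{C}^d$ if $\widetilde{w}(t)\asymp w(t)$, $0\le t<+\infty$. A tropical power series on $\mathbb{R}$ is a function of the form $\Psi(x)=\sup_{j\in E}(b_j+jx)$, $x\in\mathbb{R}$, where $E\subset\mathbb{Z}_+=\{0,1,2,\dots\}$ is an arbitrary subset, $b_j\in\mathbb{R}$ for $j\in E$, and the supremum is finite for all $x\in\mathbb{R}$. A weight function $v:[0,+\infty)\to(0,+\infty)$ is log-tropical if $\Phi_v(x)=\log v(e^x)$, $x\in\mathbb{R}$, is a tropical power series. *)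

(* Defs.v *)
From mathcomp Require Export all_boot all_order all_algebra.
From mathcomp Require Export complex.
From mathcomp Require Export all_classical all_reals all_analysis.
Export Order.TTheory GRing.Theory Num.Theory numFieldNormedType.Exports.

Set Implicit Arguments.
Unset Strict Implicit.
Unset Printing Implicit Defensive.

Local Open Scope classical_set_scope.
Local Open Scope ring_scope.

(* Functions on [0, +oo[ are total functions R -> R of which only the values
   at t >= 0 matter. *)
Definition weight_function (R : realType) (w : R -> R) : Prop :=
  [/\ forall t, 0 <= t -> 0 < w t,
      forall s t, 0 <= s -> s <= t -> w s <= w t,
      {within `[0, +oo[, continuous w}
    & forall M, exists2 t, 0 <= t & M < w t].

(* Positivity of u and v on A is not part of the definition: when v > 0 on A,
   the inequality v <= C2 * u forces u > 0 on A as well. *)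
Definition equivalent_on (R : realType) (X : Type) (A : set X) (u v : X -> R) :
    Prop :=
  exists C1 C2 : R, [/\ 0 < C1, 0 < C2
    & forall x, A x -> C1 * u x <= v x /\ v x <= C2 * u x].

(* The library norm on 'rV_d is the sup norm, hence a separate Euclidean norm;
   the two induce the same topology and the same notion of differentiability. *)
Definition euclidean_norm (R : realType) (d : nat) (z : 'rV[R[i]]_d) : R :=
  Num.sqrt (\sum_(k < d) Normc.normc (z 0 k) ^+ 2).

(* The scalars of the normed modules are R[i], so [differentiable] means
   having a C-linear Frechet differential. *)
Definition holomorphic_map (R : realType) (d n : nat)
    (f : 'rV[R[i]]_d -> 'rV[R[i]]_n) : Prop :=
  forall z, differentiable f z.

Definition holomorphic (R : realType) (d : nat) (f : 'rV[R[i]]_d -> R[i]) :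
    Prop :=
  forall z, differentiable (f : 'rV[R[i]]_d -> R[i]^o) z.

Definition approximable_by_map (R : realType) (d : nat) (w : R -> R) : Prop :=
  exists n : nat, (0 < n)%N /\
  exists f : 'rV[R[i]]_d -> 'rV[R[i]]_n,
    holomorphic_map f /\
    equivalent_on [set: 'rV[R[i]]_d]
      (fun z => euclidean_norm (f z)) (fun z => w (euclidean_norm z)).

(* For d > 0, t >= 0 and f continuous, this supremum is attained, since the
   sphere of radius t is then compact and nonempty. *)
Definition max_modulus (R : realType) (d : nat) (f : 'rV[R[i]]_d -> R[i])
    (t : R) : R :=
  sup [set Normc.normc (f z) | z in [set z | euclidean_norm z = t]].

Definition approximable_by_max_modulus (R : realType) (d : nat) (w : R -> R) :
    Prop :=
  exists f : 'rV[R[i]]_d -> R[i],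
    holomorphic f /\ equivalent_on [set t | 0 <= t] (max_modulus f) w.

(* The set below contains 0 and is bounded above by w |z|, so that sup is a
   genuine least upper bound. *)
Definition associated_weight (R : realType) (d : nat) (w : R -> R)
    (z : 'rV[R[i]]_d) : R :=
  sup [set Normc.normc (f z) | f in
    [set f : 'rV[R[i]]_d -> R[i] | holomorphic f /\
       forall y, Normc.normc (f y) <= w (euclidean_norm y)]].

(* The associated weight is radial and, for d > 0, every t >= 0 is the norm of
   some z: comparing radial functions on [0, +oo[ amounts to comparing the
   corresponding functions on C^d. *)
Definition essential (R : realType) (d : nat) (w : R -> R) : Prop :=
  equivalent_on [set: 'rV[R[i]]_d]
    (associated_weight w) (fun z => w (euclidean_norm z)).

(* The supremum is taken in \bar R; its being the real number Psi x expresses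
   that it is finite (and that E is nonempty). *)
Definition tropical_power_series (R : realType) (Psi : R -> R) : Prop :=
  exists (E : set nat) (b : nat -> R), forall x : R,
    (Psi x)%:E = ereal_sup [set (b j + j%:R * x)%:E | j in E].

Definition log_tropical (R : realType) (v : R -> R) : Prop :=
  tropical_power_series (fun x => ln (v (expR x))).

(* Main.v *)
From HB Require Import structures.
Require Import Defs.
From mathcomp Require Import ring lra zify.

(** Each of the three approximation properties, in any one dimension, provides
    competitors: for some kappa > 0 and every t > 0 there are a holomorphic f with
    |f| <= w everywhere and a point z with |z| = t and |f z| >= kappa * w t. The
    theorem says that monomials are as good as arbitrary competitors, and that
    conversely a supremum of monomials can be realized by finitely many entire
    functions.

    From competitors to monomials. Let bcoef w j be the largest B such that
    B t^j <= w t for all t > 0. The supremum v = vmax w of the monomials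
    bcoef w j * t^j is log-tropical and at most w, and [dominating_monomial] shows
    w <= (16 / kappa) v. If all these monomials were small at t, there would be an
    annulus s < |l| < r around |l| = t on which w falls and grows at rates that an
    entire function cannot follow ([slope_bracket]); a Cauchy estimate on the annulus,
    for the restriction of f to the line through z, then makes f z too small
    ([annulus_bound], [three_circles]). The complex analysis rests on Goursat's theorem
    for rectangles, transported to annuli by the exponential.

    From monomials to functions. Let v be log-tropical, the supremum of
    e^(b j) t^j. A greedy choice of lines ([next_exists]), sorted modulo 5, gives
    eleven subfamilies of the monomials such that at every t some term of some
    subfamily is comparable with v t and exceeds the sum of the other terms of its
    subfamily by any prescribed factor ([splitting]). The entire function
    obtained by summing everything at t = z 0 0 has maximum modulus comparable with v
    ([tropical_max_modulus]). For a map, |z|^k has to be replaced by finitely many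
    holomorphic functions P k i with max_i |P k i z| comparable with |z|^k uniformly
    in k ([comparable_exists]). These exist by induction on the dimension: by
    homogeneity, |(zeta, y)|^j is |zeta|^j times a radial weight at |y| / |zeta|,
    this weight has competitors with kappa = 1 whatever j ([hypow_crit]), so it is
    split as before into lacunary sums of |y|^k |zeta|^(j - k), in which the
    previous dimension replaces |y|^k. In the resulting series the dominant
    term survives in one component ([dominance]), which makes w approximable by a map
    ([tropical_map]) and, through the components of the map, essential
    ([map_competitive], [competitive_essential]). Limits of series are holomorphic by
    Vitali's theorem ([hol_limit]). *)

Set Implicit Arguments.
Unset Strict Implicit.
Unset Printing Implicit Defensive.
Local Open Scope classical_set_scope.
Local Open Scope ring_scope.
Local Open Scope complex_scope.
Import Normc.
Local Notation Re := complex.Re.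
Local Notation Im := complex.Im.

(** * Complex numbers and contour integrals *)

Section ComplexNorm.
Variable R : realType.
Implicit Types (x y z : R[i]) (r : R).

Lemma normc_ge0 z : 0 <= normc z.
Proof. by case: z => a b; rewrite /normc sqrtr_ge0. Qed.

Lemma normcD x y : normc (x + y) <= normc x + normc y.
Proof. exact: le_normcD. Qed.

Lemma normcN x : normc (- x) = normc x.
Proof. exact: complex.normcN. Qed.

Lemma normcB x y : normc (x - y) <= normc x + normc y.
Proof. by rewrite -(normcN y); exact: normcD. Qed.

Lemma normc_distC x y : normc (x - y) = normc (y - x).
Proof. by rewrite -normcN opprB. Qed.

Lemma lerB_normc x y : normc x - normc y <= normc (x + y).
Proof. by rewrite lerBlDr -(normcN y); apply: le_trans (normcD _ _); rewrite addrK. Qed.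

Lemma normc_real r : normc r%:C = `|r|.
Proof. by rewrite /normc /= expr0n addr0 sqrtr_sqr. Qed.

Lemma normcX x n : normc (x ^+ n) = normc x ^+ n.
Proof. by elim: n => [|n IH]; rewrite ?expr0 ?normc1 // !exprS normcM IH. Qed.

Lemma normc_eq0 x : (normc x == 0) = (x == 0).
Proof. by apply/eqP/eqP => [/eq0_normc//|->]; rewrite normc0. Qed.

Lemma normc_gt0 x : (0 < normc x) = (x != 0).
Proof. by rewrite lt_def normc_eq0 normc_ge0 andbT. Qed.

Lemma normc_ge_Re z : `|Re z| <= normc z.
Proof. by have := complex.normc_ge_Re z; rewrite lecR. Qed.

Lemma normc_i : normc ('i : R[i]) = 1.
Proof. by rewrite /normc /= expr0n add0r expr1n sqrtr1. Qed.

Lemma normc_ge_Im z : `|Im z| <= normc z.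
Proof.
have := normc_ge_Re (z * 'i).
by rewrite normcM normc_i mulr1 ReiNIm normrN.
Qed.

Lemma normc_leD z : normc z <= `|Re z| + `|Im z|.
Proof.
rewrite [z in X in X <= _]complexE; apply: le_trans (normcD _ _) _.
by rewrite normcM normc_i mul1r !normc_real.
Qed.

Lemma normcE z : `|z| = (normc z)%:C.
Proof. by []. Qed.

Lemma complexD (a b c d : R) : (a +i* b) + (c +i* d) = (a + c) +i* (b + d).
Proof. by []. Qed.

Lemma complexB (a b c d : R) : (a +i* b) - (c +i* d) = (a - c) +i* (b - d).
Proof. by []. Qed.

Lemma ReD x y : Re (x + y) = Re x + Re y. Proof. by case: x; case: y. Qed.
Lemma ImD x y : Im (x + y) = Im x + Im y. Proof. by case: x; case: y. Qed.
Lemma ReN x : Re (- x) = - Re x. Proof. by case: x. Qed.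
Lemma ImN x : Im (- x) = - Im x. Proof. by case: x. Qed.

End ComplexNorm.

Section EpsDelta.
Variable R : realType.
Local Notation C := R[i].

Definition ccont (G : C -> C) (z : C) := forall e : R, 0 < e ->
  exists2 d : R, 0 < d & forall h, normc h <= d -> normc (G (z + h) - G z) <= e.

(** Complex differentiability in epsilon-delta form, with real epsilon and delta:
    the form in which contour integrals are estimated. [cdiffP] links it to
    [differentiable]. *)
Definition cdiff (G : C -> C) (z : C) := exists c : C, forall e : R, 0 < e ->
  exists2 d : R, 0 < d & forall h, normc h <= d ->
    normc (G (z + h) - G z - c * h) <= e * normc h.

Lemma cdiff_ccont G z : cdiff G z -> ccont G z.
Proof.
move=> [c Hc] e e0; have [d d0 Hd] := Hc 1 ltr01.
have N0 : 0 < normc c + 1 by rewrite ltr_wpDl// normc_ge0.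
exists (Num.min d (e / (normc c + 1))); first by rewrite lt_min d0 divr_gt0.
move=> h; rewrite le_min => /andP[h1 h2].
have -> : G (z + h) - G z = (G (z + h) - G z - c * h) + c * h by rewrite subrK.
apply: le_trans (normcD _ _) _; rewrite normcM.
apply: (le_trans (lerD (Hd _ h1) (lexx _))).
by rewrite -mulrDl addrC -ler_pdivlMl// mulrC.
Qed.

End EpsDelta.

Section SegmentIntegral.
Variable R : realType.
Local Notation C := R[i].
Local Notation mu := (@lebesgue_measure R).

Definition seg_cont (a b : R) (f : R -> C) :=
  {within `[a, b], continuous (fun x => Re (f x))} /\
  {within `[a, b], continuous (fun x => Im (f x))}.

Definition cint (a b : R) (f : R -> C) : C :=
  (\int[mu]_(x in `[a, b]) Re (f x)) +i* (\int[mu]_(x in `[a, b]) Im (f x)).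

Lemma within_integrable (a b : R) (f : R -> R) :
  {within `[a, b], continuous f} -> mu.-integrable `[a, b] (EFin \o f).
Proof. by move=> cf; apply: continuous_compact_integrable => //; exact: segment_compact. Qed.

Lemma cint_split a b c f : a <= b -> b <= c -> seg_cont a c f ->
  cint a c f = cint a b f + cint b c f.
Proof.
move=> ab bc [hr hi].
have key (g : R -> R) : {within `[a, c], continuous g} ->
    \int[mu]_(x in `[a, c]) g x = \int[mu]_(x in `[a, b]) g x + \int[mu]_(x in `[b, c]) g x.
  move=> cg; have ig := within_integrable cg.
  have := Rintegral_itvB ig (x := b).
  rewrite !bnd_simp => /(_ ab bc) /eqP; rewrite subr_eq => /eqP ->.
  rewrite addrC; congr (_ + _); apply: Rintegral_itv_obnd_cbnd.
  apply: integrableS ig => //; apply: subset_itv; rewrite bnd_simp //.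
by rewrite /cint complexD -!key.
Qed.

(** The factor 2 comes from bounding real and imaginary parts separately; every
    use below tolerates a constant factor. *)
Lemma cint_bound a b f M : a <= b -> seg_cont a b f ->
  (forall x, a <= x <= b -> normc (f x) <= M) ->
  normc (cint a b f) <= 2 * M * (b - a).
Proof.
move=> ab [hr hi] fM.
have key (g : R -> R) : {within `[a, b], continuous g} ->
    (forall x, a <= x <= b -> `|g x| <= M) ->
    `|\int[mu]_(x in `[a, b]) g x| <= M * (b - a).
  move=> cg gM; have ig := within_integrable cg.
  apply: le_trans (le_normr_Rintegral _ ig) _ => //.
  have -> : M * (b - a) = \int[mu]_(x in `[a, b]) M.
    rewrite Rintegral_cst//=; congr (_ * _).
    rewrite lebesgue_measure_itv/= lte_fin.
    by case: ltgtP ab => // -> _; rewrite subrr.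
  apply: le_Rintegral => //.
  - exact: (integrable_norm ig).
  - by apply: within_integrable => x; exact: cvg_cst.
apply: le_trans (normc_leD _) _ => /=.
rewrite -mulrA mulr_natl mulr2n; apply: lerD; apply: key => // x xab.
- exact: le_trans (normc_ge_Re _) (fM _ xab).
- exact: le_trans (normc_ge_Im _) (fM _ xab).
Qed.

Lemma seg_cont_cst a b k : seg_cont a b (fun=> k).
Proof. by split => x; exact: cvg_cst. Qed.

Lemma seg_contD a b f g : seg_cont a b f -> seg_cont a b g ->
  seg_cont a b (fun x => f x + g x).
Proof.
move=> [f1 f2] [g1 g2]; split.
- have -> : (fun x => Re (f x + g x)) = (fun x => Re (f x)) \+ (fun x => Re (g x)).
    by apply/funext => x; rewrite ReD.
  by move=> x; apply: continuousD; [exact: f1|exact: g1].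
- have -> : (fun x => Im (f x + g x)) = (fun x => Im (f x)) \+ (fun x => Im (g x)).
    by apply/funext => x; rewrite ImD.
  by move=> x; apply: continuousD; [exact: f2|exact: g2].
Qed.

Lemma seg_contN a b f : seg_cont a b f -> seg_cont a b (fun x => - f x).
Proof.
move=> [f1 f2]; split.
- have -> : (fun x => Re (- f x)) = \- (fun x => Re (f x)).
    by apply/funext => x; rewrite ReN.
  by move=> x; apply: continuousN; exact: f1.
- have -> : (fun x => Im (- f x)) = \- (fun x => Im (f x)).
    by apply/funext => x; rewrite ImN.
  by move=> x; apply: continuousN; exact: f2.
Qed.

Lemma cintD a b f g : seg_cont a b f -> seg_cont a b g ->
  cint a b (fun x => f x + g x) = cint a b f + cint a b g.
Proof.
move=> [f1 f2] [g1 g2]; rewrite /cint complexD.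
congr (_ +i* _).
- by rewrite -RintegralD//; try exact: within_integrable; apply: eq_Rintegral => x _; rewrite ReD.
- by rewrite -RintegralD//; try exact: within_integrable; apply: eq_Rintegral => x _; rewrite ImD.
Qed.

Lemma eq_cint a b f g : (forall x, a <= x <= b -> f x = g x) -> cint a b f = cint a b g.
Proof.
move=> fg; rewrite /cint; congr (_ +i* _); apply: eq_Rintegral => x;
  by rewrite inE/= in_itv/= => /fg ->.
Qed.

Lemma cintN a b f : seg_cont a b f -> cint a b (fun x => - f x) = - cint a b f.
Proof.
move=> cf; apply/eqP; rewrite -addr_eq0; apply/eqP.
rewrite -cintD//; last exact: seg_contN.
rewrite (@eq_cint _ _ _ (fun=> 0)); last by move=> x _; rewrite addNr.
by rewrite /cint /Rintegral !integral0.
Qed.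

Lemma cintB a b f g : seg_cont a b f -> seg_cont a b g ->
  cint a b (fun x => f x - g x) = cint a b f - cint a b g.
Proof. by move=> cf cg; rewrite cintD ?cintN//; exact: seg_contN. Qed.

Lemma cint_cst a b k : a <= b -> cint a b (fun=> k) = k * (b - a)%:C.
Proof.
move=> ab; rewrite /cint !Rintegral_cst//= lebesgue_measure_itv/= lte_fin.
have -> : fine (if (a < b)%R then (b%:E - a%:E)%E else 0%E) = b - a.
  by case: ltgtP ab => // -> _; rewrite subrr.
by case: k => k1 k2; simpc.
Qed.

Lemma cintZ a b f k : seg_cont a b f ->
  cint a b (fun x => k * f x) = k * cint a b f.
Proof.
move=> [f1 f2]; case: k => k1 k2; rewrite /cint.
have i1 := within_integrable f1; have i2 := within_integrable f2.
have iz (k : R) g : mu.-integrable `[a, b] (EFin \o g) ->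
    mu.-integrable `[a, b] (EFin \o (fun x => k * g x)).
  move=> ig; have -> : EFin \o (fun x => k * g x) = (fun x => k%:E * (EFin \o g) x)%E.
    by apply/funext => x.
  exact: integrableZl.
simpc; rewrite -!RintegralZl//; congr (_ +i* _).
- rewrite -RintegralB//; try exact: iz.
  by apply: eq_Rintegral => x _; case: (f x).
- rewrite -RintegralD//; try exact: iz.
  by apply: eq_Rintegral => x _; case: (f x).
Qed.

End SegmentIntegral.

Arguments Normc.normc : simpl never.
Arguments cint : simpl never.

(** * Goursat's theorem on rectangles *)

Section Goursat.
Variable R : realType.
Local Notation C := R[i].
Implicit Types (G : C -> C) (a b c d : R).

Lemma seg_cont_epsP a b (f : R -> C) :
  (forall x, a <= x <= b -> forall e : R, 0 < e -> exists2 r : R, 0 < r &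
     forall h, `|h| <= r -> normc (f (x + h) - f x) <= e) ->
  seg_cont a b f.
Proof.
move=> H.
have key (p : C -> R) : (forall z, `|p z| <= normc z) ->
    (forall z t, p (z - t) = p z - p t) ->
    {within `[a, b], continuous (fun x => p (f x))}.
  move=> p1 pB; apply: continuous_in_subspaceT => x.
  rewrite inE/= in_itv/= => xab; apply/cvgrPdist_le => e e0.
  have [r r0 Hr] := H x xab e e0.
  apply/nbhs_ballP; exists r => // t; rewrite /ball/= => xt.
  rewrite -pB; apply: le_trans (p1 _) _.
  rewrite normc_distC -[t](subrK x) [t - x + x]addrC; apply: Hr.
  by rewrite distrC ltW.
split; apply: key.
- exact: normc_ge_Re.
- by move=> z t; rewrite ReD ReN.
- exact: normc_ge_Im.
- by move=> z t; rewrite ImD ImN.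
Qed.

Lemma hseg_cont G a b y :
  (forall x, a <= x <= b -> ccont G (x +i* y)) -> seg_cont a b (fun x => G (x +i* y)).
Proof.
move=> H; apply: seg_cont_epsP => x xab e e0; have [r r0 Hr] := H x xab e e0.
exists r => // h hr; have -> : (x + h) +i* y = (x +i* y) + (h +i* 0) by rewrite complexD addr0.
by apply: Hr; rewrite normc_real.
Qed.

Lemma vseg_cont G c d x :
  (forall y, c <= y <= d -> ccont G (x +i* y)) -> seg_cont c d (fun y => G (x +i* y)).
Proof.
move=> H; apply: seg_cont_epsP => y ycd e e0; have [r r0 Hr] := H y ycd e e0.
exists r => // h hr; have -> : x +i* (y + h) = (x +i* y) + (0 +i* h) by rewrite complexD addr0.
by apply: Hr; rewrite /normc /= expr0n add0r sqrtr_sqr.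
Qed.

Definition on_rect a b c d (P : C -> Prop) :=
  forall x y, a <= x <= b -> c <= y <= d -> P (x +i* y).

(** The integral of G over the boundary of [a, b] x [c, d], counterclockwise. *)
Definition rint G a b c d : C :=
  cint a b (fun x => G (x +i* c) - G (x +i* d)) +
  'i * cint c d (fun y => G (b +i* y) - G (a +i* y)).

Arguments rint : simpl never.

Lemma on_rectW a b c d a' b' c' d' P : a <= a' -> b' <= b -> c <= c' -> d' <= d ->
  on_rect a b c d P -> on_rect a' b' c' d' P.
Proof. by move=> ? ? ? ? H x y /andP[? ?] /andP[? ?]; apply: H; apply/andP; split; lra. Qed.

Lemma rint_splitx G a m b c d : a <= m -> m <= b -> c <= d ->
  on_rect a b c d (ccont G) -> rint G a b c d = rint G a m c d + rint G m b c d.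
Proof.
move=> am mb cd cG.
have hc y : c <= y <= d -> seg_cont a b (fun x => G (x +i* y)).
  by move=> ?; apply: hseg_cont => x ?; apply: cG.
have vc x : a <= x <= b -> seg_cont c d (fun y => G (x +i* y)).
  by move=> ?; apply: vseg_cont => y ?; apply: cG.
rewrite /rint (cint_split am mb); last first.
  by apply: seg_contD; [|apply: seg_contN]; apply: hc; lra.
have [va vm vb] : [/\ seg_cont c d (fun y => G (a +i* y)),
    seg_cont c d (fun y => G (m +i* y)) & seg_cont c d (fun y => G (b +i* y))].
  by split; apply: vc; lra.
by rewrite (cintB vb va) (cintB vm va) (cintB vb vm); ring.
Qed.

Lemma rint_splity G a b c n d : a <= b -> c <= n -> n <= d ->
  on_rect a b c d (ccont G) -> rint G a b c d = rint G a b c n + rint G a b n d.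
Proof.
move=> ab cn nd cG.
have hc y : c <= y <= d -> seg_cont a b (fun x => G (x +i* y)).
  by move=> ?; apply: hseg_cont => x ?; apply: cG.
have vc x : a <= x <= b -> seg_cont c d (fun y => G (x +i* y)).
  by move=> ?; apply: vseg_cont => y ?; apply: cG.
rewrite /rint (cint_split cn nd); last first.
  by apply: seg_contD; [|apply: seg_contN]; apply: vc; lra.
have [va vm vb] : [/\ seg_cont a b (fun x => G (x +i* c)),
    seg_cont a b (fun x => G (x +i* n)) & seg_cont a b (fun x => G (x +i* d))].
  by split; apply: hc; lra.
by rewrite (cintB va vb) (cintB va vm) (cintB vm vb); ring.
Qed.

Lemma normc_pair (x y : R) : normc (x +i* y) <= `|x| + `|y|.
Proof. exact: normc_leD. Qed.

(** The affine part of G integrates to zero over the boundary, so only the error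
    of the linear approximation contributes. *)
Lemma rint_small G a b c d (p k : C) e : a <= b -> c <= d -> 0 <= e ->
  on_rect a b c d (ccont G) ->
  on_rect a b c d (fun z => normc (G z - G p - k * (z - p)) <= e) ->
  normc (rint G a b c d) <= 4 * e * ((b - a) + (d - c)).
Proof.
move=> ab cd e0 cG small.
have hc y : c <= y <= d -> seg_cont a b (fun x => G (x +i* y)).
  by move=> ?; apply: hseg_cont => x ?; apply: cG.
have vc x : a <= x <= b -> seg_cont c d (fun y => G (x +i* y)).
  by move=> ?; apply: vseg_cont => y ?; apply: cG.
pose E z := G z - G p - k * (z - p).
have eqh x : G (x +i* c) - G (x +i* d) = (E (x +i* c) - E (x +i* d)) + k * ((0 : R) +i* (c - d)).
  rewrite /E; have -> : (0 : R) +i* (c - d) = (x +i* c) - (x +i* d) by rewrite complexB subrr.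
  by ring.
have eqv y : G (b +i* y) - G (a +i* y) = (E (b +i* y) - E (a +i* y)) + k * ((b - a) +i* 0).
  rewrite /E; have -> : (b - a) +i* 0 = (b +i* y) - (a +i* y) by rewrite complexB subrr.
  by ring.
have Eh : seg_cont a b (fun x => E (x +i* c) - E (x +i* d)).
  have -> : (fun x => E (x +i* c) - E (x +i* d)) =
      (fun x => (G (x +i* c) - G (x +i* d)) - k * ((0 : R) +i* (c - d))).
    by apply/funext => x; rewrite eqh addrK.
  apply: seg_contD; last by apply: seg_contN; exact: seg_cont_cst.
  by apply: seg_contD; [|apply: seg_contN]; apply: hc; lra.
have Ev : seg_cont c d (fun y => E (b +i* y) - E (a +i* y)).
  have -> : (fun y => E (b +i* y) - E (a +i* y)) =
      (fun y => (G (b +i* y) - G (a +i* y)) - k * ((b - a) +i* 0)).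
    by apply/funext => x; rewrite eqv addrK.
  apply: seg_contD; last by apply: seg_contN; exact: seg_cont_cst.
  by apply: seg_contD; [|apply: seg_contN]; apply: vc; lra.
have -> : rint G a b c d = cint a b (fun x => E (x +i* c) - E (x +i* d)) +
    'i * cint c d (fun y => E (b +i* y) - E (a +i* y)).
  rewrite /rint.
  rewrite (eq_cint (fun x _ => eqh x)) (eq_cint (fun y _ => eqv y)).
  rewrite (cintD Eh (seg_cont_cst _ _ _)) (cintD Ev (seg_cont_cst _ _ _)).
  rewrite !cint_cst// mulrDr addrACA -[RHS]addr0; congr (_ + _).
  case: (k) => k1 k2; simpc; congr (_ +i* _); ring.
apply: le_trans (normcD _ _) _; rewrite normcM normc_i mul1r mulrDr.
have bd (u v : C) : normc u <= e -> normc v <= e -> normc (u - v) <= 2 * e.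
  by move=> u1 v1; apply: le_trans (normcB _ _) _; lra.
have -> : 4 * e = 2 * (2 * e) by ring.
apply: lerD; apply: cint_bound => //.
- by move=> x xab; apply: bd; apply: small => //; lra.
- by move=> y ycd; apply: bd; apply: small => //; lra.
Qed.

Lemma nested_point (u v : nat -> R) :
  (forall n, u n <= u n.+1) -> (forall n, v n.+1 <= v n) -> (forall n, u n <= v n) ->
  exists x, forall n, u n <= x <= v n.
Proof.
move=> ui vd uv.
have um : {homo u : m n / (m <= n)%N >-> m <= n}.
  by apply: homo_leq => //; exact: le_trans.
have vm : {homo v : m n / (m <= n)%N >-> n <= m}.
  by apply: (homo_leq (r := fun x y => y <= x)) => // x y z h1 h2; exact: le_trans h2 h1.
have ub m : ubound (range u) (v m).
  move=> _ [n _ <-]; have [mn|nm] := leP m n.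
    by apply: le_trans (uv n) _; exact: vm.
  by apply: le_trans (um _ _ (ltnW nm)) _; exact: uv.
exists (sup (range u)) => n; apply/andP; split.
- by apply: ub_le_sup; [exists (v 0%N); exact: ub|exists n].
- by apply: ge_sup; [exists (u 0%N); exists 0%N|exact: ub].
Qed.

Lemma pow2_large (S r : R) : 0 < r -> exists n, S / 2 ^+ n <= r.
Proof.
move=> r0; exists (Num.bound (S / r)).
have -> : S / 2 ^+ Num.bound (S / r) <= r = (S / r <= 2 ^+ Num.bound (S / r)).
  by rewrite ler_pdivrMr ?exprn_gt0// ler_pdivrMr// mulrC.
have [s0|s0] := leP 0 (S / r).
  by apply: le_trans (ltW (archi_boundP s0)) _; rewrite -natrX ler_nat ltnW// ltn_expl.
by apply: le_trans (ltW s0) _; rewrite exprn_ge0.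
Qed.

(** Bisection: if the integral were nonzero, nested rectangles with sides shrinking
    like 2^-n would carry an integral of size at least M / 4^n, while
    differentiability at their common point makes it o(4^-n). *)
Lemma goursat G a b c d : a <= b -> c <= d ->
  on_rect a b c d (cdiff G) -> rint G a b c d = 0.
Proof.
move=> ab cd dG; apply/eqP; rewrite -normc_eq0; apply/negPn/negP => M0.
have {M0} : 0 < normc (rint G a b c d) by rewrite lt_def M0 normc_ge0.
set M := normc _ => M0.
have cG : on_rect a b c d (ccont G) by move=> x y ? ?; apply/cdiff_ccont/dG.
pose S := (b - a) + (d - c).
pose P n (q : R * R * R * R) :=
  [/\ a <= q.1.1.1 /\ q.1.1.2 <= b, c <= q.1.2 /\ q.2 <= d,
      q.1.1.2 - q.1.1.1 = (b - a) / 2 ^+ n, q.2 - q.1.2 = (d - c) / 2 ^+ n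
    & M / 4 ^+ n <= normc (rint G q.1.1.1 q.1.1.2 q.1.2 q.2)].
pose sub (q q' : R * R * R * R) :=
  [/\ q.1.1.1 <= q'.1.1.1, q'.1.1.2 <= q.1.1.2, q.1.2 <= q'.1.2 & q'.2 <= q.2].
have len n : 0 <= (b - a) / 2 ^+ n /\ 0 <= (d - c) / 2 ^+ n.
  by split; rewrite divr_ge0 ?exprn_ge0// subr_ge0.
have step n q : exists q', P n q -> P n.+1 q' /\ sub q q'.
  have [|nP] := pselect (P n q); last by exists q.
  case: q => [[[x1 x2] y1] y2] [/= [h1 h2] [h3 h4] hx hy hM].
  have [lx ly] := len n.
  pose m := (x1 + x2) / 2; pose k := (y1 + y2) / 2.
  have m1 : m - x1 = (b - a) / 2 ^+ n.+1 by rewrite exprS invfM mulrCA -hx /m; field.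
  have m2 : x2 - m = (b - a) / 2 ^+ n.+1 by rewrite exprS invfM mulrCA -hx /m; field.
  have k1 : k - y1 = (d - c) / 2 ^+ n.+1 by rewrite exprS invfM mulrCA -hy /k; field.
  have k2 : y2 - k = (d - c) / 2 ^+ n.+1 by rewrite exprS invfM mulrCA -hy /k; field.
  have [lx' ly'] := len n.+1.
  have x1m : x1 <= m by rewrite -subr_ge0 m1.
  have mx2 : m <= x2 by rewrite -subr_ge0 m2.
  have y1k : y1 <= k by rewrite -subr_ge0 k1.
  have ky2 : k <= y2 by rewrite -subr_ge0 k2.
  clearbody m k.
  have eq4 : rint G x1 x2 y1 y2 = rint G x1 m y1 k + rint G x1 m k y2 +
      (rint G m x2 y1 k + rint G m x2 k y2).
    have y12 := le_trans y1k ky2.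
    have c1 : on_rect x1 x2 y1 y2 (ccont G) by apply: on_rectW cG.
    rewrite (rint_splitx x1m mx2 y12 c1).
    rewrite (rint_splity x1m y1k ky2); last exact: on_rectW c1.
    by rewrite (rint_splity mx2 y1k ky2)//; exact: on_rectW c1.
  have M4 : M / 4 ^+ n.+1 = (M / 4 ^+ n) / 4 by rewrite exprS invfM; ring.
  (* one of the four quarters keeps a quarter of the integral *)
  have [b1|b1] := leP (M / 4 ^+ n.+1) (normc (rint G x1 m y1 k)).
    exists (x1, m, y1, k) => _; split; split => //=.
    - exact: (conj (h1) (le_trans mx2 h2)).
    - exact: (conj (h3) (le_trans ky2 h4)).
  have [b2|b2] := leP (M / 4 ^+ n.+1) (normc (rint G x1 m k y2)).
    exists (x1, m, k, y2) => _; split; split => //=.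
    - exact: (conj (h1) (le_trans mx2 h2)).
    - exact: (conj (le_trans h3 y1k) (h4)).
  have [b3|b3] := leP (M / 4 ^+ n.+1) (normc (rint G m x2 y1 k)).
    exists (m, x2, y1, k) => _; split; split => //=.
    - exact: (conj (le_trans h1 x1m) (h2)).
    - exact: (conj (h3) (le_trans ky2 h4)).
  have [b4|b4] := leP (M / 4 ^+ n.+1) (normc (rint G m x2 k y2)).
    exists (m, x2, k, y2) => _; split; split => //=.
    - exact: (conj (le_trans h1 x1m) (h2)).
    - exact: (conj (le_trans h3 y1k) (h4)).
  exfalso; move: hM; rewrite leNgt => /negP; apply.
  rewrite eq4; apply: le_lt_trans (normcD _ _) _.
  apply: le_lt_trans (lerD (normcD _ _) (normcD _ _)) _.
  move: b1 b2 b3 b4; rewrite M4; move: (M / 4 ^+ n) (normc (rint G x1 m y1 k))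
    (normc (rint G x1 m k y2)) (normc (rint G m x2 y1 k)) (normc (rint G m x2 k y2)).
  by clear => y n1 n2 n3 n4 *; lra.
have [f Hf] := choice (fun nq : nat * (R * R * R * R) => step nq.1 nq.2).
pose q := fix q n := if n is m.+1 then f (m, q m) else (a, b, c, d).
have Pq n : P n (q n).
  elim: n => [|n IH]; last by have [] := Hf (n, q n) IH.
  by split; rewrite /= ?expr0 ?divr1 ?lexx.
have Sq n : sub (q n) (q n.+1) by have [] := Hf (n, q n) (Pq n).
have [x Hx] : exists x, forall n, (q n).1.1.1 <= x <= (q n).1.1.2.
  apply: nested_point => n; try by have [] := Sq n.
  by have [_ _ e1 _ _] := Pq n; have [] := len n; lra.
have [y Hy] : exists y, forall n, (q n).1.2 <= y <= (q n).2.
  apply: nested_point => n; try by have [] := Sq n.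
  by have [_ _ _ e1 _] := Pq n; have [] := len n; lra.
have [k Hk] := dG x y (Hx 0%N) (Hy 0%N).
have S0 : 0 <= S by rewrite /S; lra.
have N0 : 0 < 4 * S ^+ 2 + 1 by rewrite ltr_wpDl// mulr_ge0// sqr_ge0.
(* with this e, [rint_small] bounds the n-th integral by less than M / 4^n *)
pose e := M / (4 * S ^+ 2 + 1).
have e0 : 0 < e by rewrite divr_gt0.
have [r r0 Hr] := Hk e e0.
have [n Hn] := pow2_large S r0.
have [[q1 q2] [q3 q4] q5 q6 q7] := Pq n.
have Sn : (b - a) / 2 ^+ n + (d - c) / 2 ^+ n = S / 2 ^+ n by rewrite -mulrDl.
have Sn0 : 0 <= S / 2 ^+ n by rewrite -Sn; have [] := len n; lra.
have small : on_rect (q n).1.1.1 (q n).1.1.2 (q n).1.2 (q n).2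
    (fun z => normc (G z - G (x +i* y) - k * (z - (x +i* y))) <= e * (S / 2 ^+ n)).
  move=> s t sx ty; have hN : normc ((s +i* t) - (x +i* y)) <= S / 2 ^+ n.
    rewrite complexB; apply: le_trans (normc_pair _ _) _; rewrite -Sn.
    have hx := Hx n; have hy := Hy n; clear -hx hy q5 q6 sx ty.
    by apply: lerD; rewrite ler_norml; lra.
  have := Hr ((s +i* t) - (x +i* y)) (le_trans hN Hn); rewrite [X in G X]addrC subrK => h.
  by apply: le_trans h _; rewrite ler_wpM2l// ltW.
have [l1 l2] := len n.
have := @rint_small G _ _ _ _ _ _ (e * (S / 2 ^+ n)) _ _ _ _ small.
have es0 : 0 <= e * (S / 2 ^+ n) by rewrite mulr_ge0// ltW.
rewrite q5 q6 Sn => /(_ _ _ es0) H; apply/negP: M0; rewrite -leNgt.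
have {}H : M / 4 ^+ n <= 4 * (e * (S / 2 ^+ n)) * (S / 2 ^+ n).
  apply: le_trans q7 _; apply: H; last by apply: on_rectW cG.
  - by rewrite -subr_ge0 q5.
  - by rewrite -subr_ge0 q6.
have e4 : 4 * (e * (S / 2 ^+ n)) * (S / 2 ^+ n) = (4 * e * S ^+ 2) / 4 ^+ n.
  have -> : (4 : R) ^+ n = 2 ^+ n * 2 ^+ n by rewrite -exprMn; congr (_ ^+ _); ring.
  by field; rewrite expf_eq0 pnatr_eq0 andbF.
move: H; rewrite e4 ler_pM2r ?invr_gt0 ?exprn_gt0// /e => H.
have : M * (4 * S ^+ 2 + 1) <= 4 * M * S ^+ 2.
  by rewrite -ler_pdivlMr//; apply: le_trans H _; rewrite le_eqVlt; apply/orP; left; apply/eqP; ring.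
lra.
Qed.

End Goursat.

Arguments rint : simpl never.

(** * Complex differentiability, the exponential and circles *)

Section DerivableEps.
Variable K : numFieldType.

Lemma derivable_eps (f : K -> K^o) (a : K) : derivable f a 1 ->
  forall e : K, 0 < e -> exists2 d : K, 0 < d &
    forall h, `|h| < d -> `|f (a + h) - f a - ('D_1 f a) * h| <= e * `|h|.
Proof.
move=> df e e0.
have /cvgrPdist_le /(_ e e0) : h^-1 *: ((f \o shift a) (h *: (1:K)) - f a) @[h --> 0^'] --> 'D_1 f a by exact: df.
move=> /nbhs_ballP [d d0 Hd]; exists d => // h hd.
have [->|h0] := eqVneq h 0; first by rewrite addr0 subrr mulr0 subrr normr0 mulr0.
have := Hd h; rewrite /ball/= sub0r normrN => /(_ hd h0).
rewrite /GRing.scale/= mulr1 => H.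
have -> : f (a + h) - f a - 'D_1 f a * h = - (('D_1 f a - h^-1 * (f (h + a) - f a)) * h).
  by rewrite mulrBl mulrAC mulVf// mul1r opprB addrC [h + a]addrC addrC.
by rewrite normrN normrM ler_wpM2r.
Qed.

Lemma eps_derivable (f : K -> K^o) (a c : K) :
  (forall e : K, 0 < e -> exists2 d : K, 0 < d &
    forall h, `|h| < d -> `|f (a + h) - f a - c * h| <= e * `|h|) -> derivable f a 1.
Proof.
move=> H; apply/cvg_ex; exists c; apply/cvgrPdist_le => e e0.
have [d d0 Hd] := H e e0; apply/nbhs_ballP; exists d => // h'.
have key (h : K) : `|h| < d -> h != 0 -> `|c - h^-1 * (f (h + a) - f a : K)| <= e.
  move=> hd h0; have hp : 0 < `|h| by rewrite normr_gt0.
  rewrite -(ler_pM2r hp); apply: le_trans (Hd h hd).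
  rewrite -normrM -normrN mulrBl mulrAC mulVf// mul1r opprB.
  by rewrite [X in f X]addrC lexx.
rewrite /ball/= sub0r normrN => hd h0.
by rewrite /GRing.scale/= mulr1; exact: key.
Qed.

End DerivableEps.

Section Bridge.
Variable R : realType.
Local Notation C := R[i].

Lemma ltc_real (e : C) : 0 < e -> 0 < Re e /\ e = (Re e)%:C.
Proof. by case: e => x y; rewrite ltcE/= => /andP[/eqP -> x0]. Qed.

Lemma cdiffP (G : C -> C) z : cdiff G z <-> differentiable (G : C^o -> C^o) (z : C^o).
Proof.
rewrite -derivable1_diffP; split.
- move=> [c Hc]; apply: (@eps_derivable _ _ _ c) => e /ltc_real[e0 ->].
  have [d d0 Hd] := Hc _ e0; exists d%:C; first by rewrite ltcR.
  by move=> h; rewrite !normcE ltcR => /ltW/Hd; rewrite -rmorphM lecR.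
- move=> dG; exists ('D_1 (G : C^o -> C^o) (z : C^o)) => e e0.
  have [|d /ltc_real[d0 ->] Hd] := derivable_eps dG (e := e%:C); first by rewrite ltcR.
  exists (Re d / 2); first by rewrite divr_gt0.
  move=> h hd; have := Hd h; rewrite !normcE ltcR -rmorphM lecR; apply.
  by apply: le_lt_trans hd _; rewrite ltr_pdivrMr// ltr_pMr// ltr1n.
Qed.

Lemma is_derive_eps (f : R -> R) (a c : R) : is_derive a 1 f c ->
  forall e : R, 0 < e -> exists2 d : R, 0 < d &
    forall h, `|h| < d -> `|f (a + h) - f a - c * h| <= e * `|h|.
Proof.
move=> fc e e0; have := derivable_eps (@ex_derive _ _ _ _ _ _ _ fc) e0.
by rewrite (@derive_val _ _ _ _ _ _ _ fc).
Qed.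

Lemma ccont_comp (G H : C -> C) z : ccont H z -> ccont G (H z) -> ccont (G \o H) z.
Proof.
move=> cH cG e e0; have [d d0 Hd] := cG e e0; have [r r0 Hr] := cH d d0.
exists r => // h hr /=; have -> : H (z + h) = H z + (H (z + h) - H z) by rewrite [RHS]addrC subrK.
by apply: Hd; exact: Hr.
Qed.

Lemma cdiff_comp (G H : C -> C) z : cdiff H z -> cdiff G (H z) -> cdiff (G \o H) z.
Proof.
move=> /cdiffP dH /cdiffP dG; apply/cdiffP.
exact: (@differentiable_comp _ C^o C^o C^o _ _ _ dH dG).
Qed.

Lemma cdiff_cst k z : cdiff (fun=> k : C) z.
Proof. by apply/cdiffP; exact: differentiable_cst. Qed.

Lemma cdiff_id z : cdiff (id : C -> C) z.
Proof. by exists 1 => e e0; exists 1 => // h _; rewrite mul1r [z + h]addrC addrK subrr normc0 mulr_ge0 ?normc_ge0// ltW. Qed.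

Lemma cdiffD (G H : C -> C) z : cdiff G z -> cdiff H z -> cdiff (fun x => G x + H x) z.
Proof. by move=> /cdiffP dG /cdiffP dH; apply/cdiffP; exact: (differentiableD dG dH). Qed.

Lemma cdiffM (G H : C -> C) z : cdiff G z -> cdiff H z -> cdiff (fun x => G x * H x) z.
Proof. by move=> /cdiffP dG /cdiffP dH; apply/cdiffP; exact: (differentiableM dG dH). Qed.

Lemma cdiffX (G : C -> C) n z : cdiff G z -> cdiff (fun x => G x ^+ n) z.
Proof.
move=> dG; elim: n => [|n IH]; first exact: cdiff_cst.
have -> : (fun x => G x ^+ n.+1) = (fun x => G x * G x ^+ n) by apply/funext => x; rewrite exprS.
exact: cdiffM.
Qed.

Lemma cdiffV (G : C -> C) z : G z != 0 -> cdiff G z -> cdiff (fun x => (G x)^-1) z.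
Proof. by move=> G0 /cdiffP dG; apply/cdiffP; exact: (differentiableV dG G0). Qed.

Lemma cdiff_eq_near (G H : C -> C) z (r : R) : 0 < r ->
  (forall h, normc h <= r -> G (z + h) = H (z + h)) -> cdiff G z -> cdiff H z.
Proof.
move=> r0 GH [c Hc]; exists c => e e0; have [d d0 Hd] := Hc e e0.
exists (Num.min d r); first by rewrite lt_min d0.
move=> h; rewrite le_min => /andP[h1 h2]; rewrite -GH//.
by rewrite -{2}(addr0 z) -GH ?addr0 ?normc0 ?(ltW r0)//; apply: Hd.
Qed.

Definition cexp (z : C) : C := (expR (Re z))%:C * (cos (Im z) +i* sin (Im z)).

Lemma cexpE (x y : R) : cexp (x +i* y) = (expR x * cos y) +i* (expR x * sin y).
Proof. by rewrite /cexp/=; simpc. Qed.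

Lemma cexpD z w : cexp (z + w) = cexp z * cexp w.
Proof.
case: z => a b; case: w => c d; rewrite complexD !cexpE.
rewrite expRD cosD sinD; simpc; congr (_ +i* _); ring.
Qed.

Lemma normc_cexp z : normc (cexp z) = expR (Re z).
Proof.
rewrite /cexp normcM normc_real ger0_norm ?expR_ge0// /normc cos2Dsin2.
by rewrite sqrtr1 mulr1.
Qed.

(** It suffices to differentiate at 0, by the functional equation; there the
    expansion follows from those of the real exponential, cosine and sine. *)
Lemma cdiff_cexp z : cdiff cexp z.
Proof.
suff H : forall e : R, 0 < e -> exists2 d : R, 0 < d & forall h, normc h <= d ->
    normc (cexp h - 1 - h) <= e * normc h.
  exists (cexp z) => e e0.
  have p0 : 0 < expR (Re z) by exact: expR_gt0.
  have [d d0 Hd] := H (e / expR (Re z)) (divr_gt0 e0 p0).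
  exists d => // h hd; rewrite cexpD.
  have -> : cexp z * cexp h - cexp z - cexp z * h = cexp z * (cexp h - 1 - h) by ring.
  rewrite normcM normc_cexp; apply: le_trans (ler_wpM2l (ltW p0) (Hd h hd)) _.
  by rewrite mulrA mulrCA divff ?mulr1// gt_eqF.
move=> e0 e0p; pose e := Num.min 1 (e0 / 10).
have e1 : e <= 1 by rewrite /e ge_min lexx.
have ee0 : 10 * e <= e0.
  by rewrite mulrC -ler_pdivlMr// /e ge_min lexx orbT.
have ep : 0 < e by rewrite lt_min ltr01 divr_gt0.
clearbody e.
have [d1 d10 H1] := is_derive_eps (is_derive_expR (0 : R)) ep.
have [d2 d20 H2] := is_derive_eps (is_derive_cos (0 : R)) ep.
have [d3 d30 H3] := is_derive_eps (is_derive_sin (0 : R)) ep.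
exists (Num.min (Num.min (d1 / 2) (d2 / 2)) (Num.min (d3 / 2) e)).
  by rewrite !lt_min ep !divr_gt0.
move=> [x y]; rewrite !le_min => /andP[/andP[h1 h2] /andP[h3 he]].
have xh : `|x| <= normc (x +i* y) by exact: (normc_ge_Re (x +i* y)).
have yh : `|y| <= normc (x +i* y) by exact: (normc_ge_Im (x +i* y)).
set n := normc _ in h1 h2 h3 he xh yh *.
have {}H1 : `|expR x - 1 - x| <= e * n.
  have := H1 x; rewrite add0r expR0 mul1r => H; apply: le_trans (H _) _; first lra.
  by rewrite ler_wpM2l// ltW.
have {}H2 : `|cos y - 1| <= e * n.
  have := H2 y; rewrite add0r cos0 sin0 oppr0 mul0r subr0 => H; apply: le_trans (H _) _; first lra.
  by rewrite ler_wpM2l// ltW.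
have {}H3 : `|sin y - y| <= e * n.
  have := H3 y; rewrite add0r sin0 cos0 mul1r subr0 => H; apply: le_trans (H _) _; first lra.
  by rewrite ler_wpM2l// ltW.
have n0 : 0 <= n by exact: normc_ge0.
have en1 : e * n <= n by rewrite ler_piMl.
have en : e * n <= 1 by lra.
have E2 : `|expR x - 1| <= 2 * n.
  have -> : expR x - 1 = (expR x - 1 - x) + x by ring.
  by apply: le_trans (ler_normD _ _) _; lra.
have E1 : `|expR x| <= 3.
  have -> : expR x = (expR x - 1) + 1 by ring.
  apply: le_trans (ler_normD _ _) _; rewrite normr1; lra.
rewrite cexpE (_ : (1 : C) = 1 +i* 0)// !complexB.
apply: le_trans (normc_pair _ _) _; rewrite subr0.
have -> : expR x * cos y - 1 - x = expR x * (cos y - 1) + (expR x - 1 - x) by ring.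
have -> : expR x * sin y - y = expR x * (sin y - y) + (expR x - 1) * y by ring.
have B1 : `|expR x * (cos y - 1)| <= 3 * (e * n) by rewrite normrM ler_pM.
have B2 : `|expR x * (sin y - y)| <= 3 * (e * n) by rewrite normrM ler_pM.
have B3 : `|(expR x - 1) * y| <= 2 * (e * n).
  rewrite normrM mulrC (_ : 2 * (e * n) = e * (2 * n)); last by ring.
  by rewrite ler_pM//; apply: le_trans yh he.
apply: le_trans (lerD (ler_normD _ _) (ler_normD _ _)) _.
apply: (@le_trans _ _ (10 * e * n)); last by rewrite ler_wpM2r.
have en0 : 0 <= e * n by rewrite mulr_ge0// ltW.
rewrite -mulrA; lra.
Qed.

Lemma cexp_per x : cexp (x +i* pi) = cexp (x +i* (- pi)).
Proof. by rewrite !cexpE cosN sinN sinpi oppr0. Qed.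

Lemma cexp_pos (x y : R) t : - pi <= y <= pi -> cexp (x +i* y) = t%:C -> 0 < t ->
  x = ln t /\ y = 0.
Proof.
move=> ypi e t0; have ex : expR x = t.
  by have := normc_cexp (x +i* y); rewrite e normc_real gtr0_norm.
split; first by rewrite -ex expRK.
move: e; rewrite cexpE => -[e _].
have c1 : cos y = 1 by apply: (mulfI (lt0r_neq0 t0)); rewrite -{1}ex e mulr1.
have c2 : cos `|y| = cos 0.
  by rewrite cos0 -c1; case: (ger0P y) => // _; rewrite cosN.
apply/eqP; rewrite -normr_eq0; apply/eqP; apply: cos_inj c2; rewrite in_itv/=.
- by rewrite normr_ge0 ler_norml.
- by rewrite lexx pi_ge0.
Qed.

(** Continuity is enough at an isolated point: by Goursat the integral reduces
    to that over a tiny square around the point, where G is bounded. *)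
Lemma goursat_except (G : C -> C) a b c d (p q : R) : a < p < b -> c < q < d ->
  on_rect a b c d (ccont G) ->
  on_rect a b c d (fun z => z != p +i* q -> cdiff G z) -> rint G a b c d = 0.
Proof.
move=> /andP[ap pb] /andP[cq qd] cG dG; apply/eqP; rewrite -normc_eq0.
have small n0 : 0 < n0 -> normc (rint G a b c d) <= n0.
  move=> n0p; have [||r r0 Hr] := cG p q _ _ 1 ltr01; try by rewrite !ltW.
  pose h := Num.min (Num.min (Num.min (p - a) (b - p)) (Num.min (q - c) (d - q)))
    (Num.min (r / 2) (n0 / 16)).
  have h0 : 0 < h by rewrite !lt_min !subr_gt0 ap pb cq qd !divr_gt0.
  have [ha hb hc hd] : [/\ h <= p - a, h <= b - p, h <= q - c & h <= d - q].
    by rewrite /h; split; rewrite !ge_min lexx ?orbT.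
  have [hr hn] : h <= r / 2 /\ h <= n0 / 16.
    by rewrite /h; split; rewrite !ge_min lexx ?orbT.
  clearbody h.
  have aph : a <= p - h by lra.
  have pph : p - h <= p + h by lra.
  have phb : p + h <= b by lra.
  have cqh : c <= q - h by lra.
  have qqh : q - h <= q + h by lra.
  have qhd : q + h <= d by lra.
  have cd : c <= d by lra.
  rewrite (rint_splitx aph (le_trans pph phb) cd cG).
  have cG1 : on_rect (p - h) b c d (ccont G) by apply: on_rectW cG.
  rewrite (rint_splitx pph phb cd cG1).
  have cG2 : on_rect (p - h) (p + h) c d (ccont G) by apply: on_rectW cG1.
  rewrite (rint_splity pph cqh (le_trans qqh qhd) cG2).
  have cG3 : on_rect (p - h) (p + h) (q - h) d (ccont G) by apply: on_rectW cG2.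
  rewrite (rint_splity pph qqh qhd cG3).
  have neqx (x y : R) : x != p -> x +i* y != p +i* q by move=> xp; rewrite eq_complex/= negb_and xp.
  have neqy (x y : R) : y != q -> x +i* y != p +i* q by move=> xp; rewrite eq_complex/= negb_and xp orbT.
  rewrite (@goursat _ _ a)//; last first.
    move=> x y /andP[x1 x2] /andP[y1 y2]; apply: dG; first by apply/andP; split; lra.
    - by rewrite y1 y2.
    - by apply: neqx; apply/eqP; lra.
  rewrite (@goursat _ _ (p + h))//; last first.
    move=> x y /andP[x1 x2] /andP[y1 y2]; apply: dG; first by apply/andP; split; lra.
    - by rewrite y1 y2.
    - by apply: neqx; apply/eqP; lra.
  rewrite (@goursat _ _ _ _ c)//; last first.
    move=> x y /andP[x1 x2] /andP[y1 y2]; apply: dG; first by apply/andP; split; lra.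
    - by apply/andP; split; lra.
    - by apply: neqy; apply/eqP; lra.
  rewrite (@goursat _ _ _ _ (q + h))//; last first.
    move=> x y /andP[x1 x2] /andP[y1 y2]; apply: dG; first by apply/andP; split; lra.
    - by apply/andP; split; lra.
    - by apply: neqy; apply/eqP; lra.
  rewrite !(add0r, addr0).
  have := @rint_small _ G (p - h) (p + h) (q - h) (q + h) (p +i* q) 0 1 pph qqh ler01.
  move=> /(_ _ _)/le_trans; apply.
  - by apply: on_rectW cG3.
  - move=> x y xh yh; rewrite mul0r subr0.
    have -> : x +i* y = (p +i* q) + ((x +i* y) - (p +i* q)) by rewrite [RHS]addrC subrK.
    apply: Hr.
    rewrite complexB; apply: le_trans (normc_pair _ _) _.
    have : `|x - p| <= h by rewrite ler_norml; lra.
    have : `|y - q| <= h by rewrite ler_norml; lra.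
    lra.
  - lra.
have n0 := normc_ge0 (rint G a b c d).
rewrite eq_le n0 andbT leNgt; apply/negP => n1.
by have := small (normc (rint G a b c d) / 2) (divr_gt0 n1 (ltr0n _ 2)); lra.
Qed.

(** The integral of G z dz / (i z) over the circle of radius e^x. *)
Definition circ (G : C -> C) (x : R) : C := cint (- pi) pi (fun y => G (cexp (x +i* y))).

(** In the logarithmic coordinate x + i y an annulus is a rectangle, and by
    periodicity its two horizontal sides cancel. The exceptional point is to be
    the pole removed in Cauchy's formula. *)
Lemma circ_const (G : C -> C) x1 x2 t : 0 < t -> x1 < ln t < x2 ->
  (forall z, expR x1 <= normc z <= expR x2 -> ccont G z) ->
  (forall z, expR x1 <= normc z <= expR x2 -> z != t%:C -> cdiff G z) ->
  circ G x1 = circ G x2.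
Proof.
move=> t0 x12 cG dG; have pi0 := pi_gt0 R.
have rng x y : x1 <= x <= x2 -> expR x1 <= normc (cexp (x +i* y)) <= expR x2.
  by rewrite normc_cexp !ler_expR.
have x12' : x1 <= x1 <= x2 by rewrite lexx /=; lra.
have x12'' : x1 <= x2 <= x2 by rewrite lexx andbT; lra.
have cGe : on_rect x1 x2 (- pi) pi (ccont (G \o cexp)).
  move=> x y xx yy; apply: ccont_comp; first exact/cdiff_ccont/cdiff_cexp.
  by apply: cG; exact: rng.
have : rint (G \o cexp) x1 x2 (- pi) pi = 0.
  apply: (@goursat_except _ _ _ _ _ (ln t) 0) => //; first by rewrite oppr_lt0 pi0.
  move=> x y xx yy xy; apply: cdiff_comp; first exact: cdiff_cexp.
  apply: dG; first exact: rng.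
  by apply/eqP => /(cexp_pos yy)/(_ t0)[xt y0]; move: xy; rewrite xt y0 eqxx.
rewrite /rint (@eq_cint _ _ _ _ (fun=> 0)); last by move=> x _ /=; rewrite -cexp_per subrr.
rewrite cint_cst ?mul0r ?add0r; last by lra.
have i0 : ('i : C) != 0 by rewrite -normc_eq0 normc_i oner_eq0.
move=> /eqP; rewrite mulf_eq0 (negbTE i0) orFb.
rewrite cintB; [|apply: vseg_cont..]; first by rewrite subr_eq0 eq_sym => /eqP.
- by move=> y yy; exact: cGe.
- by move=> y yy; exact: cGe.
Qed.

End Bridge.

(** * A Cauchy estimate on annuli *)

Section Annulus.
Variable R : realType.
Local Notation C := R[i].

Lemma circ_seg (G : C -> C) x : (forall z, normc z = expR x -> ccont G z) ->
  seg_cont (- pi) pi (fun y => G (cexp (x +i* y))).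
Proof.
move=> cG; apply: (@vseg_cont _ (G \o @cexp R)) => y _.
by apply: ccont_comp; [exact/cdiff_ccont/cdiff_cexp|apply: cG; rewrite normc_cexp].
Qed.

Lemma circ_near (G : C -> C) x k M : (forall z, normc z = expR x -> ccont G z) ->
  (forall z, normc z = expR x -> normc (G z - k) <= M) ->
  normc (circ G x - k * (2 * pi)%:C) <= 2 * M * (2 * pi).
Proof.
move=> cG GM; have pi0 := pi_gt0 R; have pp : - pi <= pi :> R by lra.
have e2 : 2 * pi = pi - - pi :> R by ring.
have -> : k * (2 * pi)%:C = cint (- pi) pi (fun=> k) by rewrite cint_cst// e2.
rewrite /circ -cintB; [|exact: circ_seg|exact: seg_cont_cst].
rewrite e2; apply: cint_bound => //.
  by apply: seg_contD; [exact: circ_seg|apply: seg_contN; exact: seg_cont_cst].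
by move=> y _; apply: GM; rewrite normc_cexp.
Qed.

Lemma circ_bound (G : C -> C) x M : (forall z, normc z = expR x -> ccont G z) ->
  (forall z, normc z = expR x -> normc (G z) <= M) ->
  normc (circ G x) <= 2 * M * (2 * pi).
Proof.
move=> cG GM; have := @circ_near G x 0 M cG; rewrite mul0r subr0; apply => z zx.
by rewrite subr0; exact: GM.
Qed.

Lemma circ_hol (G : C -> C) x1 x2 : x1 <= x2 ->
  (forall z, expR x1 <= normc z <= expR x2 -> cdiff G z) -> circ G x1 = circ G x2.
Proof.
rewrite le_eqVlt => /predU1P[->//|x12] dG.
apply: (@circ_const _ _ _ _ (expR ((x1 + x2) / 2))); first exact: expR_gt0.
- by rewrite expRK; apply/andP; split; lra.
- by move=> z zx; apply/cdiff_ccont/dG.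
- by move=> z zx _; exact: dG.
Qed.

(** The Cauchy kernel for the measure dz / (i z) used by [circ]. *)
Definition kernel (t : R) (z : C) : C := z / (z - t%:C).

Lemma sub_real_neq0 (t : R) z : 0 < t -> normc z != t -> z - t%:C != 0.
Proof.
by move=> t0; apply: contra_neq => /eqP; rewrite subr_eq0 => /eqP ->; rewrite normc_real gtr0_norm.
Qed.

Lemma cdiff_kernel t z : z - t%:C != 0 -> cdiff (kernel t) z.
Proof.
move=> zt; apply: cdiffM; first exact: cdiff_id.
by apply: cdiffV => //; apply: cdiffD; [exact: cdiff_id|exact: cdiff_cst].
Qed.

Lemma kernel_bound t z : 0 < t -> normc z != t ->
  normc (kernel t z) <= normc z / `|normc z - t|.
Proof.
move=> t0 zt; rewrite /kernel normcM normcV ler_wpM2l ?normc_ge0//.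
rewrite lef_pV2 ?posrE ?normr_gt0 ?subr_eq0//; last first.
  by rewrite normc_gt0 sub_real_neq0.
have h1 : normc z <= normc (z - t%:C) + t.
  by rewrite -{1}[z](subrK t%:C); apply: le_trans (normcD _ _) _; rewrite normc_real gtr0_norm.
have h2 : t <= normc (z - t%:C) + normc z.
  rewrite -{1}(gtr0_norm t0) -normc_real -{1}[t%:C](subrK z) normc_distC; exact: normcD.
by rewrite ler_norml; apply/andP; split; lra.
Qed.

(** Used for a contour integral u that does not depend on the radius rho: let rho
    tend to infinity. *)
Lemma small_eq0 (u : C) (A B t : R) : 0 <= A -> 0 <= B ->
  (forall rho : R, B < rho -> normc u <= A / (rho - t)) -> u = 0.
Proof.
move=> A0 B0 H; apply/eqP; rewrite -normc_eq0; apply/negPn/negP => u0.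
have up : 0 < normc u by rewrite lt_def u0 normc_ge0.
pose rho := B + `|t| + 1 + t + (A + 1) / normc u.
have q0 : 0 < (A + 1) / normc u by rewrite divr_gt0// ltr_wpDl.
have t1 := ler_norm t; have t2 := ler_norm (- t); rewrite normrN in t2.
have rB : B < rho by rewrite /rho; lra.
have rt : 0 < rho - t by rewrite /rho; lra.
have := H rho rB; rewrite ler_pdivlMr// /rho => h.
have : normc u * ((A + 1) / normc u) <= A.
  by apply: le_trans h; rewrite ler_wpM2l ?ltW//; lra.
by rewrite mulrC divfK// leNgt ltrDl ltr01.
Qed.

(** The radius can be enlarged without changing the value, and the kernel tends
    to 1 at infinity. *)
Lemma circ_kernel_out t x : 0 < t -> t < expR x -> circ (kernel t) x = (2 * pi)%:C.
Proof.
move=> t0 tx; have pi0 := pi_gt0 R; apply/eqP; rewrite -subr_eq0; apply/eqP.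
apply: (@small_eq0 _ (2 * t * (2 * pi)) (expR x) t).
- by rewrite !mulr_ge0 ?ltW.
- exact: expR_ge0.
move=> rho xr; have r0 : 0 < rho by apply: lt_trans xr; exact: expR_gt0.
have xr' : x <= ln rho by rewrite -ler_expR lnK ?posrE// ltW.
rewrite (circ_hol xr'); last first.
  by move=> z /andP[z1 _]; apply: cdiff_kernel; rewrite sub_real_neq0// gt_eqF// (lt_le_trans tx).
have -> : 2 * t * (2 * pi) / (rho - t) = 2 * (t / (rho - t)) * (2 * pi) by ring.
rewrite -[X in _ - X]mul1r; apply: circ_near.
- move=> z zr; apply/cdiff_ccont/cdiff_kernel; rewrite sub_real_neq0// zr lnK ?posrE//.
  by rewrite gt_eqF// (lt_trans tx).
- rewrite lnK ?posrE// => z zr; have rt : t < rho by exact: lt_trans xr.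
  have zt : z - t%:C != 0 by rewrite sub_real_neq0// zr gt_eqF.
  have -> : kernel t z - 1 = t%:C / (z - t%:C).
    by rewrite /kernel -[X in _ - X](divff zt) -mulrBl; congr (_ / _); ring.
  rewrite normcM normcV normc_real gtr0_norm// ler_pM2l// lef_pV2 ?posrE ?subr_gt0//; last first.
    by rewrite normc_gt0.
  have := lerB_normc z (- t%:C); rewrite normcN normc_real gtr0_norm// zr; lra.
Qed.

(** The radius can be shrunk to 0, where the kernel vanishes. *)
Lemma circ_kernel_in t x : expR x < t -> circ (kernel t) x = 0.
Proof.
move=> xt; have pi0 := pi_gt0 R.
have t0 : 0 < t by apply: lt_trans xt; exact: expR_gt0.
have e0 := expR_gt0 x.
apply: (@small_eq0 _ (2 * (2 * pi)) (t / expR x) 1); first by lra.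
  by rewrite divr_ge0 ?ltW.
move=> rho xr; have r0 : 0 < rho by apply: lt_trans xr; rewrite divr_gt0.
have r1 : 1 < rho by apply: lt_trans xr; rewrite ltr_pdivlMr// mul1r.
have tr : t / rho < expR x by rewrite ltr_pdivrMr// mulrC -ltr_pdivrMr.
have tr0 : 0 < t / rho by rewrite divr_gt0.
have rx : ln (t / rho) <= x by rewrite -ler_expR lnK ?posrE// ltW.
rewrite -(circ_hol rx); last first.
  move=> z /andP[_ z1]; apply: cdiff_kernel; rewrite sub_real_neq0// lt_eqF//.
  exact: le_lt_trans z1 xt.
have -> : 2 * (2 * pi) / (rho - 1) = 2 * (rho - 1)^-1 * (2 * pi) by ring.
apply: circ_bound.
- move=> z zr; apply/cdiff_ccont/cdiff_kernel; rewrite sub_real_neq0// zr lnK ?posrE//.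
  by rewrite lt_eqF// (lt_trans tr).
- rewrite lnK ?posrE// => z zr.
  have zt : normc z < t by rewrite zr (lt_trans tr).
  apply: le_trans (kernel_bound t0 _) _; first by rewrite lt_eqF.
  rewrite ltr0_norm ?subr_lt0// opprB zr.
  have -> : t / rho / (t - t / rho) = (rho - 1)^-1.
    field; rewrite !gt_eqF ?subr_gt0//.
    by rewrite ltr_pMr.
  by [].
Qed.

(** Cauchy's formula for the annulus s < |z| < r, applied to g(z) (t / z)^e. The
    exponent e is free: it balances the growth of g on the two circles. The
    factor 2 is that of [cint_bound]. *)
Lemma annulus_bound_real (g : C -> C) (s t r Ms Mr : R) (e : nat) :
  (forall z, cdiff g z) -> 0 < s -> s < t -> t < r ->
  (forall z, normc z = s -> normc (g z) <= Ms) ->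
  (forall z, normc z = r -> normc (g z) <= Mr) ->
  normc (g t%:C) <= 2 * (Mr * (t / r) ^+ e * (r / (r - t)) + Ms * (t / s) ^+ e * (s / (t - s))).
Proof.
move=> dg s0 st tr gs gr; have pi0 := pi_gt0 R.
have t0 := lt_trans s0 st; have r0 := lt_trans t0 tr.
have tC0 : t%:C != 0 by rewrite -normc_eq0 normc_real normr_eq0 gt_eqF.
pose F z := g z * (t%:C / z) ^+ e.
have dF z : z != 0 -> cdiff F z.
  move=> z0; apply: cdiffM => //; apply: cdiffX; apply: cdiffM; first exact: cdiff_cst.
  by apply: cdiffV => //; exact: cdiff_id.
have Ft : F t%:C = g t%:C by rewrite /F divff// expr1n mulr1.
have [c Hc] := dF _ tC0.
(* K is the difference quotient of F at t times the variable; it is continuous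
   at t, so its integrals over the two circles agree *)
pose K z := if z == t%:C then c * t%:C else (F z - F t%:C) * kernel t z.
have nz0 (z : C) a : 0 < a -> normc z = a -> z != 0 by move=> a0 za; rewrite -normc_gt0 za.
have dK z : z != 0 -> z != t%:C -> cdiff K z.
  move=> z0 zt; have zt' : z - t%:C != 0 by rewrite subr_eq0.
  apply: (@cdiff_eq_near _ (fun z => (F z - F t%:C) * kernel t z) _ _ (normc (z - t%:C) / 2)).
  - by rewrite divr_gt0// normc_gt0.
  - move=> h hz; rewrite /K; case: eqP => // zht; exfalso.
    have : normc h = normc (z - t%:C) by rewrite -zht opprD addNKr normcN.
    have : 0 < normc (z - t%:C) by rewrite normc_gt0.
    by lra.
  - apply: cdiffM; last exact: cdiff_kernel.
    by apply: cdiffD; [exact: dF|exact: cdiff_cst].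
have cK z : z != 0 -> ccont K z.
  move=> z0; have [->|zt] := eqVneq z t%:C; last exact/cdiff_ccont/dK.
  move=> a a0; pose a1 := a / (2 * (t + 1)).
  have t10 : 0 < 2 * (t + 1) by rewrite mulr_gt0// addr_gt0.
  have a10 : 0 < a1 by rewrite divr_gt0.
  have [d d0 Hd] := Hc a1 a10.
  have c0 : 0 < 2 * (normc c + 1) by rewrite mulr_gt0// ltr_wpDl// normc_ge0.
  exists (Num.min d (Num.min 1 (a / (2 * (normc c + 1))))).
    by rewrite !lt_min d0 ltr01 divr_gt0.
  move=> h; rewrite !le_min => /and3P[hd h1 ha].
  rewrite /K eqxx; have [h0|h0] := eqVneq h 0.
    by rewrite h0 addr0 eqxx subrr normc0 ltW.
  have nh0 : 0 < normc h by rewrite normc_gt0.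
  have -> : (t%:C + h == t%:C) = false by rewrite -subr_eq0 addrC addKr (negbTE h0).
  have -> : (F (t%:C + h) - F t%:C) * kernel t (t%:C + h) - c * t%:C =
      (F (t%:C + h) - F t%:C - c * h) / h * (t%:C + h) + c * h.
    rewrite /kernel [t%:C + h - _]addrC addKr; field; exact: h0.
  apply: le_trans (normcD _ _) _; rewrite !normcM normcV.
  have b1 : normc (F (t%:C + h) - F t%:C - c * h) / normc h <= a1.
    by rewrite ler_pdivrMr//; exact: Hd.
  have b2 : normc (t%:C + h) <= t + 1.
    by apply: le_trans (normcD _ _) _; rewrite normc_real gtr0_norm// lerD2l.
  have b3 : normc c * normc h <= a / 2.
    have : normc h * (2 * (normc c + 1)) <= a by rewrite -ler_pdivlMr.
    have -> : normc h * (2 * (normc c + 1)) = 2 * (normc c * normc h) + 2 * normc h by ring.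
    lra.
  have b4 : normc (F (t%:C + h) - F t%:C - c * h) / normc h * normc (t%:C + h) <= a / 2.
    apply: le_trans (ler_pM _ _ b1 b2) _; rewrite ?divr_ge0 ?normc_ge0//.
    rewrite /a1 le_eqVlt; apply/orP; left; apply/eqP; field.
    by rewrite gt_eqF// addr_gt0.
  lra.
have lt1 : ln s < ln t < ln r by rewrite !ltr_ln ?posrE// st tr.
have cc : circ K (ln s) = circ K (ln r).
  apply: (circ_const t0 lt1) => z; rewrite !lnK ?posrE// => /andP[zs _].
  - by apply: cK; rewrite -normc_gt0 (lt_le_trans s0).
  - by apply: dK; rewrite -normc_gt0 (lt_le_trans s0).
have nk (z : C) a : normc z = a -> a != t -> z - t%:C != 0.
  by move=> <-; exact: sub_real_neq0.
have split x a k : expR x = a -> 0 < a -> a != t -> circ (kernel t) x = k ->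
    circ K x = circ (fun z => F z * kernel t z) x - F t%:C * k.
  move=> xa a0 at' <-; have ck z : normc z = expR x -> cdiff (kernel t) z.
    by rewrite xa => zx; apply: cdiff_kernel; exact: nk zx at'.
  have cFk z : normc z = expR x -> cdiff (fun z => F z * kernel t z) z.
    by move=> zx; apply: cdiffM; [apply: dF; apply: nz0 a0 _; rewrite -xa|exact: ck].
  have ckt z : normc z = expR x -> ccont (fun z => F t%:C * kernel t z) z.
    by move=> zx; apply/cdiff_ccont/cdiffM; [exact: cdiff_cst|exact: ck].
  rewrite /circ -cintZ; last by apply: circ_seg => z zx; exact/cdiff_ccont/ck.
  rewrite -cintB; first last.
  - exact: (@circ_seg (fun z => F t%:C * kernel t z)).
  - by apply: (@circ_seg (fun z => F z * kernel t z)) => z zx; exact/cdiff_ccont/cFk.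
  apply: eq_cint => y _; rewrite /K; case: eqP => [e1|_]; last by rewrite mulrBl.
  exfalso; move/eqP: at'; apply; have := normc_cexp (x +i* y).
  by rewrite e1 normc_real (gtr0_norm t0) /= xa => /esym.
have bd x M a : expR x = a -> 0 < a -> a != t -> (forall z, normc z = a -> normc (g z) <= M) ->
    normc (circ (fun z => F z * kernel t z) x) <=
    2 * (M * (t / a) ^+ e * (a / `|a - t|)) * (2 * pi).
  move=> xa a0 at' gM; apply: circ_bound => z; rewrite xa => zx.
    apply/cdiff_ccont/cdiffM; first by apply: dF; exact: nz0 zx.
    by apply: cdiff_kernel; exact: nk zx at'.
  have ta0 : 0 <= t / a by rewrite divr_ge0 ?(ltW t0) ?(ltW a0).
  have -> : normc (F z * kernel t z) = normc (g z) * (t / a) ^+ e * normc (kernel t z).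
    by rewrite /F !normcM normcX normcM normcV normc_real (gtr0_norm t0) zx.
  apply: ler_pM.
  - by rewrite mulr_ge0 ?exprn_ge0 ?normc_ge0.
  - exact: normc_ge0.
  - by apply: ler_wpM2r; [exact: exprn_ge0|exact: gM].
  - by have := @kernel_bound t z t0; rewrite zx; apply.
have er : expR (ln r) = r by rewrite lnK ?posrE.
have es : expR (ln s) = s by rewrite lnK ?posrE.
have rt' : r != t by rewrite gt_eqF.
have st' : s != t by rewrite lt_eqF.
have kr : circ (kernel t) (ln r) = (2 * pi)%:C by apply: circ_kernel_out; rewrite ?er.
have ks : circ (kernel t) (ln s) = 0 by apply: circ_kernel_in; rewrite es.
have e2 : g t%:C * (2 * pi)%:C = circ (fun z => F z * kernel t z) (ln r) -
    circ (fun z => F z * kernel t z) (ln s).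
  have := etrans (esym (split _ _ _ es s0 st' ks)) (etrans cc (split _ _ _ er r0 rt' kr)).
  move: (circ _ (ln s)) (circ _ (ln r)) => A B; rewrite mulr0 subr0 Ft => ->.
  by ring.
have p2 : 0 < 2 * pi :> R by lra.
rewrite -(ler_pM2r p2).
have -> : normc (g t%:C) * (2 * pi) = normc (g t%:C * (2 * pi)%:C).
  by rewrite normcM normc_real (gtr0_norm p2).
have nr : `|r - t| = r - t by apply: gtr0_norm; rewrite subr_gt0.
have ns : `|s - t| = t - s by rewrite distrC; apply: gtr0_norm; rewrite subr_gt0.
have h1 := bd _ _ _ er r0 rt' gr; have h2 := bd _ _ _ es s0 st' gs.
rewrite e2; apply: le_trans (normcB _ _) _; apply: le_trans (lerD h1 h2) _.
rewrite nr ns -mulrDl -mulrDr; exact: lexx.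
Qed.

Lemma annulus_bound (g : C -> C) (s r Ms Mr : R) (e : nat) (z : C) :
  (forall z, cdiff g z) -> 0 < s -> s < normc z -> normc z < r ->
  (forall z, normc z = s -> normc (g z) <= Ms) ->
  (forall z, normc z = r -> normc (g z) <= Mr) ->
  normc (g z) <= 2 * (Mr * (normc z / r) ^+ e * (r / (r - normc z)) +
                      Ms * (normc z / s) ^+ e * (s / (normc z - s))).
Proof.
move=> dg s0 sz zr gs gr; have z0 := lt_trans s0 sz.
have tC0 : (normc z)%:C != 0 by rewrite -normc_eq0 normc_real normr_eq0 gt_eqF.
pose u := z / (normc z)%:C.
have nu : normc u = 1 by rewrite normcM normcV normc_real gtr0_norm// divff// gt_eqF.
have -> : normc (g z) = normc (g (u * (normc z)%:C)) by rewrite /u divfK.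
apply: (@annulus_bound_real (fun w => g (u * w))) => //.
- move=> w; apply: (@cdiff_comp _ g (fun w => u * w)) => //.
  by apply: cdiffM; [exact: cdiff_cst|exact: cdiff_id].
- by move=> w ws; apply: gs; rewrite normcM nu mul1r.
- by move=> w ws; apply: gr; rewrite normcM nu mul1r.
Qed.

End Annulus.

(** * Holomorphic functions of several variables *)

Section Several.
Variable R : realType.
Local Notation C := R[i].

(** A Schwarz lemma: let the inner radius of [annulus_bound] tend to 0 with
    exponent k + 1. *)
Lemma vanishing_bound (g : C -> C) (k : nat) (M : R) :
  (forall z, cdiff g z) -> (forall z, normc z = 1 -> normc (g z) <= M) ->
  (forall e : R, 0 < e -> exists2 d : R, 0 < d &
     forall h, normc h <= d -> normc (g h) <= e * normc h ^+ k) ->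
  forall z, 0 < normc z <= 1 / 2 -> normc (g z) <= 4 * M * normc z ^+ k.+1.
Proof.
move=> dg gM g0 z /andP[z0 z2]; set t := normc z in z0 z2 *.
have M0 : 0 <= M by apply: le_trans (gM 1 _); [exact: normc_ge0|exact: normc1].
have key (e : R) : 0 < e -> normc (g z) <= 4 * M * t ^+ k.+1 + 4 * e * t ^+ k.
  move=> e0; have [d d0 Hd] := g0 e e0.
  pose s := Num.min d (t / 2).
  have s0 : 0 < s by rewrite lt_min d0 divr_gt0.
  have sd : s <= d by rewrite /s ge_min lexx.
  have st : s <= t / 2 by rewrite /s ge_min lexx orbT.
  clearbody s; have s1 : s < t by lra.
  have t1 : t < 1 by lra.
  (* the powers of s cancel in the contribution of the inner circle, which is
     at most 4 e t^k and disappears with e *)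
  have := @annulus_bound R g s 1 (e * s ^+ k) M k.+1 z dg s0 s1 t1.
  move=> /(_ _ _)/le_trans; apply.
  - by move=> w ws; have := Hd w; rewrite ws; apply.
  - exact: gM.
  rewrite -/t divr1 mul1r mulrDr; apply: lerD.
    have : (1 - t)^-1 <= 2 by rewrite -[2]invrK lef_pV2 ?posrE ?invr_gt0//; lra.
    have : 0 <= M * t ^+ k.+1 by rewrite mulr_ge0// exprn_ge0// ltW.
    nra.
  have -> : 2 * (e * s ^+ k * (t / s) ^+ k.+1 * (s / (t - s))) =
      2 * e * t ^+ k * (t / (t - s)).
    rewrite !exprS expr_div_n; field.
    by rewrite expf_eq0 subr_eq0 !gt_eqF// andbF.
  have : t / (t - s) <= 2 by rewrite ler_pdivrMr; lra.
  have : 0 <= e * t ^+ k by rewrite mulr_ge0 ?exprn_ge0 ?ltW.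
  nra.
rewrite leNgt; apply/negP => lt1.
have k0 : 0 < 8 * t ^+ k by rewrite mulr_gt0// exprn_gt0.
set D := normc (g z) - 4 * M * t ^+ k.+1.
have D0 : 0 < D by rewrite subr_gt0.
have := key (D / (8 * t ^+ k)) (divr_gt0 D0 k0).
have -> : 4 * (D / (8 * t ^+ k)) * t ^+ k = D / 2.
  by field; rewrite expf_eq0 gt_eqF// andbF.
rewrite /D; lra.
Qed.

(** Apply [vanishing_bound] to g - g(0), which bounds c, then to the second order
    remainder. *)
Lemma cdiff_taylor (g : C -> C) (M : R) (c : C) :
  (forall z, cdiff g z) -> (forall z, normc z <= 1 -> normc (g z) <= M) ->
  (forall e : R, 0 < e -> exists2 d : R, 0 < d & forall h, normc h <= d ->
    normc (g h - g 0 - c * h) <= e * normc h) ->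
  forall h, normc h <= 1 / 2 -> normc (g h - g 0 - c * h) <= 40 * M * normc h ^+ 2.
Proof.
move=> dg gM Hc; have g0 : normc (g 0) <= M by apply: gM; rewrite normc0.
have M0 : 0 <= M by apply: le_trans g0; exact: normc_ge0.
have dg1 z : cdiff (fun w => g w - g 0) z by apply: cdiffD; [exact: dg|exact: cdiff_cst].
have b1 z : normc z = 1 -> normc (g z - g 0) <= 2 * M.
  move=> z1; apply: le_trans (normcB _ _) _.
  by have := gM z; rewrite z1 lexx => /(_ isT); lra.
have v1 : forall z, 0 < normc z <= 1 / 2 -> normc (g z - g 0) <= 4 * (2 * M) * normc z ^+ 1.
  apply: vanishing_bound => //= e e0.
  have [d d0 Hd] := cdiff_ccont (dg 0) e0.
  by exists d => // h hd; rewrite expr0 mulr1 -{1}(add0r h); exact: Hd.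
have c1 : normc c <= 8 * M.
  rewrite leNgt; apply/negP => lt1.
  have ep : 0 < (normc c - 8 * M) / 2 by lra.
  have [d d0 Hd] := Hc _ ep.
  pose s := Num.min d (1 / 2).
  have s0 : 0 < s by rewrite lt_min d0 divr_gt0.
  have sd : s <= d by rewrite /s ge_min lexx.
  have st : s <= 1 / 2 by rewrite /s ge_min lexx orbT.
  clearbody s; have ns : normc s%:C = s by rewrite normc_real gtr0_norm.
  have := Hd s%:C; rewrite ns => /(_ sd) h1.
  have := v1 s%:C; rewrite ns s0 st => /(_ isT) h2.
  have : normc (c * s%:C) <= (normc c - 8 * M) / 2 * s + 4 * (2 * M) * s ^+ 1.
    have -> : c * s%:C = (g s%:C - g 0) - (g s%:C - g 0 - c * s%:C) by ring.
    by apply: le_trans (normcB _ _) _; rewrite addrC lerD.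
  rewrite normcM ns expr1 -mulrDl ler_pM2r//; lra.
move=> h hh; have [->|h0] := eqVneq h 0.
  by rewrite subrr mulr0 subr0 normc0 expr0n mulr0.
have -> : 40 * M = 4 * (10 * M) by ring.
apply: (@vanishing_bound (fun w => g w - g 0 - c * w) 1) => //.
- move=> z; apply: cdiffD => //.
  have -> : (fun x => - (c * x)) = (fun x => (- c) * x) by apply/funext => x; rewrite mulNr.
  by apply: cdiffM; [exact: cdiff_cst|exact: cdiff_id].
- move=> z z1; apply: le_trans (normcB _ _) _; rewrite normcM z1 mulr1.
  by have := b1 z z1; lra.
- by rewrite normc_gt0 h0.
Qed.

Definition climit (u : nat -> C) (l : C) := forall e : R, 0 < e ->
  exists N, forall n, (N <= n)%N -> normc (u n - l) <= e.

Lemma climitP (u : nat -> C) :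
  (forall e : R, 0 < e -> exists N, forall m n, (N <= m)%N -> (N <= n)%N ->
    normc (u m - u n) <= e) -> exists l, climit u l.
Proof.
move=> H.
have key (p : C -> R) : (forall z, `|p z| <= normc z) ->
    (forall z t, p (z - t) = p z - p t) -> exists l : R, forall e : R, 0 < e ->
    exists N, forall n, (N <= n)%N -> `|p (u n) - l| <= e.
  move=> p1 pB; pose v := (fun n => p (u n)) : nat -> R^o.
  have /cvg_ex[l /cvgrPdist_le Hl] : cvg (v @ \oo).
    apply: cauchy_cvg; apply: cauchy_exP => e e0.
    have [N HN] := H (e / 2) (divr_gt0 e0 (ltr0n _ 2)).
    exists (v N); exists N => // n /= Nn; rewrite /ball/= /v -pB.
    apply: le_lt_trans (p1 _) _; apply: le_lt_trans (HN _ _ _ Nn) _ => //.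
    by rewrite ltr_pdivrMr// ltr_pMr// ltr1n.
  exists l => e e0; have [N _ HN] := Hl e e0.
  by exists N => n Nn; rewrite distrC; exact: HN.
have [a Ha] := key (@complex.Re R) (@normc_ge_Re R)
  (fun z t => etrans (ReD z (- t)) (congr1 _ (ReN t))).
have [b Hb] := key (@complex.Im R) (@normc_ge_Im R)
  (fun z t => etrans (ImD z (- t)) (congr1 _ (ImN t))).
exists (a +i* b) => e e0; have e2 : 0 < e / 2 by exact: divr_gt0.
have [N1 H1] := Ha _ e2; have [N2 H2] := Hb _ e2.
exists (maxn N1 N2) => n; rewrite geq_max => /andP[n1 n2].
apply: le_trans (normc_leD _) _; rewrite ReD ReN ImD ImN/= [e]splitr.
by rewrite lerD// ?H1 ?H2.
Qed.

Lemma climit_eps u l : climit u l -> forall (B : R), (forall n, normc (u n) <= B) ->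
  normc l <= B.
Proof.
move=> ul B uB; rewrite leNgt; apply/negP => lt1.
have [N HN] := ul ((normc l - B) / 2) (divr_gt0 (eq_ind_r is_true lt1 (subr_gt0 _ _)) (ltr0n _ 2)).
have := HN N (leqnn N); have := uB N; have := lerB_normc l (- u N).
by rewrite normcN normc_distC; lra.
Qed.

Lemma climitD u v l k : climit u l -> climit v k -> climit (fun n => u n + v n) (l + k).
Proof.
move=> ul vk e e0; have e2 : 0 < e / 2 by exact: divr_gt0.
have [N1 H1] := ul _ e2; have [N2 H2] := vk _ e2.
exists (maxn N1 N2) => n; rewrite geq_max => /andP[n1 n2].
have -> : u n + v n - (l + k) = (u n - l) + (v n - k) by ring.
by apply: le_trans (normcD _ _) _; rewrite [e]splitr lerD ?H1 ?H2.
Qed.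

Lemma climitZ u l k : climit u l -> climit (fun n => k * u n) (k * l).
Proof.
move=> ul e e0; have k0 : 0 < normc k + 1 by rewrite ltr_wpDl// normc_ge0.
have [N HN] := ul (e / (normc k + 1)) (divr_gt0 e0 k0).
exists N => n Nn; rewrite -mulrBr normcM.
apply: le_trans (ler_wpM2l (normc_ge0 _) (HN n Nn)) _.
rewrite mulrA ler_pdivrMr// mulrC; apply: ler_wpM2l; first exact: ltW.
by rewrite lerDl ler01.
Qed.

Lemma climit_cst k : climit (fun=> k) k.
Proof. by move=> e e0; exists 0%N => n _; rewrite subrr normc0 ltW. Qed.

Lemma climit_sum (I : finType) (u : I -> nat -> C) (l : I -> C) :
  (forall i, climit (u i) (l i)) -> climit (fun n => \sum_i u i n) (\sum_i l i).
Proof.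
move=> H; elim: (index_enum I) => [|i s IH].
  rewrite big_nil; have -> : (fun n => \sum_(i <- [::]) u i n) = fun=> 0.
    by apply/funext => n; rewrite big_nil.
  exact: climit_cst.
rewrite big_cons; have -> : (fun n => \sum_(i <- i :: s) u i n) = fun n => u i n + \sum_(i <- s) u i n.
  by apply/funext => n; rewrite big_cons.
exact: climitD.
Qed.

Section Dim.
Variable d : nat.
Local Notation V := 'rV[C]_d.
Local Notation eucl := (@euclidean_norm R d).
Implicit Types (z w h : V).

Lemma eucl_ge0 z : 0 <= eucl z.
Proof. exact: sqrtr_ge0. Qed.

Lemma eucl_sqr z : eucl z ^+ 2 = \sum_(k < d) normc (z 0 k) ^+ 2.
Proof. by rewrite sqr_sqrtr// sumr_ge0// => i _; rewrite sqr_ge0. Qed.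

Lemma eucl_coord z i : normc (z 0 i) <= eucl z.
Proof.
rewrite -(@ler_pXn2r _ 2) ?nnegrE ?normc_ge0 ?eucl_ge0// eucl_sqr (bigD1 i)//=.
by rewrite lerDl sumr_ge0// => j _; rewrite sqr_ge0.
Qed.

Lemma euclZ (a : C) z : eucl (a *: z) = normc a * eucl z.
Proof.
apply: (@pexpIrn _ 2) => //; rewrite ?nnegrE ?mulr_ge0 ?normc_ge0 ?eucl_ge0//.
rewrite exprMn !eucl_sqr mulr_sumr; apply: eq_bigr => i _.
by rewrite mxE normcM exprMn.
Qed.

Lemma eucl0 : eucl 0 = 0.
Proof. by rewrite -(scale0r (0 : V)) euclZ normc0 mul0r. Qed.

Lemma eucl_eq0 z : eucl z = 0 -> z = 0.
Proof.
move=> z0; apply/rowP => i; rewrite mxE; apply/eqP; rewrite -normc_eq0.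
by rewrite eq_le normc_ge0 andbT -z0 eucl_coord.
Qed.

(** The Cauchy-Schwarz inequality. *)
Lemma sum_normc_le (z w : V) :
  \sum_(k < d) normc (z 0 k) * normc (w 0 k) <= eucl z * eucl w.
Proof.
have [->|z0] := eqVneq z 0.
  rewrite eucl0 mul0r big1// => i _; by rewrite mxE normc0 mul0r.
have [->|w0] := eqVneq w 0.
  rewrite eucl0 mulr0 big1// => i _; by rewrite mxE normc0 mulr0.
have pz : 0 < eucl z by rewrite lt_def eucl_ge0 andbT; apply: contra_neq z0; exact: eucl_eq0.
have pw : 0 < eucl w by rewrite lt_def eucl_ge0 andbT; apply: contra_neq w0; exact: eucl_eq0.
have : \sum_(k < d) 2 * (normc (z 0 k) / eucl z) * (normc (w 0 k) / eucl w) <=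
    \sum_(k < d) ((normc (z 0 k) / eucl z) ^+ 2 + (normc (w 0 k) / eucl w) ^+ 2).
  by apply: ler_sum => k _; have := sqr_ge0 (normc (z 0 k) / eucl z - normc (w 0 k) / eucl w); nra.
rewrite big_split/=.
under [X in _ <= X + _]eq_bigr do rewrite expr_div_n.
under [X in _ <= _ + X]eq_bigr do rewrite expr_div_n.
rewrite -!mulr_suml -!eucl_sqr !divff ?expf_eq0 ?gt_eqF//.
have -> : \sum_(k < d) 2 * (normc (z 0 k) / eucl z) * (normc (w 0 k) / eucl w) =
    2 * ((\sum_(k < d) normc (z 0 k) * normc (w 0 k)) / (eucl z * eucl w)).
  rewrite mulr_suml mulr_sumr; apply: eq_bigr => k _; field; by rewrite !gt_eqF.
move=> h; have : (\sum_(k < d) normc (z 0 k) * normc (w 0 k)) / (eucl z * eucl w) <= 1 by lra.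
by rewrite ler_pdivrMr ?mulr_gt0// mul1r.
Qed.

Lemma euclD z w : eucl (z + w) <= eucl z + eucl w.
Proof.
rewrite -(@ler_pXn2r _ 2) ?nnegrE ?addr_ge0 ?eucl_ge0//.
rewrite sqrrD !eucl_sqr.
have := sum_normc_le z w => h.
apply: (@le_trans _ _ (\sum_(k < d) (normc (z 0 k) ^+ 2 +
    (normc (z 0 k) * normc (w 0 k)) *+ 2 + normc (w 0 k) ^+ 2))).
  apply: ler_sum => k _; rewrite mxE -sqrrD ler_pXn2r ?nnegrE ?addr_ge0 ?normc_ge0//.
  exact: normcD.
by rewrite !big_split/= lerD2r lerD2l mulr2n lerD.
Qed.

Lemma mx_entry_le (h : V) i : normc (h 0 i) <= Re `|h|.
Proof.
have : `|h 0 i| <= `|h|.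
  rewrite -[leRHS]/(mx_norm h) mx_normE -[leLHS]nngE num_le.
  exact: (@le_bigmax _ _ _ _ (fun ij => `|h ij.1 ij.2|%:nng) (0, i)).
by rewrite normcE lecE/= => /andP[].
Qed.

Lemma sum_entry_le (h : V) : \sum_(k < d) normc (h 0 k) <= d%:R * Re `|h|.
Proof.
have -> : d%:R * Re `|h| = \sum_(k < d) Re `|h|.
  by rewrite sumr_const card_ord mulr_natl.
by apply: ler_sum => i _; exact: mx_entry_le.
Qed.

(** Entrance to [holomorphic] from coordinates: the differential is given by a
    row c of partial derivatives and errors are measured in the l^1 norm. *)
Lemma hol_from_coef (f : V -> C) :
  (forall z, exists c : V, forall e : R, 0 < e -> exists2 r : R, 0 < r &
     forall h, \sum_(k < d) normc (h 0 k) <= r ->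
     normc (f (z + h) - f z - \sum_(k < d) c 0 k * h 0 k) <= e * \sum_(k < d) normc (h 0 k)) ->
  holomorphic f.
Proof.
move=> Hf z; have [c H] := Hf z.
pose VN : normedModType C := V; pose CN : normedModType C := C^o.
pose D (h : VN) : CN := \sum_(k < d) c 0 k * h 0 k.
have linD : linear D.
  move=> a u v; rewrite /D scaler_sumr -big_split/=; apply: eq_bigr => k _.
  by rewrite !mxE mulrDr /GRing.scale/= mulrCA.
pose DM := GRing.isLinear.Build _ _ _ _ D linD.
pose DL : {linear VN -> CN} := HB.pack D DM.
have cD : continuous (DL : VN -> CN).
  have -> : (DL : VN -> CN) = \sum_(k < d) (fun h : VN => c 0 k *: (h 0 k : C^o)).
    by apply/funext => h; rewrite fct_sumE.
  move=> x; apply: differentiable_continuous; apply: differentiable_sum => k.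
  by apply: differentiableZ; exact: differentiable_coord.
have lo : (f : VN -> CN) \o shift (z : VN) = cst (f z : CN) + (DL : VN -> CN) +o_ (0 : VN) id.
  apply/eqaddoP => e /ltc_real[e0 ->].
  have d1 : (0 : R) < d%:R + 1 by rewrite ltr_wpDl.
  have [r r0 Hr] := H (Re e / (d%:R + 1)) (divr_gt0 e0 d1).
  apply/(@nbhs_normP _ VN 0); exists (r / (d%:R + 1))%:C; first by rewrite /= ltcR divr_gt0.
  move=> h; rewrite /= sub0r normrN => hr.
  have hre : `|h| = (Re `|h|)%:C by rewrite RRe_real// normr_real.
  have {}hr : Re `|h| < r / (d%:R + 1) by move: hr; rewrite hre ltcR.
  have h0 : 0 <= Re `|h| by rewrite -lecR -hre normr_ge0.
  have sr : \sum_(k < d) normc (h 0 k) <= r.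
    apply: le_trans (sum_entry_le h) _; move: hr; rewrite ltr_pdivlMr// => hr; nra.
  have := Hr h sr; rewrite [z + h]addrC => hh.
  rewrite hre normcE -rmorphM lecR.
  have -> : ((f : VN -> CN) \o shift (z : VN) - (cst (f z : CN) + (DL : VN -> CN))) h =
      f (h + z) - f z - \sum_(k < d) c 0 k * h 0 k.
    by rewrite /= opprD addrA.
  apply: le_trans hh _; apply: le_trans (ler_wpM2l _ (sum_entry_le h)) _.
    by rewrite divr_ge0 ?ltW.
  rewrite mulrA ler_wpM2r// mulrAC -mulrA ler_piMr ?ltW//.
  by rewrite ltr_pdivrMr// mul1r ltrDl.
have dE := diff_unique cD lo.
by apply/diff_locallyP; rewrite dE.
Qed.

Lemma eucl_le_sum z : eucl z <= \sum_(k < d) normc (z 0 k).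
Proof.
have e0 := eucl_ge0 z; have [->|z0] := eqVneq (eucl z) 0.
  by rewrite sumr_ge0// => k _; exact: normc_ge0.
have zp : 0 < eucl z by rewrite lt_def z0.
rewrite -(ler_pM2r zp) -expr2 eucl_sqr mulr_suml; apply: ler_sum => k _.
by rewrite expr2 ler_wpM2l ?normc_ge0// eucl_coord.
Qed.

Lemma sum_le_eucl z : \sum_(k < d) normc (z 0 k) <= d%:R * eucl z.
Proof.
have -> : d%:R * eucl z = \sum_(k < d) eucl z.
  by rewrite sumr_const card_ord mulr_natl.
by apply: ler_sum => i _; exact: eucl_coord.
Qed.

Lemma hol_line (f : V -> C) : holomorphic f -> forall z u l, cdiff (fun l : C => f (z + l *: u)) l.
Proof.
move=> hf z u l; apply/cdiffP.
have d1 : differentiable (fun l : C^o => z + l *: u : V) (l : C^o).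
  apply: differentiableD; first exact: differentiable_cst.
  by apply: (@differentiableZl _ _ _ (fun l : C^o => l)); exact: (@ex_diff _ _ _ _ _ id id).
exact: (@differentiable_comp _ C^o V C^o _ f _ d1 (hf _)).
Qed.

Lemma mx_norm_le_eucl (h : V) : Re `|h| <= eucl h.
Proof.
have [h0|h0] := eqVneq (mx_norm h) 0.
  by rewrite [X in Re X](_ : _ = 0)//= eucl_ge0.
have [[i j]] := mx_norm_neq0 h0; rewrite ord1/= => hj.
have -> : Re `|h| = normc (h 0 j) by rewrite -[`|h|]/(mx_norm h) hj.
exact: eucl_coord.
Qed.

Lemma hol_continuous (f : V -> C) : holomorphic f -> forall z (e : R), 0 < e ->
  exists2 r : R, 0 < r & forall h, eucl h <= r -> normc (f (z + h) - f z) <= e.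
Proof.
move=> hf z e e0; have cf := differentiable_continuous (hf z).
have /cvgrPdist_le /(_ e%:C) := cf; rewrite ltcR => /(_ e0).
move=> /nbhs_normP[r' /= r'0 Hr].
have [r0 rE] := ltc_real r'0.
exists (Re r' / 2); first exact: divr_gt0.
move=> h hr; have := Hr (z + h).
rewrite /= normcE lecR normc_distC; apply; rewrite opprD addNKr normrN rE.
have -> : `|h| = (Re `|h|)%:C by rewrite RRe_real// normr_real.
by rewrite ltcR; have := mx_norm_le_eucl h; lra.
Qed.

Lemma hol_derivative (f : V -> C) z : holomorphic f -> exists c : V,
  forall u (e : R), 0 < e -> exists2 r : R, 0 < r & forall l : C, normc l <= r ->
    normc (f (z + l *: u) - f z - (\sum_(k < d) c 0 k * u 0 k) * l) <= e * normc l.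
Proof.
move=> hf; have df := hf z.
pose VN : normedModType C := V; pose CN : normedModType C := C^o.
pose Df : {linear VN -> CN} := 'd (f : VN -> CN) (z : VN).
pose c : V := \row_k Df (delta_mx 0 k); exists c => u e e0.
have Du : Df u = \sum_(k < d) c 0 k * u 0 k.
  rewrite [in LHS](row_sum_delta u) linear_sum; apply: eq_bigr => k _.
  by rewrite linearZ/= mxE mulrC.
rewrite -Du.
have /diff_locally/eqaddoP lo : differentiable (f : VN -> CN) (z : VN) by [].
pose B := Re `|u| + 1.
have u0 : 0 <= Re `|u| by have := normr_ge0 u; rewrite lecE/= => /andP[].
have B0 : 0 < B by rewrite ltr_wpDl.
have := lo (e / B)%:C; rewrite ltcR => /(_ (divr_gt0 e0 B0)).
move=> /nbhs_normP[r /= /ltc_real[r0 rE] Hr].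
exists (Re r / (2 * B)); first by rewrite divr_gt0// mulr_gt0.
move=> l lr; have nu : `|l *: u| = (normc l * Re `|u|)%:C.
  by rewrite normrZ rmorphM/= RRe_real// normr_real.
have h1 : normc l * Re `|u| <= normc l * B by rewrite ler_wpM2l ?normc_ge0// lerDl.
have h2 : normc l * B <= Re r / 2.
  by move: lr; rewrite ler_pdivlMr ?mulr_gt0//; lra.
have h3 : normc l * Re `|u| < Re r by lra.
have hb : ball_ Num.norm (0 : VN) r (l *: u) by rewrite /ball_/= sub0r normrN nu rE ltcR.
have := Hr _ hb; rewrite -/Df nu -[X in X <= _]/((normc _)%:C) -rmorphM lecR.
have -> : ((f : VN -> CN) \o shift (z : VN) - (cst (f z : CN) + (Df : VN -> CN))) (l *: u) =
    f (z + l *: u) - f z - Df u * l.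
  rewrite -[LHS]/(f (l *: u + z) - (f z + Df (l *: u))).
  by rewrite linearZ opprD addrA [z + _]addrC [_ * l]mulrC.
move=> /le_trans; apply.
apply: (@le_trans _ _ (e / B * (normc l * B))); first by rewrite ler_wpM2l// divr_ge0// ltW.
by rewrite mulrCA divfK ?gt_eqF// mulrC.
Qed.

(** [cdiff_taylor] on the complex line through z in the direction h. *)
Lemma hol_taylor (f : V -> C) z M : holomorphic f ->
  (forall y, eucl y <= eucl z + 1 -> normc (f y) <= M) ->
  exists c : V, forall h, eucl h <= 1 / 2 ->
    normc (f (z + h) - f z - \sum_(k < d) c 0 k * h 0 k) <= 40 * M * eucl h ^+ 2.
Proof.
move=> hf fM; have [c Hc] := hol_derivative z hf; exists c => h hh.
have [->|h0] := eqVneq h 0.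
  rewrite addr0 subrr eucl0 expr0n mulr0 big1 ?subrr ?normc0// => k _.
  by rewrite mxE mulr0.
have hp : 0 < eucl h.
  by rewrite lt_def eucl_ge0 andbT; apply: contra_neq h0; exact: eucl_eq0.
pose u := (eucl h)^-1%:C *: h.
have hu : h = (eucl h)%:C *: u.
  by rewrite /u scalerA -rmorphM divff ?gt_eqF// scale1r.
have nu : eucl u = 1.
  by rewrite euclZ normc_real gtr0_norm ?invr_gt0// mulVf// gt_eqF.
clearbody u.
have := @cdiff_taylor (fun l => f (z + l *: u)) M (\sum_(k < d) c 0 k * u 0 k) _ _ _ (eucl h)%:C.
rewrite scale0r addr0 -hu normc_real gtr0_norm//.
have -> : (\sum_(k < d) c 0 k * u 0 k) * (eucl h)%:C = \sum_(k < d) c 0 k * h 0 k.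
  by rewrite mulr_suml; apply: eq_bigr => k _; rewrite [in RHS]hu mxE; ring.
apply => //.
- by move=> l; exact: hol_line.
- move=> l l1; apply: fM; apply: le_trans (euclD _ _) _.
  by rewrite lerD2l euclZ nu mulr1.
- exact: Hc.
Qed.

(** Vitali's theorem for sequences known to converge pointwise: the uniform second
    order remainder of [hol_taylor] makes the first derivatives at z a Cauchy
    sequence and passes to the limit. *)
Lemma hol_limit (S : nat -> V -> C) (f : V -> C) :
  (forall N, holomorphic (S N)) ->
  (forall rho : R, exists M, forall N y, eucl y <= rho -> normc (S N y) <= M) ->
  (forall z, climit (S ^~ z) (f z)) -> holomorphic f.
Proof.
move=> hS bS lS; apply: hol_from_coef => z; have [M HM] := bS (eucl z + 1).
have M0 : 0 <= M by apply: le_trans (HM 0%N z _); rewrite ?normc_ge0// lerDl.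
have [c Hc] := choice (fun N => hol_taylor (hS N) (HM N)).
have cvc k : exists l, climit (fun N => c N 0 k) l.
  apply: climitP => e e0.
  (* the k-th derivatives at z are compared through increments of length t, each
     with remainder 40 M t^2; this t makes 80 M t at most e / 2 *)
  pose t := Num.min (1 / 2) (e / (160 * M + 1)).
  have M1 : 0 < 160 * M + 1 by rewrite ltr_wpDl// mulr_ge0.
  have t0 : 0 < t by rewrite lt_min !divr_gt0.
  have t1 : t <= 1 / 2 by rewrite /t ge_min lexx.
  have t2 : t * (160 * M + 1) <= e by rewrite -ler_pdivlMr// /t ge_min lexx orbT.
  clearbody t; pose h : V := t%:C *: delta_mx 0 k.
  have hk (a : V) : \sum_(j < d) a 0 j * h 0 j = a 0 k * t%:C.
    rewrite (bigD1 k)//= big1 ?addr0; first by rewrite !mxE !eqxx mulr1.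
    by move=> j jk; rewrite !mxE (negbTE jk) andbF !mulr0.
  have eh : eucl h <= t.
    apply: le_trans (eucl_le_sum h) _; rewrite (bigD1 k)//= big1 ?addr0.
      by rewrite !mxE !eqxx mulr1 normc_real gtr0_norm.
    by move=> j jk; rewrite !mxE (negbTE jk) andbF mulr0 normc0.
  have e8 : 0 < e * t / 8 by rewrite divr_gt0// mulr_gt0.
  have [N1 H1] := lS z _ e8; have [N2 H2] := lS (z + h) _ e8.
  exists (maxn N1 N2) => m n; rewrite !geq_max => /andP[m1 m2] /andP[n1 n2].
  have a1 := H1 m m1; have a2 := H2 m m2; have a3 := H1 n n1; have a4 := H2 n n2.
  have b1 := Hc m h (le_trans eh t1); have b2 := Hc n h (le_trans eh t1).
  rewrite !hk in b1 b2.
  have hsq : 40 * M * eucl h ^+ 2 <= 40 * M * t ^+ 2.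
    rewrite ler_wpM2l ?mulr_ge0// ler_pXn2r ?nnegrE ?eucl_ge0// ltW//.
  have : normc ((c m 0 k - c n 0 k) * t%:C) <= 80 * M * t ^+ 2 + e * t / 2.
    have -> : (c m 0 k - c n 0 k) * t%:C =
      ((S m (z + h) - f (z + h)) - (S m z - f z) - (S m (z + h) - S m z - c m 0 k * t%:C)) -
      ((S n (z + h) - f (z + h)) - (S n z - f z) - (S n (z + h) - S n z - c n 0 k * t%:C)) by ring.
    apply: le_trans (normcB _ _) _.
    have := normcB (S m (z + h) - f (z + h)) (S m z - f z).
    have := normcB (S n (z + h) - f (z + h)) (S n z - f z).
    have := normcB ((S m (z + h) - f (z + h)) - (S m z - f z)) (S m (z + h) - S m z - c m 0 k * t%:C).
    have := normcB ((S n (z + h) - f (z + h)) - (S n z - f z)) (S n (z + h) - S n z - c n 0 k * t%:C).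
    lra.
  rewrite normcM normc_real gtr0_norm// => hfin.
  rewrite -(ler_pM2r t0); apply: le_trans hfin _.
  have : t * (160 * M) * t <= e * t by rewrite ler_wpM2r//; lra.
  rewrite expr2; lra.
have [c0 Hc0] := choice cvc.
exists (\row_k c0 k) => e e0.
have lim_ineq h : eucl h <= 1 / 2 ->
    normc (f (z + h) - f z - \sum_(k < d) (\row_k c0 k) 0 k * h 0 k) <= 40 * M * eucl h ^+ 2.
  move=> hh; apply: (@climit_eps (fun N => S N (z + h) - S N z - \sum_(k < d) c N 0 k * h 0 k)).
    have -> : (fun N => S N (z + h) - S N z - \sum_(k < d) c N 0 k * h 0 k) =
        (fun N => S N (z + h) + ((-1) * S N z + (-1) * \sum_(k < d) h 0 k * c N 0 k)).
      apply/funext => N; rewrite !mulN1r addrA; congr (_ - _).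
      by apply: eq_bigr => k _; rewrite mulrC.
    have -> : f (z + h) - f z - \sum_(k < d) (\row_k c0 k) 0 k * h 0 k =
        f (z + h) + ((-1) * f z + (-1) * \sum_(k < d) h 0 k * c0 k).
      rewrite !mulN1r addrA; congr (_ - _).
      by apply: eq_bigr => k _; rewrite mxE mulrC.
    apply: climitD; first exact: lS.
    apply: climitD; first exact/climitZ/lS.
    by apply/climitZ/climit_sum => k; apply: climitZ; exact: Hc0.
  by move=> N; exact: Hc.
have M1 : 0 < 40 * M + 1 by rewrite ltr_wpDl// mulr_ge0.
exists (Num.min (1 / 2) (e / (40 * M + 1))); first by rewrite lt_min !divr_gt0.
move=> h; rewrite le_min => /andP[h1 h2].
have hs := eucl_le_sum h; have eh0 := eucl_ge0 h.
apply: le_trans (lim_ineq h (le_trans hs h1)) _.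
apply: (@le_trans _ _ (e * eucl h)); last by rewrite ler_wpM2l// ltW.
rewrite expr2 mulrA ler_wpM2r//.
have : eucl h * (40 * M + 1) <= e by rewrite -ler_pdivlMr//; exact: le_trans h2.
lra.
Qed.

End Dim.
End Several.

(** * From holomorphic competitors to monomials *)

Section Criterion.
Variable R : realType.
Local Notation C := R[i].

Lemma expr_gt_nat (a : R) (n : nat) : 0 <= a -> 1 + n%:R * a <= (1 + a) ^+ n.
Proof.
move=> a0; elim: n => [|n IH]; first by rewrite mul0r addr0 expr0.
rewrite exprS; apply: le_trans (ler_wpM2l _ IH); last by rewrite addr_ge0.
have : 0 <= n%:R * a ^+ 2 by rewrite mulr_ge0// sqr_ge0.
rewrite -natr1; nra.
Qed.

Lemma expr_bounded_le1 (a K : R) : 0 <= a -> (forall q : nat, a ^+ q <= K) -> a <= 1.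
Proof.
move=> a0 aK; rewrite leNgt; apply/negP => a1.
have b0 : 0 < a - 1 by rewrite subr_gt0.
have K0 : 0 <= K / (a - 1) by rewrite divr_ge0 ?(ltW b0)//; apply: le_trans (aK 0%N); rewrite expr0.
have := aK (Num.bound (K / (a - 1))).
have := expr_gt_nat (Num.bound (K / (a - 1))) (ltW b0).
have -> : 1 + (a - 1) = a by ring.
have := archi_boundP K0; rewrite ltr_pdivrMr//; lra.
Qed.

(** [annulus_bound] for the powers g^q with exponents e q: the geometric factors
    become negligible as q grows, a tensor power trick. This is Hadamard's
    inequality with an integer slope e. *)
Lemma three_circles (g : C -> C) (s r Ms Mr Y : R) (e : nat) (z : C) :
  (forall z, cdiff g z) -> 0 < s -> s < normc z -> normc z < r ->
  (forall z, normc z = s -> normc (g z) <= Ms) ->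
  (forall z, normc z = r -> normc (g z) <= Mr) -> 0 < Y ->
  Mr * (normc z / r) ^+ e <= Y -> Ms * (normc z / s) ^+ e <= Y -> normc (g z) <= Y.
Proof.
move=> dg s0 sz zr gs gr Y0 rY sY.
have z0 := lt_trans s0 sz; have r0 := lt_trans z0 zr.
have Mr0 : 0 <= Mr by apply: le_trans (gr r%:C _); rewrite ?normc_ge0 ?normc_real ?gtr0_norm.
have Ms0 : 0 <= Ms by apply: le_trans (gs s%:C _); rewrite ?normc_ge0 ?normc_real ?gtr0_norm.
have Pr0 : 0 <= Mr * (normc z / r) ^+ e by rewrite mulr_ge0// exprn_ge0// divr_ge0// ltW.
have Ps0 : 0 <= Ms * (normc z / s) ^+ e by rewrite mulr_ge0// exprn_ge0// divr_ge0// ltW.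
pose A := r / (r - normc z); pose B := s / (normc z - s).
have A0 : 0 <= A by rewrite divr_ge0 ?subr_ge0 ?ltW.
have B0 : 0 <= B by rewrite divr_ge0 ?subr_ge0 ?ltW.
rewrite -[X in _ <= X]mul1r -ler_pdivrMr//.
apply: (@expr_bounded_le1 _ (2 * (A + B))); first by rewrite divr_ge0 ?normc_ge0 ?ltW.
move=> q; rewrite expr_div_n ler_pdivrMr ?exprn_gt0// -normcX.
have := @annulus_bound R (fun w => g w ^+ q) s r (Ms ^+ q) (Mr ^+ q) (e * q) z.
have dgq w : cdiff (fun w => g w ^+ q) w by exact: cdiffX.
move=> /(_ dgq s0 sz zr) H; apply: le_trans (H _ _) _.
- by move=> w ws; rewrite normcX lerXn2r ?nnegrE ?normc_ge0// gs.
- by move=> w ws; rewrite normcX lerXn2r ?nnegrE ?normc_ge0// gr.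
rewrite !exprM -!exprMn -/A -/B.
have h1 : (Mr * (normc z / r) ^+ e) ^+ q <= Y ^+ q by rewrite lerXn2r// nnegrE ltW.
have h2 : (Ms * (normc z / s) ^+ e) ^+ q <= Y ^+ q by rewrite lerXn2r// nnegrE ltW.
have := ler_wpM2r A0 h1; have := ler_wpM2r B0 h2; lra.
Qed.

(** The largest coefficient that makes a monomial of degree j a minorant of w. *)
Definition bcoef (w : R -> R) (j : nat) : R :=
  inf [set w t / t ^+ j | t in [set t | 0 < t]].

Variable w : R -> R.
Hypothesis w_gt0 : forall t, 0 <= t -> 0 < w t.
Hypothesis w_mono : forall s t, 0 <= s -> s <= t -> w s <= w t.

Lemma bcoef_ge0 j : 0 <= bcoef w j.
Proof.
apply: lb_le_inf; first by exists (w 1 / 1 ^+ j); exists 1 => //=.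
by move=> _ [t /= t0 <-]; rewrite divr_ge0 ?exprn_ge0 ?ltW// w_gt0// ltW.
Qed.

Lemma bcoef_le j t : 0 < t -> bcoef w j * t ^+ j <= w t.
Proof.
move=> t0; rewrite -ler_pdivlMr ?exprn_gt0//; apply: ge_inf; last by exists t.
by exists 0 => _ [s /= s0 <-]; rewrite divr_ge0 ?exprn_ge0 ?ltW// w_gt0// ltW.
Qed.

Lemma bcoef_lt j t X : 0 < t -> bcoef w j * t ^+ j < X ->
  exists2 y, 0 < y & w y * (t / y) ^+ j < X.
Proof.
move=> t0; rewrite -ltr_pdivlMr ?exprn_gt0//.
move=> /inf_lt[]; first by exists (w 1 / 1 ^+ j); exists 1 => //=.
move=> _ [y /= y0 <-] hy; exists y => //.
by rewrite expr_div_n mulrA mulrAC -ltr_pdivlMr ?exprn_gt0.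
Qed.

Hypothesis w_left : forall t c, 0 < t -> c < w t ->
  exists2 y, 0 < y < t & forall s, y <= s <= t -> c < w s.

(** Each monomial of height X at t exceeds w somewhere, on the left or on the right
    of t. Degree 0 does so on the left, large degrees only on the right; at a degree j
    where the side changes, the obstruction is on the left for j and on the right for
    j + 1. *)
Lemma slope_bracket t X : 0 < t -> 0 < X -> X < w t ->
  (forall j, bcoef w j * t ^+ j < X) ->
  exists j s r, [/\ 0 < s < t, t < r, w s * (t / s) ^+ j < X & w r * (t / r) ^+ j.+1 < X].
Proof.
move=> t0 X0 Xt H; have {}H j := bcoef_lt t0 (H j).
pose Q j := exists2 y, 0 < y < t & w y * (t / y) ^+ j < X.
have Q0 : Q 0%N.
  have [y y0] := H 0%N; rewrite expr0 mulr1 => hy; exists y; rewrite ?expr0 ?mulr1// y0 /=.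
  rewrite ltNge; apply/negP => ty; have := w_mono (ltW t0) ty; lra.
have [J QJ] : exists J, ~ Q J.
  have [y0 /andP[y00 y0t] Hy] := w_left t0 Xt.
  have w0 := w_gt0 (lexx 0); have n0 : 0 < t / y0 - 1 by rewrite subr_gt0 ltr_pdivlMr// mul1r.
  pose J := Num.bound (X / w 0 / (t / y0 - 1)).
  have hJ : X < w 0 * (t / y0) ^+ J.
    have := expr_gt_nat J (ltW n0).
    have -> : 1 + (t / y0 - 1) = t / y0 by ring.
    have : X / w 0 / (t / y0 - 1) < J%:R by apply: archi_boundP; rewrite !divr_ge0 ?ltW.
    rewrite ltr_pdivrMr// ltr_pdivrMr// => h1 h2.
    apply: lt_le_trans h1 _; rewrite mulrC ler_wpM2l ?ltW//; lra.
  exists J => -[y /andP[yp yt]]; apply/negP; rewrite -leNgt.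
  have ty1 : 1 <= t / y by rewrite ler_pdivlMr// mul1r ltW.
  have [yy0|yy0] := leP y0 y.
    have h : X < w y by apply: Hy; rewrite yy0 ltW.
    apply: le_trans (ltW h) _; rewrite ler_peMr ?exprn_ege1//.
    by rewrite ltW// w_gt0// ltW.
  apply: le_trans (ltW hJ) _; apply: ler_pM.
  - exact: ltW.
  - by rewrite exprn_ge0// divr_ge0 ?ltW.
  - by apply: w_mono => //; exact: ltW.
  - by rewrite lerXn2r ?nnegrE ?divr_ge0 ?(ltW t0) ?(ltW yp) ?(ltW y00)// ler_pM2l// lef_pV2 ?posrE// ltW.
have [j Qj nQj] : exists2 j, Q j & ~ Q j.+1.
  elim: J QJ => // J IH QJ; have [QJ'|/IH//] := pselect (Q J).
  by exists J.
have [s sr hs] := Qj; have [r r0 hr] := H j.+1.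
exists j, s, r; split=> //; have [rt|//|rt] := ltgtP r t.
  by exfalso; apply: nQj; exists r => //; rewrite r0.
by move: hr; rewrite rt divff ?gt_eqF// expr1n mulr1; lra.
Qed.

(** If no monomial below w came close to w at t, [slope_bracket] would give an
    annulus around |l| = t on whose boundary the competitor f, restricted to the
    complex line through z, is so small that f(z) is small as well. *)
Lemma dominating_monomial kappa : 0 < kappa ->
  (forall t, 0 < t -> exists d (f : 'rV[C]_d -> C) z, [/\ holomorphic f,
      forall y, normc (f y) <= w (euclidean_norm y), euclidean_norm z = t
    & kappa * w t <= normc (f z)]) ->
  forall t, 0 < t -> exists j, kappa / 16 * w t <= bcoef w j * t ^+ j.
Proof.
move=> k0 H t t0; apply: contrapT => /forallNP nH.
have [d [f [z [hf fw zt kf]]]] := H t t0; have w0 := w_gt0 (ltW t0).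
have k1 : kappa <= 1.
  by have := le_trans kf (fw z); rewrite zt ger_pMl.
pose X := kappa / 16 * w t.
have X0 : 0 < X by rewrite mulr_gt0// divr_gt0.
have Xt : X < w t by rewrite /X; nra.
have [j|j [s [r [/andP[s0 st] tr hs hr]]]] := slope_bracket t0 X0 Xt.
  by rewrite ltNge; apply/negP; exact: nH.
have r0 := lt_trans t0 tr.
have t0C : t%:C != 0 by rewrite -normc_eq0 normc_real normr_eq0 gt_eqF.
pose u := t^-1%:C *: z; have nu : euclidean_norm u = 1.
  by rewrite euclZ normc_real zt gtr0_norm ?invr_gt0// mulVf// gt_eqF.
pose g (l : C) := f (l *: u).
have dg l : cdiff g l.
  have := hol_line hf 0 u l; congr cdiff; apply/funext => x; by rewrite add0r.
have gw l a : normc l = a -> normc (g l) <= w a.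
  by move=> la; apply: le_trans (fw _) _; rewrite euclZ nu mulr1 la.
have nt : normc t%:C = t by rewrite normc_real gtr0_norm.
have gt : g t%:C = f z by rewrite /g /u scalerA -rmorphM divff ?gt_eqF// scale1r.
have Xw : kappa * w t = 16 * X by rewrite /X; field.
have ts1 : 0 < t / s by rewrite divr_gt0.
have tr1 : 0 < t / r by rewrite divr_gt0.
(* [annulus_bound] suffices when both circles are far from |l| = t; if one of
   them is near, changing the exponent by one costs at most a factor 2 and
   [three_circles] is insensitive to the distance *)
have Z8 : normc (g t%:C) <= 8 * X.
  have [s2|s2] := leP s (t / 2); last first.
    have : normc (g t%:C) <= 2 * X; last lra.
    apply: (@three_circles g s r (w s) (w r) (2 * X) j.+1) => //; rewrite ?nt//.
    - by move=> l ls; exact: gw.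
    - by move=> l ls; exact: gw.
    - by rewrite mulr_gt0.
    - lra.
    - rewrite exprS mulrCA; apply: ler_pM; rewrite ?ltW//.
      + by rewrite mulr_gt0 ?exprn_gt0// w_gt0// ltW.
      + by rewrite ltr_pdivrMr//; lra.
  have [r2|r2] := leP (2 * t) r; last first.
    have : normc (g t%:C) <= 2 * X; last lra.
    apply: (@three_circles g s r (w s) (w r) (2 * X) j) => //; rewrite ?nt//.
    - by move=> l ls; exact: gw.
    - by move=> l ls; exact: gw.
    - by rewrite mulr_gt0.
    - have -> : w r * (t / r) ^+ j = (r / t) * (w r * (t / r) ^+ j.+1).
        by rewrite exprS; field; rewrite !gt_eqF.
      apply: ler_pM; rewrite ?ltW// ?divr_gt0//.
      + by rewrite mulr_gt0 ?exprn_gt0// w_gt0// ltW.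
      + by rewrite ltr_pdivrMr//; lra.
    - lra.
  have := @annulus_bound R g s r (w s) (w r) j.+1 t%:C dg s0.
  rewrite nt => /(_ st tr (fun l ls => gw l s ls) (fun l ls => gw l r ls)) h.
  apply: le_trans h _.
  have e1 : w s * (t / s) ^+ j.+1 * (s / (t - s)) = w s * (t / s) ^+ j * (t / (t - s)).
    by rewrite exprS; field; rewrite subr_eq0 !gt_eqF.
  rewrite e1.
  have b1 : t / (t - s) <= 2 by rewrite ler_pdivrMr; lra.
  have b2 : r / (r - t) <= 2 by rewrite ler_pdivrMr; lra.
  have p1 : 0 <= w s * (t / s) ^+ j by rewrite ltW// mulr_gt0 ?exprn_gt0// w_gt0// ltW.
  have p2 : 0 <= w r * (t / r) ^+ j.+1 by rewrite ltW// mulr_gt0 ?exprn_gt0// w_gt0// ltW.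
  have q1 : 0 <= t / (t - s) by rewrite divr_ge0//; lra.
  have q2 : 0 <= r / (r - t) by rewrite divr_ge0//; lra.
  have := ler_pM p1 q1 (ltW hs) b1; have := ler_pM p2 q2 (ltW hr) b2; lra.
move: kf; rewrite -gt Xw; lra.
Qed.

End Criterion.

Section Continuity.
Variable R : realType.

Lemma within_epsP (w : R -> R) : {within `[0, +oo[, continuous w} <->
  (forall t, 0 <= t -> forall e : R, 0 < e -> exists2 r, 0 < r &
    forall s, 0 <= s -> `|s - t| <= r -> `|w s - w t| <= e).
Proof.
rewrite subspace_continuousP; split.
- move=> H t t0 e e0; have Ht : `[0, +oo[%classic t by rewrite /= in_itv/= andbT.
  have /cvgrPdist_le /(_ e e0) := H t Ht; rewrite near_withinE => /nbhs_ballP[r /= r0 Hr].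
  exists (r / 2); first by rewrite divr_gt0.
  move=> s s0 st; rewrite distrC; apply: Hr; last by rewrite /= in_itv/= s0.
  rewrite /ball/= distrC; apply: le_lt_trans st _; lra.
- move=> H t; rewrite /= in_itv/= andbT => t0; apply/cvgrPdist_le => e e0.
  have [r r0 Hr] := H t t0 e e0; rewrite near_withinE; apply/nbhs_ballP; exists r => // s.
  rewrite /ball/= => st; rewrite in_itv/= andbT => s0; rewrite distrC; apply: Hr => //.
  by rewrite distrC ltW.
Qed.

Lemma within_left (w : R -> R) : {within `[0, +oo[, continuous w} ->
  forall t c, 0 < t -> c < w t -> exists2 y, 0 < y < t & forall s, y <= s <= t -> c < w s.
Proof.
move=> /within_epsP H t c t0 ct.
have [|r r0 Hr] := H t (ltW t0) ((w t - c) / 2); first lra.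
exists (Num.max (t / 2) (t - r)).
  by rewrite lt_max gt_max; apply/andP; split; lra.
move=> s; rewrite ge_max => /andP[/andP[s1 s2] st].
have s0 : 0 <= s by lra.
have := Hr s s0; rewrite ler_norml => /(_ _)/ler_normlP[]; first by lra.
lra.
Qed.

End Continuity.

(** * Thinning out the lines of a tropical power series *)

Section Tropical.
Variable R : realType.

Lemma finite_max n (P : nat -> Prop) (f : nat -> R) (c : R) : exists m, [/\ c <= m,
  forall j, (j < n)%N -> P j -> f j <= m & m = c \/ exists j, [/\ (j < n)%N, P j & m = f j]].
Proof.
elim: n => [|n [m [cm fm em]]]; first by exists c; split => //; left.
have [Pn|nPn] := pselect (P n); last first.
  exists m; split => //.
    move=> j; rewrite ltnS leq_eqVlt => /predU1P[-> //|jn]; exact: fm.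
  by case: em => [->|[j [jn Pj ->]]]; [left|right; exists j; split => //; exact: ltnW].
have [fnm|fnm] := leP (f n) m.
  exists m; split => //.
    by move=> j; rewrite ltnS leq_eqVlt => /predU1P[-> //|jn]; exact: fm.
  by case: em => [->|[j [jn Pj ->]]]; [left|right; exists j; split => //; exact: ltnW].
exists (f n); split.
- by apply: le_trans cm _; exact: ltW.
- move=> j; rewrite ltnS leq_eqVlt => /predU1P[-> //|jn] Pj.
  by apply: le_trans (fm j jn Pj) _; exact: ltW.
- by right; exists n; split.
Qed.

Lemma least_nat (P : nat -> Prop) : (exists n, P n) ->
  exists2 n, P n & forall m, P m -> (n <= m)%N.
Proof.
move=> exP; have exP' : exists n, `[< P n >] by have [n Pn] := exP; exists n; apply/asboolP.
case: (ex_minnP exP') => n /asboolP Pn nm; exists n => // m Pm.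
by apply: nm; apply/asboolP.
Qed.

Variables (E : nat -> Prop) (b : nat -> R) (Psi : R -> R).

Definition tline (j : nat) (x : R) : R := b j + j%:R * x.
Local Notation l := tline.

Hypothesis line_le : forall j x, E j -> l j x <= Psi x.
Arguments line_le {j} x _.

Lemma tlineB j x y : l j y = l j x + j%:R * (y - x).
Proof. by rewrite /tline; ring. Qed.

(** Psi (x + 1) bounds the slopes of all lines that are nearly active at x. This
    is why the supremum defining Psi is a maximum. *)
Lemma near_line_bound x A : exists J, forall j, E j -> Psi x - A <= l j x -> (j <= J)%N.
Proof.
exists (Num.bound (Psi (x + 1) - Psi x + A)) => j Ej hj.
have := line_le (x + 1) Ej; rewrite (tlineB j x) [x + 1 - x](_ : _ = 1); last by ring.
rewrite mulr1 => h; rewrite -(ler_nat R) ltW//.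
have jb : j%:R <= Psi (x + 1) - Psi x + A by lra.
by apply: le_lt_trans (jb) _; apply: archi_boundP; apply: le_trans jb.
Qed.

Lemma sup_attained : (forall x y, y < Psi x -> exists2 j, E j & y < l j x) ->
  forall x, exists2 j, E j & l j x = Psi x.
Proof.
move=> H x; have [J HJ] := near_line_bound x 1.
have [m [m1 m2 m3]] := finite_max J.+1 E (fun j => l j x) (Psi x - 1).
have mP : Psi x <= m.
  rewrite leNgt; apply/negP => /H[j Ej mj].
  have := m2 j; rewrite ltnS HJ//; last by apply: le_trans m1 (ltW mj).
  by move=> /(_ isT Ej); rewrite leNgt mj.
case: m3 => [mE|[j [_ Ej mj]]]; first by exfalso; lra.
by exists j => //; apply: le_anti; rewrite line_le// -mj mP.
Qed.

Hypothesis attained : forall x, exists2 j, E j & l j x = Psi x.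

Definition contact j x := E j /\ l j x = Psi x.

Lemma contact_mono k k' x x' : contact k x -> contact k' x' -> x < x' -> (k <= k')%N.
Proof.
move=> [Ek kx] [Ek' kx'] xx; rewrite leqNgt; apply/negP; rewrite -(ltr_nat R) => kk.
have := line_le x Ek'; have := line_le x' Ek.
rewrite -kx -kx' (tlineB k x x') (tlineB k' x x').
have : 0 < (k%:R - k'%:R) * (x' - x) by rewrite mulr_gt0 ?subr_gt0.
lra.
Qed.

(** Psi minus a line is convex, so its bounds at s and t hold in between. *)
Lemma chord k A s t y : s <= y <= t -> Psi s <= l k s + A -> Psi t <= l k t + A ->
  Psi y <= l k y + A.
Proof.
move=> /andP[sy yt] hs ht; have [j Ej <-] := attained y.
have h1 := le_trans (line_le s Ej) hs; have h2 := le_trans (line_le t Ej) ht.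
move: h1 h2; rewrite (tlineB j y s) (tlineB k y s) (tlineB j y t) (tlineB k y t).
have [jk|jk] := leP (j%:R : R) k%:R.
  have : 0 <= (k%:R - j%:R) * (y - s) by rewrite mulr_ge0 ?subr_ge0.
  lra.
have : 0 <= (j%:R - k%:R) * (t - y) by rewrite mulr_ge0 ?subr_ge0// ltW.
lra.
Qed.

Lemma lines_right k k' c x y : (k <= k')%N -> x <= y -> l k x + c <= l k' x -> l k y + c <= l k' y.
Proof.
rewrite -(ler_nat R) => kk xy; rewrite (tlineB k x y) (tlineB k' x y).
have : 0 <= (k'%:R - k%:R) * (y - x) by rewrite mulr_ge0 ?subr_ge0.
lra.
Qed.

Lemma lines_left k k' c x y : (k <= k')%N -> y <= x -> l k' x + c <= l k x -> l k' y + c <= l k y.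
Proof.
rewrite -(ler_nat R) => kk xy; rewrite (tlineB k x y) (tlineB k' x y).
have : 0 <= (k'%:R - k%:R) * (x - y) by rewrite mulr_ge0 ?subr_ge0.
lra.
Qed.

Variable A : R.
Hypothesis A0 : 0 < A.

(** An index k' that may follow k in the thinned out sequence: beyond t it becomes
    active at a point where the line of k has fallen A below Psi, and at t it lies
    A below Psi itself, so that the contributions decay geometrically both ways. *)
Definition good t k k' := exists x, [/\ t < x, contact k' x, l k x + A <= Psi x
  & l k' t + A <= Psi t].

(** A node (t, a, k) consists of an abscissa t, an index k active there, from which
    the construction goes on, and a second active index a at most k. The last
    clause says that on the interval between two nodes Psi is within A of a single
    line: the previous k, or the auxiliary index a of the new node. *)
Definition next (s s' : R * nat * nat) := let: (t, _, k) := s in let: (t', a, k') := s' in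
  [/\ t < t' /\ contact a t', contact k' t' /\ (k <= a <= k')%N,
      l k t' + A <= Psi t', l k' t + A <= Psi t
    & (forall y, t <= y <= t' -> Psi y <= l k y + A) \/
      (forall y, t <= y <= t' -> Psi y <= l a y + A)].

(** Take the least good index k', and let p be the first abscissa at which its line
    is active and l k lies A below it. What stops p from being smaller is either
    l k itself, and then l k is within A of Psi up to p, or another active line j;
    that line is not good by minimality of k', hence within A of Psi at t, and by
    [chord] on the whole interval. *)
Lemma next_exists t a0 k : contact k t -> (exists k', good t k k') ->
  exists s', next (t, a0, k) s'.
Proof.
move=> kt /least_nat[k' [x [tx k'x kx k't]] kmin].
have [Ek Pt] := kt; have [Ek' Px] := k'x.
have kk : (k < k')%N.
  rewrite ltnNge; apply/negP; rewrite -(ler_nat R) => kk.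
  move: kx k't; rewrite -Px -Pt (tlineB k' t x) (tlineB k t x).
  have : 0 <= (k%:R - k'%:R) * (x - t) by rewrite mulr_ge0 ?subr_ge0// ltW.
  by move: A0; lra.
have d0 j : (j < k')%N -> 0 < (k'%:R - j%:R : R) by rewrite -(ltr_nat R) subr_gt0.
pose xi j := (b j - b k') / (k'%:R - j%:R).
(* xi j is where the line of k' crosses that of j *)
have [p [cp xip ep]] := finite_max k' E xi ((b k + A - b k') / (k'%:R - k%:R)).
have ge_xi c j y : (j < k')%N -> ((b j + c - b k') / (k'%:R - j%:R) <= y) = (l j y + c <= l k' y).
  move=> jk; rewrite ler_pdivrMr ?d0// /tline; apply/idP/idP; lra.
have xiE j : xi j = (b j + 0 - b k') / (k'%:R - j%:R) by rewrite addr0.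
have px : p <= x.
  case: ep => [->|[j [jk Ej ->]]]; first by rewrite ge_xi// Px.
  by rewrite xiE ge_xi// addr0 Px line_le.
have kp : l k p + A <= l k' p by rewrite -ge_xi.
have tp : t < p.
  rewrite ltNge; apply/negP => pt.
  have := @lines_right k k' A p t (ltnW kk) pt kp; rewrite Pt; move: A0; lra.
have k'p : contact k' p.
  split => //; have [j Ej jp] := attained p.
  apply: le_anti; rewrite line_le//= -jp.
  have [jk|jk|->//] := ltngtP j k'.
    by rewrite -[l j p]addr0 -ge_xi// -xiE; exact: xip.
  have := @lines_left k' j 0 x p (ltnW jk) px; rewrite !addr0; apply.
  by rewrite Px line_le.
have [_ k'pE] := k'p.
case: ep => [pE|[j [jk Ej pE]]].
- exists (p, k', k'); split.
  + by [].
  + by split => //; rewrite (ltnW kk) leqnn.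
  + by rewrite -k'pE.
  + by [].
  + left => y typ; apply: chord typ _ _; first by rewrite Pt lerDl ltW.
    have : p <= (b k + A - b k') / (k'%:R - k%:R) by rewrite -pE.
    by rewrite ler_pdivlMr ?d0// -k'pE /tline; lra.
- have jp : contact j p.
    split => //; apply: le_anti; rewrite line_le//= -k'pE.
    have : p <= (b j - b k') / (k'%:R - j%:R) by rewrite -/(xi j) -pE.
    by rewrite ler_pdivlMr ?d0// /tline; lra.
  have jt : Psi t <= l j t + A.
    rewrite leNgt; apply/negP => h.
    have : (k' <= j)%N by apply: kmin; exists p; split => //; [rewrite -k'pE|exact: ltW].
    by rewrite leqNgt jk.
  exists (p, j, k'); split.
  + by [].
  + by split => //; rewrite (@contact_mono k j t p kt jp tp) ltnW.
  + by rewrite -k'pE.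
  + by [].
  + right => y typ; apply: chord typ _ _ => //.
    by rewrite -jp.2 lerDl ltW.
Qed.

(** Without good successor, the slopes active far to the right are bounded, since
    their lines are within A of Psi at t; the largest of them takes over where l k
    fails. *)
Lemma terminal t k : contact k t -> ~ (exists k', good t k k') ->
  exists2 K, E K & forall y, t <= y -> Psi y <= l k y + A \/ Psi y <= l K y + A.
Proof.
move=> kt ng; have [Ek Pt] := kt.
have [all|nall] := pselect (forall y, t <= y -> Psi y <= l k y + A).
  by exists k => // y ty; left; exact: all.
have [y1 [ty1 hy1]] : exists y1, t <= y1 /\ l k y1 + A < Psi y1.
  apply: contrapT => H; apply: nall => y ty; rewrite leNgt; apply/negP => h.
  by apply: H; exists y.
have far x : y1 <= x -> l k x + A <= Psi x.
  move=> y1x; rewrite leNgt; apply/negP => h.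
  have : Psi y1 <= l k y1 + A.
    apply: (@chord _ _ t x) => //; first by rewrite ty1.
      by rewrite Pt lerDl ltW.
    exact: ltW.
  by rewrite leNgt hy1.
have ty1' : t < y1.
  by rewrite lt_neqAle ty1 andbT; apply: contraTneq hy1 => <-; rewrite Pt -leNgt lerDl ltW.
have cl j x : y1 <= x -> contact j x -> Psi t - A <= l j t.
  move=> y1x jx; rewrite leNgt; apply/negP => h; apply: ng; exists j; exists x; split => //.
  - exact: lt_le_trans y1x.
  - exact: far.
  - by lra.
have [J HJ] := near_line_bound t A.
pose P n := exists j x, [/\ y1 <= x, contact j x & n = (J - j)%N].
(* minimizing J - j, with J an upper bound, finds the largest index K active to
   the right of y1 *)
have [n [K [xK [y1K Kx nE]]] nmin] : exists2 n, P n & forall m, P m -> (n <= m)%N.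
  by apply: least_nat; have [j Ej jx] := attained y1; exists (J - j)%N, j, y1; split.
have EK := Kx.1.
have Kmax j x : y1 <= x -> contact j x -> (j <= K)%N.
  move=> y1x jx; have := nmin (J - j)%N; rewrite nE => /(_ _) h.
  have jJ : (j <= J)%N by apply: HJ; [exact: jx.1|exact: cl jx].
  have KJ : (K <= J)%N by apply: HJ => //; exact: cl Kx.
  have : (J - K <= J - j)%N by apply: h; exists j, x; split.
  by lia.
exists K => // y ty; right.
pose x := Num.max y xK.
have yx : y <= x by rewrite le_max lexx.
have xKx : xK <= x by rewrite le_max lexx orbT.
have Kx' : contact K x.
  have [->|xKx'] := eqVneq x xK; first by [].
  have [j Ej jx] := attained x.
  have jc : contact j x by [].
  have lt : xK < x by rewrite lt_neqAle eq_sym xKx' xKx.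
  suff -> : K = j by [].
  apply/eqP; rewrite eqn_leq (@contact_mono K j xK x Kx jc lt) (Kmax j x)//.
  exact: le_trans xKx.
apply: (@chord _ _ t x); first by rewrite ty.
- by have := cl K xK y1K Kx; lra.
- by rewrite Kx'.2 lerDl ltW.
Qed.

Lemma start : exists t0 k0, contact k0 t0 /\ forall x, x <= t0 -> contact k0 x.
Proof.
have [k0 [t0 k0t0] kmin] : exists2 k, (exists x, contact k x) & forall j, (exists x, contact j x) -> (k <= j)%N.
  by apply: least_nat; have [j Ej jx] := attained 0; exists j, 0.
exists t0, k0; split => // x; rewrite le_eqVlt => /predU1P[->//|xt].
have [j Ej jx] := attained x; have jc : contact j x by [].
suff -> : k0 = j by [].
by apply/eqP; rewrite eqn_leq (@contact_mono j k0 x t0 jc k0t0 xt) kmin//; exists x.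
Qed.

(** The sequence stops, with value None, when no good successor exists. *)
Lemma node_seq : exists st : nat -> option (R * nat * nat),
  [/\ exists s, st 0%N = Some s /\ (forall x, x <= s.1.1 -> contact s.2 x) /\ s.1.2 = s.2,
      forall m s s', st m = Some s -> st m.+1 = Some s' -> next s s',
      forall m, st m = None -> st m.+1 = None
    & forall m s, st m = Some s -> st m.+1 = None ->
        ~ exists k', good s.1.1 s.2 k'].
Proof.
have [t0 [k0 [k0t0 k0l]]] := start.
have step s : exists o : option (R * nat * nat),
    (forall s', o = Some s' -> next s s') /\
    (o = None -> contact s.2 s.1.1 -> ~ exists k', good s.1.1 s.2 k').
  have [[s' ss']|ns] := pselect (exists s', next s s').
    by exists (Some s'); split => // _ [<-].
  exists None; split => // _; case: s ns => [[t a] k] /= ns kt gk; apply: ns.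
  exact: next_exists.
have [nx Hnx] := choice step.
pose st := fix st m := if m is p.+1 then obind nx (st p) else Some (t0, k0, k0).
have ct m s : st m = Some s -> contact s.2 s.1.1.
  case: m => [[<-]//|m] /=; case: (st m) => //= s1 /(proj1 (Hnx s1)).
  by case: s1 => [[? ?] ?]; case: s => [[? ?] ?] [_ []].
exists st; split.
- by exists (t0, k0, k0).
- by move=> m s s' /= -> /= /(proj1 (Hnx s)).
- by move=> m /= ->.
- move=> m s ms; have cs := ct _ _ ms; move: ms => /= -> /= h.
  exact: (proj2 (Hnx s)) h cs.
Qed.

Section Nodes.
Variable st : nat -> option (R * nat * nat).
Hypothesis st0 : exists s, st 0%N = Some s /\ (forall x, x <= s.1.1 -> contact s.2 x) /\ s.1.2 = s.2.
Hypothesis stS : forall m s s', st m = Some s -> st m.+1 = Some s' -> next s s'.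
Hypothesis stN : forall m, st m = None -> st m.+1 = None.
Hypothesis stT : forall m s, st m = Some s -> st m.+1 = None -> ~ exists k', good s.1.1 s.2 k'.

Arguments stN {m} _.
Arguments stS {m s s'} _ _.
Arguments stT {m s} _ _.

Lemma st_prev m s' : st m.+1 = Some s' -> exists2 s, st m = Some s & next s s'.
Proof.
case sm: (st m) => [s|] ms; first by exists s => //; exact: stS sm ms.
by rewrite (stN sm) in ms.
Qed.

Lemma st_contact m s : st m = Some s ->
  [/\ contact s.2 s.1.1, contact s.1.2 s.1.1 & (s.1.2 <= s.2)%N].
Proof.
case: m => [|m] ms.
  have [s0 [e0 [c0 e2]]] := st0; move: ms; rewrite e0 => -[<-].
  by rewrite e2 leqnn; split => //; apply: c0.
have [s1 _] := st_prev ms; case: s1 ms => [[t a] k]; case: s => [[t' a'] k'] _ /=.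
by case=> [[_ ?] [? /andP[_ ?]]] _ _ _.
Qed.

(** Each step of the sequence adds A to the gap between the lines on both sides. *)
Lemma st_order m i s s' : st m = Some s -> st (m + i) = Some s' ->
  [/\ s.1.1 <= s'.1.1, (s.2 <= s'.2)%N, (i <= s'.2)%N,
      forall x, s'.1.1 <= x -> l s.2 x + i%:R * A <= l s'.2 x
    & forall x, x <= s.1.1 -> l s'.2 x + i%:R * A <= l s.2 x].
Proof.
move=> ms; elim: i s' => [|i IH] s'.
  rewrite addn0 ms => -[<-]; split => // x _; by rewrite mul0r addr0.
rewrite addnS => /st_prev[s1 ms1 n1]; have [u1 u2 u3 u4 u5] := IH _ ms1.
have [c1 _ _] := st_contact ms1.
case: s1 ms1 n1 u1 u2 u3 u4 u5 c1 => [[t1 a1] k1] ms1; case: s' => [[t2 a2] k2].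
move=> [[t12 ca2] [ck2 /andP[ka ak]] h1 h2 _] /= u1 u2 u3 u4 u5 c1.
have k12 : (k1 <= k2)%N by exact: leq_trans ka ak.
have k12' : (k1 < k2)%N.
  rewrite ltn_neqAle k12 andbT; apply/eqP => e; move: h1.
  by rewrite e ck2.2; move: A0; lra.
split.
- by apply: le_trans u1 _; exact: ltW.
- exact: leq_trans u2 k12.
- exact: leq_ltn_trans u3 k12'.
- move=> x x2; have := u4 x (le_trans (ltW t12) x2).
  have := @lines_right k1 k2 A t2 x k12 x2; rewrite ck2.2 => /(_ h1).
  by rewrite -natr1; lra.
- move=> x x2; have := u5 x x2.
  have := @lines_left k1 k2 A t1 x k12 (le_trans x2 u1); rewrite c1.2 => /(_ h2).
  by rewrite -natr1; lra.
Qed.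

(** x lies between the abscissas of the nodes m and m + 1, where the node 0 extends
    to the left and the last node, if any, to the right. *)
Definition loc x m := exists s, [/\ st m = Some s, s.1.1 <= x \/ m = 0%N
  & forall s', st m.+1 = Some s' -> x <= s'.1.1].

Lemma loc_exists x : exists m, loc x m.
Proof.
apply: contrapT => nl.
have [s0 [e0 _]] := st0.
have P m : exists s, st m = Some s /\ (s.1.1 <= x \/ m = 0%N).
  elim: m => [|m [s [ms sx]]]; first by exists s0; split => //; right.
  apply: contrapT => H; apply: nl; exists m, s; split => // s' ms'.
  rewrite leNgt; apply/negP => h; apply: H; exists s'; split => //; left; exact: ltW.
have [j Ej jx] := attained (x + 1).
have [s [ms []//]] := P j.+1; rewrite leNgt.
have [c1 _ _] := st_contact ms.
move=> sx; have x1 : s.1.1 < x + 1 by move: sx; rewrite -leNgt; lra.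
have := @contact_mono s.2 j _ _ c1 (conj Ej jx) x1.
have [_ _ + _ _] := @st_order 0 j.+1 _ _ e0 ms.
by move=> /leq_trans h /h; rewrite ltnn.
Qed.

Definition bline m := omap (fun s : R * nat * nat => s.2) (st m).
Definition aline m := omap (fun s : R * nat * nat => s.1.2) (st m).

Definition dist (i m : nat) := ((i - m) + (m - i))%N.

(** The loss of 2 absorbs the position of x between its two nodes and, for the
    auxiliary lines of [aline_decay], the shift by one node. *)
Lemma bline_decay x m i k : loc x m -> bline i = Some k ->
  l k x + (dist i m - 2)%:R * A <= Psi x.
Proof.
move=> [s [ms sx s1]]; rewrite /bline; case is' : (st i) => [s'|]//= -[ks].
have mul0 n n' : (n <= n')%N -> n%:R * A <= n'%:R * A.
  by move=> nn; apply: ler_wpM2r; [exact: ltW|rewrite ler_nat].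
have [[k1 _] _ _] := st_contact is'; rewrite ks in k1.
have [im|im|im] := ltngtP i m.
- have [//|m0] := sx; last by rewrite m0 in im.
  move=> sx'; have ms' : st (i + (m - i)) = Some s by rewrite subnKC// ltnW.
  have [_ _ _ h _] := st_order is' ms'; have := h x sx'; rewrite ks.
  have [[Es _] _ _] := st_contact ms; have := line_le x Es.
  have := mul0 (dist i m - 2)%N (m - i)%N; rewrite /dist => /(_ _) h2.
  have := h2 _; rewrite (_ : (_ <= _)%N); [move=> /(_ isT); lra|lia].
- case sm1 : (st m.+1) => [s2|]; last first.
    have none j : st (m.+1 + j) = None.
      by elim: j => [|j IH]; rewrite ?addn0// addnS; exact: stN.
    by move: is'; rewrite -(subnKC im) none.
  have is2 : st (m.+1 + (i - m.+1)) = Some s' by rewrite subnKC.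
  have [_ _ _ _ h] := st_order sm1 is2; have := h x (s1 _ sm1); rewrite ks.
  have [[Es _] _ _] := st_contact sm1; have := line_le x Es.
  have := mul0 (dist i m - 2)%N (i - m.+1)%N; rewrite /dist => /(_ _) h2.
  have := h2 _; rewrite (_ : (_ <= _)%N); [move=> /(_ isT); lra|lia].
- by rewrite im /dist subnn mul0r addr0; exact: line_le.
Qed.

Lemma aline_decay x m i k : loc x m -> aline i = Some k ->
  l k x + (dist i m - 2)%:R * A <= Psi x.
Proof.
move=> lx; have [s [ms sx s1]] := lx; rewrite /aline; case is' : (st i) => [s'|]//= -[ks].
have mul0 n n' : (n <= n')%N -> n%:R * A <= n'%:R * A.
  by move=> nn; apply: ler_wpM2r; [exact: ltW|rewrite ler_nat].
have [[k1 k1'] [k2 k2'] k12] := st_contact is'; rewrite ks in k2 k2' k12.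
have [d2|d2] := leqP (dist i m) 2.
  have -> : (dist i m - 2 = 0)%N by lia.
  by rewrite mul0r addr0; exact: line_le.
have [im|im|im] := ltngtP i m; last by exfalso; move: d2; rewrite im /dist; lia.
- have bi : bline i = Some s'.2 by rewrite /bline is'.
  have := bline_decay lx bi.
  have [//|m0] := sx; last by rewrite m0 in im.
  move=> sx'; have ms' : st (i + (m - i)) = Some s by rewrite subnKC// ltnW.
  have [u1 _ _ _ _] := st_order is' ms'.
  have h3 : l k x <= l s'.2 x.
    by have := @lines_right k s'.2 0 s'.1.1 x k12 (le_trans u1 sx'); rewrite !addr0 k2' k1'; apply.
  lra.
- have [i' ei] : exists i', i = i'.+1 by exists i.-1; lia.
  have [s2 is2 n2] := st_prev (etrans (f_equal st (esym ei)) is').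
  have mi' : (m < i')%N by move: d2; rewrite /dist ei; lia.
  case sm1 : (st m.+1) => [s3|]; last first.
    have none j : st (m.+1 + j) = None.
      by elim: j => [|j IH]; rewrite ?addn0// addnS; exact: stN.
    by move: is'; rewrite -(subnKC im) none.
  have is3 : st (m.+1 + (i' - m.+1)) = Some s2 by rewrite subnKC.
  have [u1 _ _ _ h] := st_order sm1 is3; have := h x (s1 _ sm1).
  have [[Es _] _ _] := st_contact sm1; have := line_le x Es.
  have k2k : (s2.2 <= k)%N.
    move: n2; case: (s2) => [[? ?] ?]; case: (s') ks => [[? ?] ?] /= ->.
    by case=> [_ [_ /andP[? _]]].
  have [[_ c2] _ _] := st_contact is2.
  have xt : x <= s2.1.1 by exact: le_trans (s1 _ sm1) u1.
  have h3 : l k x <= l s2.2 x.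
    by have := @lines_left s2.2 k 0 s2.1.1 x k2k xt; rewrite !addr0 c2; apply; exact: line_le.
  have := mul0 (dist i m - 2)%N (i' - m.+1)%N; rewrite /dist => /(_ _) h2.
  have := h2 _; rewrite (_ : (_ <= _)%N); [move=> /(_ isT); lra|lia].
Qed.

(** After the last node two lines are needed, that of the node and the one given by
    [terminal]. *)
Lemma last_line : exists oK : option nat, (forall K, oK = Some K -> E K) /\
  forall m s y, st m = Some s -> st m.+1 = None -> s.1.1 <= y ->
    Psi y <= l s.2 y + A \/ exists2 K, oK = Some K & Psi y <= l K y + A.
Proof.
have [[m [s [ms ms1]]]|H] := pselect (exists m s, st m = Some s /\ st m.+1 = None); last first.
  by exists None; split => // m s y ms ms1; exfalso; apply: H; exists m, s.
have [c1 _ _] := st_contact ms.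
have [K EK HK] := terminal c1 (stT ms ms1).
exists (Some K); split; first by move=> _ [<-].
move=> m' s' y ms' ms1'.
have none n j : st n = None -> st (n + j) = None.
  by move=> n0; elim: j => [|j IH]; rewrite ?addn0// addnS; exact: stN.
have e : m' = m.
  apply/eqP; rewrite eqn_leq; apply/andP; split; rewrite leqNgt; apply/negP => h.
    by move: ms'; rewrite -(subnKC h) (none _ _ ms1).
  by move: ms; rewrite -(subnKC h) (none _ _ ms1').
move: ms'; rewrite e ms => -[<-] /HK[h|h]; [by left|right].
by exists K.
Qed.

Lemma cover x m oK : loc x m ->
  (forall m s y, st m = Some s -> st m.+1 = None -> s.1.1 <= y ->
    Psi y <= l s.2 y + A \/ exists2 K, oK = Some K & Psi y <= l K y + A) ->
  [\/ exists2 k, bline m = Some k & Psi x <= l k x + A,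
      exists2 k, aline m.+1 = Some k & Psi x <= l k x + A
    | exists2 k, oK = Some k & Psi x <= l k x + A].
Proof.
move=> [s [ms sx s1]] HK.
have [xs|xs] := leP s.1.1 x; last first.
  apply: Or31; exists s.2; first by rewrite /bline ms.
  have [sx'|m0] := sx; first by move: sx'; rewrite leNgt xs.
  have [s0 [e0 [c0 _]]] := st0; move: ms; rewrite m0 e0 => -[e]; rewrite -e in xs *.
  by rewrite (c0 x (ltW xs)).2 lerDl ltW.
case sm1 : (st m.+1) => [s2|].
  have x2 := s1 _ sm1; have := stS ms sm1.
  case: s {sx s1} xs ms => [[t a] k] /= xs ms; case: s2 sm1 x2 => [[t2 a2] k2] /= sm1 x2.
  case=> [_ _ _ _ [h|h]].
    by apply: Or31; exists k; rewrite /bline ?ms//; apply: h; rewrite xs.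
  by apply: Or32; exists a2; rewrite /aline ?sm1//; apply: h; rewrite xs.
have [h|[K -> h]] := HK m s x ms sm1 xs.
  by apply: Or31; exists s.2 => //; rewrite /bline ms.
by apply: Or33; exists K.
Qed.

End Nodes.

End Tropical.

(** * Splitting a tropical power series into lacunary ones *)

Section Splitting.
Variable R : realType.

(** Two geometric series, each with sum q / (1 - q) <= 2 q. *)
Lemma geom_sum (q : R) (p N : nat) : 0 <= q -> q <= 1 / 2 ->
  \sum_(i < N | (i : nat) != p) q ^+ dist i p <= 4 * q.
Proof.
move=> q0 q2.
have qn n : 0 <= q ^+ n by rewrite exprn_ge0.
have hq a : 0 <= a -> q * a <= a / 2 by move=> a0; rewrite mulrC ler_wpM2l//; lra.
suff [H1 H2] : ((N <= p)%N -> \sum_(i < N | (i : nat) != p) q ^+ dist i p <= 2 * q ^+ (p - N).+1) /\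
    ((p < N)%N -> \sum_(i < N | (i : nat) != p) q ^+ dist i p <= 4 * q - 2 * q ^+ (N - p)).
  have [Np|pN] := leqP N p.
    apply: le_trans (H1 Np) _; rewrite exprS.
    have : q ^+ (p - N) <= 1 by rewrite exprn_ile1//; lra.
    nra.
  by apply: le_trans (H2 pN) _; have := qn (N - p)%N; lra.
elim: N => [|N [IH1 IH2]].
  by split => // _; rewrite big_ord0 mulr_ge0.
rewrite big_mkcond big_ord_recr -big_mkcond/=; split.
- move=> Np; have := IH1 (ltnW Np); rewrite (_ : N != p); last by rewrite neq_ltn Np.
  rewrite /dist (_ : N - p = 0)%N; last by lia.
  rewrite add0n (_ : (p - N) = (p - N.+1).+1)%N; last by lia.
  rewrite !exprS; have := hq _ (mulr_ge0 q0 (qn (p - N.+1)%N)); lra.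
- rewrite ltnS leq_eqVlt => /predU1P[e|pN].
    rewrite -e eqxx /= addr0; move: IH1; rewrite -e subnn subSnn !expr1 => /(_ (leqnn _)).
    by move=> h; apply: le_trans h _; lra.
  have := IH2 pN; rewrite (_ : N != p); last by rewrite neq_ltn pN orbT.
  rewrite /dist (_ : p - N = 0)%N; last by lia.
  rewrite addn0 (_ : (N.+1 - p) = (N - p).+1)%N; last by lia.
  rewrite exprS; have := hq _ (qn (N - p)%N); lra.
Qed.

(** None stands for a missing term, since a lacunary series may be finite. *)
Definition tterm (b : nat -> R) (o : option nat) (x : R) : R :=
  if o is Some k then expR (tline b k x) else 0.

(** Among the lines of the nodes, and among the auxiliary ones, those whose numbers
    agree modulo 5 are far enough apart for their terms to decay geometrically away
    from x, in spite of the loss of 2 in [bline_decay]. This makes ten lacunary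
    series, and an eleventh one consists of the terminal line. At each x one term
    is within the factor q of the maximum, and in its series it exceeds the sum of
    the others as soon as 4 q < 1. *)
Lemma splitting (E : nat -> Prop) (b : nat -> R) (Psi : R -> R) (q : R) :
  (forall j x, E j -> tline b j x <= Psi x) ->
  (forall x, exists2 j, E j & tline b j x = Psi x) -> 0 < q -> q <= 1 / 2 ->
  exists fam : ('I_5 * bool + unit) -> nat -> option nat,
  (forall r i k, fam r i = Some k -> E k) /\
  forall x, (forall r N, \sum_(i < N) tterm b (fam r i) x <= 5 * expR (Psi x)) /\
    exists r p, q * expR (Psi x) <= tterm b (fam r p) x /\
      forall N, \sum_(i < N | (i : nat) != p) tterm b (fam r i) x <= 4 * q ^+ 2 * expR (Psi x).
Proof.
move=> ble batt q0 q2; pose A := - ln q.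
have eA : expR (- A) = q by rewrite opprK lnK.
have A0 : 0 < A by rewrite oppr_gt0 ln_lt0// q0; lra.
clearbody A.
have [st [st0 stS stN stT]] := node_seq ble batt A0.
have [oK [EK HK]] := last_line ble batt A0 st0 stS stN stT.
pose g (c : bool) n := if c then bline st n else aline st n.
have Eg c n k : g c n = Some k -> E k.
  rewrite /g /bline /aline; case: c; case sn: (st n) => [s|]//= -[<-];
  by have [[? _] [? _] _] := st_contact st0 stS stN sn.
pose fam (r : 'I_5 * bool + unit) i := match r with
  | inl (r, c) => g c (5 * i + r)%N | inr _ => if i is 0%N then oK else None end.
exists fam; split.
  move=> [[r c]|[]] i k /=; first exact: Eg.
  by case: i => // /EK.
move=> x; have [m lx] := loc_exists ble batt A0 st0 stS stN x.
set V := expR (Psi x); have V0 : 0 < V by exact: expR_gt0.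
have decay c n k : tline b k x + n%:R * A <= Psi x -> (c <= n)%N -> expR (tline b k x) <= q ^+ c * V.
  move=> h cn; rewrite -eA -expRM_natl -expRD ler_expR.
  have : c%:R * A <= n%:R * A by apply: ler_wpM2r; [exact: ltW|rewrite ler_nat].
  rewrite mulrN; lra.
have gd c i n : (n <= dist i m - 2)%N -> tterm b (g c i) x <= q ^+ n * V.
  move=> ni; case gi : (g c i) => [k|]/=; last by rewrite mulr_ge0 ?exprn_ge0 ?ltW.
  apply: decay ni; move: gi; rewrite /g; case: c => gi.
    exact: (bline_decay ble A0 st0 stS stN lx gi).
  exact: (aline_decay ble A0 st0 stS stN lx gi).
have q1 : q <= 1 by lra.
have bound r N : \sum_(i < N) tterm b (fam r i) x <= 5 * V.
  case: r => [[r c]|[]].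
  - pose p := (m %/ 5)%N.
    have t1 : \sum_(i < N | (i : nat) == p) tterm b (fam (inl (r, c)) i) x <= V.
      have [pN|Np] := ltnP p N.
        rewrite (big_pred1 (Ordinal pN))//= -[leRHS]mul1r -(expr0 q).
        exact: gd.
      rewrite big1 ?ltW// => i /eqP ip; exfalso; have := ltn_ord i; rewrite ip; lia.
    have t2 : \sum_(i < N | (i : nat) != p) tterm b (fam (inl (r, c)) i) x <= 4 * V.
      have h i : i != p -> tterm b (fam (inl (r, c)) i) x <= q ^+ (dist i p - 1) * V.
        move=> ip; apply: gd; have := ltn_ord r; have := divn_eq m 5; have := ltn_pmod m (isT : (0 < 5)%N).
        by rewrite -/p /dist; lia.
      apply: (@le_trans _ _ (\sum_(i < N | (i : nat) != p) (q ^+ dist i p * (V / q)))).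
        apply: ler_sum => i ip; apply: le_trans (h _ ip) _.
        have -> : (dist i p = (dist i p - 1).+1)%N by rewrite /dist; lia.
        by rewrite exprS subn1 /= le_eqVlt; apply/orP; left; apply/eqP; field; rewrite gt_eqF.
      rewrite -mulr_suml; apply: le_trans (ler_wpM2r _ (geom_sum p N (ltW q0) q2)) _.
        by rewrite divr_ge0 ?ltW.
      by rewrite le_eqVlt; apply/orP; left; apply/eqP; field; rewrite gt_eqF.
    rewrite (bigID (fun i : 'I_N => (i : nat) == p))/=; lra.
  - apply: (@le_trans _ _ V); last by rewrite ler_peMl ?ltW//; lra.
    case: N => [|N]; first by rewrite big_ord0 ltW.
    rewrite big_ord_recl big1 ?addr0; last by move=> i _.
    rewrite /=; case eK : oK => [K|]/=; last exact: ltW.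
    by rewrite ler_expR; apply: ble; exact: EK.
split=> //.
have mn c n k : g c n = Some k -> Psi x <= tline b k x + A -> n = m \/ n = m.+1 ->
    exists r p, q * V <= tterm b (fam r p) x /\
      forall N, \sum_(i < N | (i : nat) != p) tterm b (fam r i) x <= 4 * q ^+ 2 * V.
  move=> gk hk nm; have n5 : (n %% 5 < 5)%N by rewrite ltn_mod.
  pose p := (n %/ 5)%N; have pe : (5 * p + n %% 5 = n)%N by rewrite /p {3}(divn_eq n 5); lia.
  exists (inl (Ordinal n5, c)), p; split.
    by rewrite /fam/= pe gk /= -eA -expRD ler_expR; lra.
  move=> N; apply: (@le_trans _ _ (\sum_(i < N | (i : nat) != p) (q ^+ dist i p * (q * V)))).
    apply: ler_sum => i ip; rewrite mulrA -exprSr; apply: gd.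
    by rewrite /= /dist; move: pe n5 ip; case: nm => ->; rewrite -/p; lia.
  rewrite -mulr_suml; apply: le_trans (ler_wpM2r _ (geom_sum p N (ltW q0) q2)) _.
    by rewrite mulr_ge0 ?ltW.
  by rewrite le_eqVlt; apply/orP; left; apply/eqP; ring.
have [[k hk hx]|[k hk hx]|[k hk hx]] := cover A0 st0 stS lx HK.
- by apply: (@mn true m k) => //; left.
- by apply: (@mn false m.+1 k) => //; right.
- exists (inr tt), 0%N; split.
    by rewrite /fam hk /= -eA -expRD ler_expR; lra.
  move=> N; rewrite big1 ?mulr_ge0 ?exprn_ge0 ?ltW//.
  by move=> [[|i] iN] //=.
Qed.

End Splitting.

(** * The largest log-tropical minorant of a weight *)

Section PowLip.
Variable R : realType.

(** The Lipschitz constant at t is bounded by the value at t + 1, with no factor j;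
    this is why v t - v s <= (t - s) v (t + 1) for suprema v of monomials. *)
Lemma pow_lip (s t : R) j : 0 <= s -> s <= t -> t ^+ j - s ^+ j <= (t - s) * (t + 1) ^+ j.
Proof.
move=> s0 st; have t0 := le_trans s0 st; have d0 : 0 <= t - s by rewrite subr_ge0.
elim: j => [|j IH]; first by rewrite !expr0 subrr mulr1.
have e : t ^+ j.+1 - s ^+ j.+1 = t * (t ^+ j - s ^+ j) + (t - s) * s ^+ j by rewrite !exprS; ring.
have h1 := ler_wpM2l t0 IH.
have h2 : s ^+ j <= (t + 1) ^+ j by rewrite lerXn2r ?nnegrE ?addr_ge0//; lra.
have h3 := ler_wpM2l d0 h2.
have -> : (t - s) * (t + 1) ^+ j.+1 = t * ((t - s) * (t + 1) ^+ j) + (t - s) * (t + 1) ^+ j.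
  by rewrite exprS; ring.
by rewrite e; apply: lerD.
Qed.

Lemma pow_limit (L K N : R) j : 0 <= N -> 0 <= K ->
  (forall e, 0 < e -> L <= K * (N + e) ^+ j) -> L <= K * N ^+ j.
Proof.
move=> N0 K0 H; rewrite leNgt; apply/negP => lt1.
pose D := L - K * N ^+ j; have D0 : 0 < D by rewrite subr_gt0.
have Q0 : 0 <= K * (N + 2) ^+ j by rewrite mulr_ge0// exprn_ge0// addr_ge0.
pose Q := 2 * (K * (N + 2) ^+ j + 1).
have QP : 0 < Q by rewrite /Q; lra.
pose e := Num.min 1 (D / Q).
have e0 : 0 < e by rewrite lt_min ltr01 divr_gt0.
have e1 : e <= 1 by rewrite /e ge_min lexx.
have eD : e * Q <= D by rewrite -ler_pdivlMr// /e ge_min lexx orbT.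
clearbody e.
have Ne : N <= N + e by rewrite lerDl ltW.
have h1 := pow_lip j N0 Ne.
have h2 : (N + e + 1) ^+ j <= (N + 2) ^+ j by rewrite lerXn2r ?nnegrE//; lra.
have h3 : (N + e) ^+ j - N ^+ j <= e * (N + 2) ^+ j.
  apply: le_trans h1 _; rewrite [N + e - N](_ : _ = e); last by ring.
  by rewrite ler_wpM2l// ltW.
have h4 := ler_wpM2l K0 h3.
have := H e e0; move: eD; rewrite /Q /D; lra.
Qed.

End PowLip.

Section TropicalBasics.
Variable R : realType.

Lemma tropical_lines (Psi : R -> R) : tropical_power_series Psi -> exists E b,
  (forall j x, E j -> tline b j x <= Psi x) /\
  (forall x, exists2 j, E j & tline b j x = Psi x).
Proof.
move=> [E [b H]]; exists E, b.
have le j x : E j -> tline b j x <= Psi x.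
  move=> Ej; rewrite -lee_fin H; apply: ereal_sup_ubound; by exists j.
split=> //; apply: sup_attained => // x y yP.
apply: contrapT => nj; have : ((Psi x)%:E <= y%:E)%E.
  rewrite H; apply: ge_ereal_sup => _ [j Ej <-]; rewrite lee_fin leNgt; apply/negP => h.
  by apply: nj; exists j.
by rewrite lee_fin leNgt yP.
Qed.

Lemma expR_tline b j x : expR (tline b j x) = expR (b j) * expR x ^+ j :> R.
Proof. by rewrite /tline expRD expRM_natl. Qed.

Variable w : R -> R.
Hypothesis w_gt0 : forall t, 0 <= t -> 0 < w t.

Definition vmax (t : R) : R := sup [set bcoef w j * t ^+ j | j in [set: nat]].

Lemma vmax_ge t j : 0 < t -> bcoef w j * t ^+ j <= vmax t.
Proof.
move=> t0; apply: ub_le_sup; last by exists j.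
by exists (w t) => _ [i _ <-]; exact: bcoef_le.
Qed.

Lemma vmax_le t X : (forall j, bcoef w j * t ^+ j <= X) -> vmax t <= X.
Proof.
move=> H; apply: ge_sup; first by exists (bcoef w 0 * t ^+ 0), 0%N.
by move=> _ [i _ <-].
Qed.

Lemma vmax_le_w t : 0 < t -> vmax t <= w t.
Proof. by move=> t0; apply: vmax_le => j; exact: bcoef_le. Qed.

Lemma vmax_gt t X : X < vmax t -> exists j, X < bcoef w j * t ^+ j.
Proof.
move=> H; apply: contrapT => /forallNP nH.
move: H; rewrite ltNge => /negP; apply; apply: vmax_le => j.
by rewrite leNgt; apply/negP.
Qed.

Hypothesis w_low : exists2 c, 0 < c & forall t, 0 <= t -> c <= w t.

Lemma bcoef0_gt0 : 0 < bcoef w 0.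
Proof.
have [c c0 H] := w_low; apply: lt_le_trans c0 _.
apply: lb_le_inf; first by exists (w 1 / 1 ^+ 0), 1 => //=.
by move=> _ [t /= t0 <-]; rewrite expr0 divr1; apply: H; exact: ltW.
Qed.

Lemma vmax_gt0 t : 0 < t -> 0 < vmax t.
Proof.
move=> t0; apply: lt_le_trans bcoef0_gt0 _.
by rewrite -[bcoef w 0]mulr1 -(expr0 t); exact: vmax_ge.
Qed.

Definition bset (j : nat) := 0 < bcoef w j.
Definition bln (j : nat) := ln (bcoef w j).

Lemma vmax_line j x : bset j -> tline bln j x <= ln (vmax (expR x)).
Proof.
move=> Bj; rewrite -ler_expR expR_tline !lnK ?posrE ?vmax_gt0 ?expR_gt0//.
by apply: vmax_ge; exact: expR_gt0.
Qed.

Lemma vmax_approx x y : y < ln (vmax (expR x)) -> exists2 j, bset j & y < tline bln j x.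
Proof.
rewrite -ltr_expR lnK ?posrE ?vmax_gt0 ?expR_gt0// => /vmax_gt[j hj].
have Bj : bset j.
  rewrite /bset; have := lt_trans (expR_gt0 y) hj.
  by rewrite pmulr_lgt0// exprn_gt0// expR_gt0.
by exists j => //; rewrite -ltr_expR expR_tline lnK ?posrE.
Qed.

Lemma vmax_attained x : exists2 j, bset j & tline bln j x = ln (vmax (expR x)).
Proof.
move: x; apply: (@sup_attained _ bset bln (fun x => ln (vmax (expR x)))).
- by move=> j x; exact: vmax_line.
- exact: vmax_approx.
Qed.

(** Indices with a zero coefficient do not correspond to any line; they are left
    out of the index set. *)
Lemma vmax_log_tropical : log_tropical vmax.
Proof.
exists [set j | bset j], bln => x; apply/le_anti/andP; split.
- have [j Bj <-] := vmax_attained x; apply: ereal_sup_ubound.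
  by exists j.
- apply: ge_ereal_sup => _ [j Bj <-]; rewrite lee_fin; exact: vmax_line.
Qed.

End TropicalBasics.

(** * Series of holomorphic functions *)

Section HolClosure.
Variable R : realType.
Local Notation C := R[i].
Variable d : nat.
Local Notation V := 'rV[C]_d.
Implicit Types (f g : V -> C).

Lemma hol_cst (k : C) : holomorphic (fun _ : V => k).
Proof. by move=> z; exact: differentiable_cst. Qed.

Lemma hol_coord i : holomorphic (fun z : V => z 0 i).
Proof. by move=> z; exact: differentiable_coord. Qed.

Lemma holD f g : holomorphic f -> holomorphic g -> holomorphic (fun z => f z + g z).
Proof. by move=> hf hg z; exact: (differentiableD (hf z) (hg z)). Qed.

Lemma holM f g : holomorphic f -> holomorphic g -> holomorphic (fun z => f z * g z).
Proof. by move=> hf hg z; exact: (differentiableM (hf z) (hg z)). Qed.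

Lemma holX f n : holomorphic f -> holomorphic (fun z => f z ^+ n).
Proof.
move=> hf; elim: n => [|n IH]; first exact: hol_cst.
have -> : (fun z => f z ^+ n.+1) = (fun z => f z * f z ^+ n) by apply/funext => z; rewrite exprS.
exact: holM.
Qed.

Lemma hol_sum (I : Type) (s : seq I) (f : I -> V -> C) : (forall i, holomorphic (f i)) ->
  holomorphic (fun z => \sum_(i <- s) f i z).
Proof.
move=> hf; elim: s => [|i s IH].
  have -> : (fun z => \sum_(i <- [::]) f i z) = (fun=> 0) by apply/funext => z; rewrite big_nil.
  exact: hol_cst.
have -> : (fun z => \sum_(i <- i :: s) f i z) = (fun z => f i z + \sum_(i <- s) f i z).
  by apply/funext => z; rewrite big_cons.
exact: holD.
Qed.

(** The product C^(1 + n) = C x C^n is the setting of the induction on the dimension. *)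
Lemma hol_rsub (n : nat) (f : 'rV[C]_n -> C) : holomorphic f ->
  holomorphic (fun z : 'rV[C]_(1 + n) => f (rsubmx z)).
Proof.
move=> hf z.
have d1 : differentiable (@rsubmx C 1 1 n : 'rV[C]_(1 + n) -> 'rV[C]_n) z by exact: differentiable_rsubmx.
exact: (@differentiable_comp _ 'rV[C]_(1 + n) 'rV[C]_n C^o _ f _ d1 (hf _)).
Qed.

Lemma climit_shift (u : nat -> C) l k : climit u l -> climit (fun n => u (n + k)%N) l.
Proof.
move=> H e e0; have [N HN] := H e e0; exists N => n Nn; apply: HN.
by apply: leq_trans Nn _; rewrite leq_addr.
Qed.

Lemma abs_series (u : nat -> C) (B : R) : (forall N, \sum_(i < N) normc (u i) <= B) ->
  exists l, climit (fun N => \sum_(i < N) u i) l.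
Proof.
move=> H; apply: climitP => e e0.
pose v N := \sum_(i < N) normc (u i).
have vS N : v N.+1 = v N + normc (u N) by rewrite /v big_ord_recr.
have vm m n : (m <= n)%N -> v m <= v n.
  elim: n => [|n IH]; first by rewrite leqn0 => /eqP ->.
  rewrite leq_eqVlt => /predU1P[->//|mn]; apply: le_trans (IH mn) _.
  by rewrite vS lerDl normc_ge0.
have hs : has_sup (range v).
  by split; [exists (v 0%N), 0%N|exists B => _ [n _ <-]; exact: H].
have [_ [N _ <-] hN] := sup_adherent (divr_gt0 e0 (ltr0n _ 2)) hs.
have near m : (N <= m)%N -> v m - v N <= e / 2.
  move=> Nm; have : v m <= sup (range v).
    by apply: ub_le_sup; [exists B => _ [n _ <-]; exact: H|exists m].
  lra.
have diff m : (N <= m)%N -> normc (\sum_(i < m) u i - \sum_(i < N) u i) <= v m - v N.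
  elim: m => [|m IH]; first by rewrite leqn0 => /eqP ->; rewrite !subrr normc0.
  rewrite leq_eqVlt => /predU1P[->|Nm]; first by rewrite !subrr normc0.
  rewrite big_ord_recr/= vS addrAC [v m + _ - _]addrAC.
  by apply: le_trans (normcD _ _) _; rewrite lerD2r; exact: IH.
exists N => m n Nm Nn.
have -> : \sum_(i < m) u i - \sum_(i < n) u i =
    (\sum_(i < m) u i - \sum_(i < N) u i) - (\sum_(i < n) u i - \sum_(i < N) u i) by ring.
apply: le_trans (normcB _ _) _.
have := diff m Nm; have := diff n Nn; have := near m Nm; have := near n Nn; lra.
Qed.

Lemma normc_sum (I : Type) (s : seq I) (P : pred I) (u : I -> C) :
  normc (\sum_(i <- s | P i) u i) <= \sum_(i <- s | P i) normc (u i).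
Proof.
elim/big_rec2: _ => [|i y x _ h]; first by rewrite normc0.
by apply: le_trans (normcD _ _) _; rewrite lerD2l.
Qed.

Lemma series_upper (u : nat -> C) l (B : R) : climit (fun N => \sum_(i < N) u i) l ->
  (forall N, \sum_(i < N) normc (u i) <= B) -> normc l <= B.
Proof.
move=> ul H; apply: (climit_eps ul) => N.
exact: le_trans (normc_sum _ _ _) (H N).
Qed.

(** One term that exceeds the sum of the others survives in the sum. *)
Lemma series_lower (u : nat -> C) l p (B : R) : climit (fun N => \sum_(i < N) u i) l ->
  (forall N, \sum_(i < N | (i : nat) != p) normc (u i) <= B) -> normc (u p) - B <= normc l.
Proof.
move=> ul H.
have h : climit (fun N => \sum_(i < N + p.+1) u i + (- u p)) (l - u p).
  by apply: climitD; [exact: (@climit_shift (fun N => \sum_(i < N) u i) l p.+1 ul)|exact: climit_cst].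
have : normc (l - u p) <= B.
  apply: (climit_eps h) => N.
  have pN : (p < N + p.+1)%N by rewrite addnS ltnS leq_addl.
  rewrite (bigD1 (Ordinal pN))//= addrAC subrr add0r.
  apply: le_trans (normc_sum _ _ _) _; apply: le_trans (H (N + p.+1)%N).
  rewrite le_eqVlt; apply/orP; left; apply/eqP; apply: eq_bigl => i.
  by rewrite -val_eqE.
rewrite normc_distC => h2.
have := lerB_normc (u p) (l - u p); rewrite [u p + _]addrC subrK normc_distC; lra.
Qed.

Lemma series_hol (u : nat -> V -> C) (M : V -> R) :
  (forall i, holomorphic (u i)) ->
  (forall N z, \sum_(i < N) normc (u i z) <= M z) ->
  (forall rho : R, exists B, forall z, euclidean_norm z <= rho -> M z <= B) ->
  exists2 f : V -> C, holomorphic f & forall z, climit (fun N => \sum_(i < N) u i z) (f z).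
Proof.
move=> hu uM Mb.
have [f Hf] := choice (fun z => @abs_series (u ^~ z) (M z) (uM ^~ z)).
exists f => //; apply: (@hol_limit _ _ (fun N z => \sum_(i < N) u i z)) => //.
- by move=> N; apply: hol_sum.
- move=> rho; have [B HB] := Mb rho; exists B => N y hy.
  apply: le_trans (normc_sum _ _ _) _; apply: le_trans (uM N y) _; exact: HB.
Qed.

End HolClosure.

(** * Maps comparable with the powers of the Euclidean norm *)

Section HomWeight.
Variable R : realType.
Local Notation C := R[i].

Definition hypot (x y : R) : R := Num.sqrt (x ^+ 2 + y ^+ 2).

Lemma hypot_sqr x y : hypot x y ^+ 2 = x ^+ 2 + y ^+ 2.
Proof. by rewrite sqr_sqrtr// addr_ge0 ?sqr_ge0. Qed.

Lemma hypot_ge0 x y : 0 <= hypot x y. Proof. exact: sqrtr_ge0. Qed.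

Lemma hypot_le x y z : 0 <= z -> x ^+ 2 + y ^+ 2 <= z ^+ 2 -> hypot x y <= z.
Proof. by move=> z0 h; rewrite -(@ler_pXn2r _ 2) ?nnegrE ?hypot_ge0// hypot_sqr. Qed.

Lemma hypotZ a x y : 0 <= a -> hypot (a * x) (a * y) = a * hypot x y.
Proof.
move=> a0; apply: (@pexpIrn _ 2) => //; rewrite ?nnegrE ?mulr_ge0 ?hypot_ge0//.
by rewrite exprMn !hypot_sqr; ring.
Qed.

Lemma hypot_shift x y e : 0 <= x -> 0 <= y -> 0 <= e ->
  hypot (x + e) (y + e) <= hypot x y + 2 * e.
Proof.
move=> x0 y0 e0; have h0 := hypot_ge0 x y.
apply: hypot_le; first by rewrite addr_ge0// mulr_ge0.
have hx : x <= hypot x y by rewrite -(@ler_pXn2r _ 2) ?nnegrE// hypot_sqr lerDl sqr_ge0.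
have hy : y <= hypot x y by rewrite -(@ler_pXn2r _ 2) ?nnegrE// hypot_sqr lerDr sqr_ge0.
have h1 := ler_wpM2l e0 hx; have h2 := ler_wpM2l e0 hy.
have -> : (hypot x y + 2 * e) ^+ 2 = hypot x y ^+ 2 + 4 * (e * hypot x y) + 4 * e ^+ 2 by ring.
rewrite hypot_sqr; have := sqr_ge0 e; nra.
Qed.

(** The norm of (1, x) to the power j: by homogeneity |(zeta, y)|^j is
    |zeta|^j times this weight at |y| / |zeta|. *)
Definition hypow (j : nat) (x : R) : R := hypot 1 x ^+ j.

Lemma hypot_gt0 x : 0 < hypot 1 x.
Proof. by rewrite sqrtr_gt0 expr1n ltr_pwDl// sqr_ge0. Qed.

Lemma hypot1_ge1 x : 1 <= hypot 1 x.
Proof. by rewrite -(@ler_pXn2r _ 2) ?nnegrE ?hypot_ge0// hypot_sqr expr1n lerDl sqr_ge0. Qed.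

Lemma hypot1_mono x y : 0 <= x -> x <= y -> hypot 1 x <= hypot 1 y.
Proof.
move=> x0 xy; apply: hypot_le; rewrite ?hypot_ge0// hypot_sqr lerD2l.
by rewrite lerXn2r ?nnegrE// (le_trans x0).
Qed.

Lemma hypot1_lip x y : 0 <= x -> x <= y -> hypot 1 y <= hypot 1 x + (y - x).
Proof.
move=> x0 xy; have h0 := hypot_ge0 1 x.
have hx : x <= hypot 1 x by rewrite -(@ler_pXn2r _ 2) ?nnegrE// hypot_sqr expr1n lerDr.
apply: hypot_le; first by rewrite addr_ge0// subr_ge0.
have d0 : 0 <= y - x by rewrite subr_ge0.
have := ler_wpM2l d0 hx; rewrite sqrrD hypot_sqr => h.
nra.
Qed.

Lemma hypow_gt0 j x : 0 <= x -> 0 < hypow j x.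
Proof. by move=> _; rewrite exprn_gt0// hypot_gt0. Qed.

Lemma hypow_mono j x y : 0 <= x -> x <= y -> hypow j x <= hypow j y.
Proof. by move=> x0 xy; rewrite lerXn2r ?nnegrE ?hypot_ge0// hypot1_mono. Qed.

Lemma hypow_left j t c : 0 < t -> c < hypow j t ->
  exists2 y, 0 < y < t & forall s, y <= s <= t -> c < hypow j s.
Proof.
move=> t0 ct; pose K := (hypot 1 t + 1) ^+ j.
have K0 : 0 < K by rewrite exprn_gt0// addr_gt0 ?hypot_gt0.
pose D := (hypow j t - c) / (2 * K).
have D0 : 0 < D by rewrite divr_gt0 ?subr_gt0// mulr_gt0.
exists (Num.max (t / 2) (t - D)).
  by rewrite lt_max gt_max; apply/andP; split; lra.
move=> s; rewrite ge_max => /andP[/andP[s1 s2] st].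
have s0 : 0 <= s by lra.
have := pow_lip j (hypot_ge0 1 s) (hypot1_mono s0 st); rewrite -/(hypow j t) -/(hypow j s) -/K.
have : (hypot 1 t - hypot 1 s) * K <= D * K.
  by apply: ler_wpM2r; [exact: ltW|have := hypot1_lip s0 st; lra].
have -> : D * K = (hypow j t - c) / 2 by rewrite /D; field; rewrite gt_eqF.
lra.
Qed.

(** The linear form paired with (1, t) attains the norm at (1, t), by the equality
    case of the Cauchy-Schwarz inequality; take its j-th power. Hence
    [dominating_monomial] applies with kappa = 1, uniformly in j. *)
Lemma hypow_crit j t : 0 < t -> exists d (f : 'rV[C]_d -> C) z, [/\ holomorphic f,
  forall y, normc (f y) <= hypow j (euclidean_norm y), euclidean_norm z = t
  & 1 * hypow j t <= normc (f z)].
Proof.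
move=> t0; exists 1%N, (fun z => ((hypot 1 t)^-1%:C * (1 + t%:C * z 0 0)) ^+ j), (const_mx t%:C).
have p0 := hypot_gt0 t.
have ze : euclidean_norm (const_mx t%:C : 'rV[C]_1) = t.
  by rewrite /euclidean_norm big_ord1 mxE normc_real sqrtr_sqr normr_id gtr0_norm.
split => //.
- apply: holX; apply: holM; first exact: hol_cst.
  apply: holD; first exact: hol_cst.
  by apply: holM; [exact: hol_cst|exact: hol_coord].
- move=> y; rewrite normcX /hypow lerXn2r ?nnegrE ?normc_ge0 ?hypot_ge0//.
  rewrite normcM normc_real gtr0_norm ?invr_gt0// mulrC ler_pdivrMr//.
  have h1 : normc (1 + t%:C * y 0 0) <= 1 + t * euclidean_norm y.
    apply: le_trans (normcD _ _) _; rewrite normc1 normcM normc_real gtr0_norm//.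
    by rewrite lerD2l ler_wpM2l ?(ltW t0)// eucl_coord.
  apply: le_trans h1 _; have n0 := eucl_ge0 y.
  rewrite -(@ler_pXn2r _ 2) ?nnegrE ?mulr_ge0 ?addr_ge0 ?mulr_ge0 ?hypot_ge0 ?(ltW t0)//.
  rewrite exprMn !hypot_sqr expr1n; have := sqr_ge0 (t - euclidean_norm y); nra.
- rewrite mul1r normcX mxE /hypow lerXn2r ?nnegrE ?normc_ge0 ?hypot_ge0//.
  rewrite normcM normc_real gtr0_norm ?invr_gt0// mulrC ler_pdivlMr// -expr2 hypot_sqr.
  have -> : 1 + t%:C * t%:C = (1 + t * t)%:C by rewrite rmorphD rmorphM rmorph1.
  by rewrite normc_real expr1n -expr2 ler_norm.
Qed.

(** The weight grows like t^j, so its monomial minorants have degree at most j. This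
    keeps the exponents j - k below nonnegative. *)
Lemma hypow_bcoef j k : 0 < bcoef (hypow j) k -> (k <= j)%N.
Proof.
move=> B0; rewrite leqNgt; apply/negP => jk.
pose B := bcoef (hypow j) k.
have key t : 1 <= t -> B * t <= 2 ^+ j.
  move=> t1; have t0 : 0 < t by lra.
  have h := bcoef_le (hypow_gt0 j) k t0.
  have h2 : hypow j t <= (2 * t) ^+ j.
    rewrite /hypow lerXn2r ?nnegrE ?hypot_ge0//; first lra.
    by apply: hypot_le; [lra|rewrite exprMn expr1n; nra].
  have h3 : B * t ^+ j.+1 <= B * t ^+ k.
    by rewrite ler_wpM2l ?(ltW B0)// ler_weXn2l.
  have := le_trans h3 (le_trans h h2).
  by rewrite exprMn exprS mulrA ler_pM2r ?exprn_gt0.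
have := key (1 + 2 ^+ j / B); rewrite lerDl divr_ge0 ?exprn_ge0 ?(ltW B0)// => /(_ isT).
by rewrite mulrDr mulr1 mulrCA divff ?gt_eqF// mulr1 gerDr leNgt B0.
Qed.

Lemma eucl_split d (z : 'rV[C]_(1 + d)) :
  euclidean_norm z = hypot (normc (z 0 0)) (euclidean_norm (rsubmx z)).
Proof.
apply: (@pexpIrn _ 2) => //; rewrite ?nnegrE ?eucl_ge0 ?hypot_ge0//.
rewrite hypot_sqr !eucl_sqr big_split_ord/= big_ord1; congr (normc (z 0 _) ^+ 2 + _).
  exact/val_inj.
by apply: eq_bigr => i _; rewrite mxE.
Qed.

(** The tropical power series within log 16 of log (hypow j). *)
Definition psi_h (j : nat) (x : R) : R := ln (vmax (hypow j) (expR x)).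

Lemma psi_h_lines j :
  (forall k x, bset (hypow j) k -> tline (bln (hypow j)) k x <= psi_h j x) /\
  (forall x, exists2 k, bset (hypow j) k & tline (bln (hypow j)) k x = psi_h j x).
Proof.
have low : exists2 c : R, 0 < c & forall t, 0 <= t -> c <= hypow j t.
  by exists 1 => // t _; rewrite exprn_ege1// hypot1_ge1.
split; first by move=> k x; exact: vmax_line (hypow_gt0 j) low _ _.
by move=> x; exact: vmax_attained (hypow_gt0 j) low x.
Qed.

Lemma psi_h_bounds j t : 0 < t -> hypow j t / 16 <= expR (psi_h j (ln t)) <= hypow j t.
Proof.
move=> t0; have low : exists2 c : R, 0 < c & forall t, 0 <= t -> c <= hypow j t.
  by exists 1 => // s _; rewrite exprn_ege1// hypot1_ge1.
have v0 := vmax_gt0 (hypow_gt0 j) low t0.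
rewrite /psi_h !lnK ?posrE ?lnK ?posrE//.
rewrite vmax_le_w//; last exact: hypow_gt0.
have [k hk] := @dominating_monomial R (hypow j) (hypow_gt0 j) (@hypow_mono j) (@hypow_left j) 1 ltr01 (@hypow_crit j) t t0.
rewrite andbT; apply: le_trans (vmax_ge (hypow_gt0 j) k t0).
by apply: le_trans hk; rewrite mulrC mul1r.
Qed.

(** Substitutes for the monomials: finitely many components, with number and constants
    independent of the degree j, suffice for the maximum of their moduli to be
    comparable with |z|^j on all of C^d. *)
Definition comparable_system d (I : finType) (delta : R)
    (P : nat -> I -> 'rV[C]_d -> C) : Prop :=
  [/\ forall j i, holomorphic (P j i),
      forall j i z, normc (P j i z) <= euclidean_norm z ^+ j
    & forall j z, delta * euclidean_norm z ^+ j <= \sum_i normc (P j i z)].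

Lemma eucl_const (z : 'rV[C]_1) : euclidean_norm z = normc (z 0 0).
Proof. by rewrite /euclidean_norm big_ord1 sqrtr_sqr ger0_norm// normc_ge0. Qed.

Lemma comparable_system1 :
  @comparable_system 1 unit 1 (fun j _ z => z 0 0 ^+ j).
Proof.
split.
- by move=> j _; apply: holX; exact: hol_coord.
- by move=> j _ z; rewrite normcX eucl_const.
- by move=> j z; rewrite mul1r big_const card_unit/= normcX eucl_const addr0.
Qed.

(** The 1 in the denominator avoids the case of an empty index set. *)
Lemma pigeonhole (I : finType) (a : I -> R) (delta m : R) : 0 < delta -> 0 < m ->
  delta * m <= \sum_i a i -> exists i, delta / (#|I|%:R + 1) * m <= a i.
Proof.
move=> d0 m0 H; apply: contrapT => /forallNP nH.
have c0 : (0 : R) < #|I|%:R + 1 by rewrite ltr_wpDl.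
have : \sum_i a i <= \sum_(i : I) delta / (#|I|%:R + 1) * m.
  by apply: ler_sum => i _; rewrite leNgt; apply/negP => h; apply: (nH i); exact: ltW.
rewrite sumr_const -[X in _ <= X]mulr_natl => h.
have := le_trans H h.
rewrite mulrA -subr_ge0 -mulrBl pmulr_lge0// subr_ge0 mulrCA -{1}[delta]mulr1 ler_pM2l//.
by rewrite ler_pdivlMr// mul1r gerDl leNgt ltr01.
Qed.

End HomWeight.

Section Step.
Variable R : realType.
Local Notation C := R[i].
Local Notation Fam := ('I_5 * bool + unit)%type.

(** Pass from the moduli of the terms to the modulus of the sum: the component i in
    which the dominant term is large keeps it at least twice as large as the sum of
    all the others. *)
Lemma dominance (I : finType) (delta q T V : R) (b : nat -> R) (fam : Fam -> nat -> option nat) (x : R)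
    (u : Fam -> I -> nat -> C) (l : Fam -> I -> C) :
  0 < delta -> 0 < q -> 8 * q <= delta / (#|I|%:R + 1) -> 0 < T -> 0 < V ->
  (exists r p, q * V <= tterm b (fam r p) x /\
     forall N, \sum_(m < N | (m : nat) != p) tterm b (fam r m) x <= 4 * q ^+ 2 * V) ->
  (forall r i m, normc (u r i m) <= T * tterm b (fam r m) x) ->
  (forall r m, delta * (T * tterm b (fam r m) x) <= \sum_i normc (u r i m)) ->
  (forall r i, climit (fun N => \sum_(m < N) u r i m) (l r i)) ->
  delta / (#|I|%:R + 1) * q / 2 * (T * V) <= \sum_(ri : Fam * I) normc (l ri.1 ri.2).
Proof.
move=> d0 q0 q8 T0 V0 [r [p [low oth]]] ule uge ul.
have qV : 0 < q * V by rewrite mulr_gt0.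
have t0 : 0 < T * tterm b (fam r p) x by rewrite mulr_gt0//; exact: lt_le_trans low.
have [i hi] := pigeonhole d0 t0 (uge r p).
set d2 := delta / (#|I|%:R + 1) in q8 hi *.
have hl := @series_lower R (u r i) (l r i) p (T * (4 * q ^+ 2 * V)) (ul r i).
have {}hl : normc (u r i p) - T * (4 * q ^+ 2 * V) <= normc (l r i).
  apply: hl => N; apply: (@le_trans _ _ (\sum_(m < N | (m : nat) != p) T * tterm b (fam r m) x)).
    by apply: ler_sum => m _; exact: ule.
  by rewrite -mulr_sumr ler_wpM2l// ltW.
apply: (@le_trans _ _ (normc (l r i))); last first.
  rewrite (bigD1 (r, i))//= lerDl sumr_ge0// => ri _; exact: normc_ge0.
apply: le_trans hl; have d20 : 0 <= d2 by apply: le_trans q8; rewrite mulr_ge0// ltW.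
have h1 : d2 * (T * (q * V)) <= normc (u r i p).
  by apply: le_trans hi; rewrite ler_wpM2l// ler_wpM2l// ltW.
have h2 : 8 * q * (q * (T * V)) <= d2 * (q * (T * V)).
  by rewrite ler_wpM2r// !mulr_ge0// ltW.
have -> : d2 * q / 2 * (T * V) = d2 * (q * (T * V)) / 2 by field.
have -> : T * (4 * q ^+ 2 * V) = 8 * q * (q * (T * V)) / 2 by field.
move: h1; rewrite (_ : T * (q * V) = q * (T * V)); [lra|ring].
Qed.

Lemma hypot_le_add (x y : R) : 0 <= x -> 0 <= y -> hypot x y <= x + y.
Proof.
move=> x0 y0; apply: hypot_le; first exact: addr_ge0.
by rewrite sqrrD lerD2r lerDl mulrn_wge0// mulr_ge0.
Qed.

Lemma hypot_mono (x y x' y' : R) : 0 <= x -> 0 <= y -> x <= x' -> y <= y' -> hypot x y <= hypot x' y'.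
Proof.
move=> x0 y0 xx yy; apply: hypot_le; rewrite ?hypot_ge0// hypot_sqr.
by apply: lerD; rewrite lerXn2r ?nnegrE// (le_trans _ xx, le_trans _ yy).
Qed.

(** Points with both components nonzero, to which the scaled one-variable splitting
    applies, are dense and can be chosen with larger norm. *)
Lemma perturb d (z : 'rV[C]_(1 + d.+1)) (e : R) : 0 < e -> exists h : 'rV[C]_(1 + d.+1),
  [/\ euclidean_norm h <= e, euclidean_norm z <= euclidean_norm (z + h),
      (z + h) 0 0 != 0 & rsubmx (z + h) != 0].
Proof.
move=> e0; pose a : C := if z 0 0 == 0 then (e / 2)%:C else 0.
pose r : 'rV[C]_d.+1 := if rsubmx z == 0 then (e / 2)%:C *: delta_mx 0 0 else 0.
pose h : 'rV[C]_(1 + d.+1) := row_mx (const_mx a) r.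
have e2 : 0 < e / 2 by rewrite divr_gt0.
have eC : (e / 2)%:C != 0 by rewrite -normc_eq0 normc_real normr_eq0 gt_eqF.
have h0 : h 0 0 = a.
  have -> : (0 : 'I_(1 + d.+1)) = lshift d.+1 (0 : 'I_1) by exact/val_inj.
  by rewrite row_mxEl mxE.
have hr : rsubmx h = r by rewrite row_mxKr.
have zr : rsubmx (z + h) = rsubmx z + r by rewrite raddfD/= hr.
have z0 : (z + h) 0 0 = z 0 0 + a by rewrite mxE h0.
have na : normc a <= e / 2.
  by rewrite /a; case: ifP => _; rewrite ?normc0 ?normc_real ?gtr0_norm// ltW.
have nr : euclidean_norm r <= e / 2.
  rewrite /r; case: ifP => _; last by rewrite eucl0 ltW.
  rewrite euclZ normc_real gtr0_norm// ler_piMr ?(ltW e2)//.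
  apply: le_trans (eucl_le_sum _) _; rewrite (bigD1 0)//= big1 ?addr0.
    by rewrite mxE !eqxx normc1.
  by move=> j j0; rewrite mxE (negbTE j0) andbF normc0.
exists h; split.
- rewrite eucl_split hr h0; apply: le_trans (hypot_le_add (normc_ge0 _) (eucl_ge0 _)) _; lra.
- rewrite (eucl_split z) (eucl_split (z + h)) zr z0; apply: hypot_mono; rewrite ?normc_ge0 ?eucl_ge0//.
    by rewrite /a; case: eqP => [->|_]; rewrite ?normc0 ?normc_ge0 ?addr0.
  by rewrite /r; case: eqP => [->|_]; rewrite ?eucl0 ?eucl_ge0 ?addr0.
- rewrite z0 /a; have [e1|e1] := eqVneq (z 0 0) 0; last by rewrite addr0.
  by rewrite e1 add0r.
- rewrite zr /r; have [e1|e1] := eqVneq (rsubmx z) 0; last by rewrite addr0.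
  rewrite e1 add0r scaler_eq0 negb_or eC/=.
  apply/eqP => /matrixP/(_ 0 0); rewrite !mxE !eqxx => /eqP.
  by rewrite oner_eq0.
Qed.

Lemma sum_normc_limit d (J : finType) (f : J -> 'rV[C]_d -> C) (z : 'rV[C]_d) (L : R) :
  (forall j, holomorphic (f j)) ->
  (forall r, 0 < r -> exists2 h, euclidean_norm h <= r & L <= \sum_j normc (f j (z + h))) ->
  L <= \sum_j normc (f j z).
Proof.
move=> hf H; rewrite leNgt; apply/negP => lt1; set S := \sum_j _ in lt1.
pose n : R := #|J|%:R.
have n1 : 0 < n + 1 by rewrite ltr_wpDl.
pose e := (L - S) / 2 / (n + 1).
have e0 : 0 < e by rewrite !divr_gt0// subr_gt0.
have near_z j : exists r, 0 < r /\ forall h, euclidean_norm h <= r ->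
    normc (f j (z + h) - f j z) <= e.
  by have [r r0 Hr] := hol_continuous (hf j) z e0; exists r.
have [rr Hrr] := choice near_z.
pose r := \big[Num.min/1]_(j : J) rr j.
have r0 : 0 < r.
  rewrite /r; elim/big_ind: _ => // [x y x0 y0|j _]; first by rewrite lt_min x0.
  exact: (Hrr j).1.
have rle j : r <= rr j by rewrite /r; exact: bigmin_le_cond.
have [h hr Lh] := H r r0.
have : \sum_j normc (f j (z + h)) <= S + n * e.
  have -> : n * e = \sum_(j : J) e by rewrite sumr_const mulr_natl.
  rewrite /S -big_split/=; apply: ler_sum => j _.
  rewrite -[f j (z + h)](subrK (f j z)); apply: le_trans (normcD _ _) _.
  by rewrite [leRHS]addrC lerD2r; apply: (Hrr j).2; exact: le_trans hr (rle j).
have : n * e <= (L - S) / 2.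
  have h2 : (n + 1) * e = (L - S) / 2 by rewrite /e mulrC divfK// gt_eqF.
  by rewrite -h2 ler_wpM2r ?(ltW e0)// lerDl.
lra.
Qed.

(** By homogeneity |(zeta, y)|^j is a weight in |y| / |zeta|, which [splitting] turns
    into lacunary sums of terms e^(b k) |y|^k |zeta|^(j - k). Replace |y|^k by the
    maps of the system in dimension d and |zeta| by zeta. All constants are
    independent of j. *)
Lemma comparable_step d (I : finType) (delta : R) (P : nat -> I -> 'rV[C]_d.+1 -> C) :
  0 < delta -> comparable_system delta P ->
  exists (I' : finType) (delta' : R) (P' : nat -> I' -> 'rV[C]_(1 + d.+1) -> C),
    0 < delta' /\ comparable_system delta' P'.
Proof.
move=> d0 [hP Pu Pl].
have c0 : (0 : R) < #|I|%:R + 1 by rewrite ltr_wpDl.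
pose d2 := delta / (#|I|%:R + 1); have d20 : 0 < d2 by rewrite divr_gt0.
pose q := Num.min (1 / 2) (d2 / 8).
have q0 : 0 < q by rewrite lt_min !divr_gt0.
have q1 : q <= 1 / 2 by rewrite /q ge_min lexx.
have q8 : 8 * q <= d2 by rewrite mulrC -ler_pdivlMr// /q ge_min lexx orbT.
clearbody q.
have spl j := splitting (proj1 (psi_h_lines R j)) (proj2 (psi_h_lines R j)) q0 q1.
have [fam Hfam] := choice spl.
pose b j := bln (@hypow R j).
have famE j r m k : fam j r m = Some k -> (k <= j)%N.
  by move=> h; apply: (@hypow_bcoef R); exact: (proj1 (Hfam j)) h.
pose tc j r m (s t : R) : R := if fam j r m is Some k then expR (b j k) * s ^+ k * t ^+ (j - k) else 0.
have tcE j r m s t : 0 < s -> 0 < t -> tc j r m s t = t ^+ j * tterm (b j) (fam j r m) (ln (s / t)).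
  move=> s0 t0; rewrite /tc /tterm; case fe : (fam j r m) => [k|]; last by rewrite mulr0.
  rewrite expR_tline lnK ?posrE ?divr_gt0// -(subnK (famE _ _ _ _ fe)) exprD subnK ?(famE _ _ _ _ fe)//.
  by rewrite expr_div_n; field; rewrite expf_eq0 gt_eqF// andbF.
have tc_pos j r N s t : 0 < s -> 0 < t -> \sum_(m < N) tc j r m s t <= 5 * hypot t s ^+ j.
  move=> s0 t0; have st0 : 0 < s / t by rewrite divr_gt0.
  under eq_bigr do rewrite tcE//.
  rewrite -mulr_sumr; have [H1 _] := proj2 (Hfam j) (ln (s / t)).
  have /andP[_ H2] := psi_h_bounds j st0.
  have -> : 5 * hypot t s ^+ j = t ^+ j * (5 * hypow j (s / t)).
    rewrite /hypow mulrCA -exprMn -hypotZ ?(ltW t0)//; congr (5 * hypot _ _ ^+ j).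
      by rewrite mulr1.
    by field; rewrite gt_eqF.
  rewrite ler_wpM2l ?exprn_ge0 ?(ltW t0)//; apply: le_trans (H1 r N) _.
  by rewrite ler_wpM2l.
have tc_all j r N s t : 0 <= s -> 0 <= t -> \sum_(m < N) tc j r m s t <= 5 * hypot t s ^+ j.
  move=> s0 t0; apply: pow_limit => //; first exact: hypot_ge0.
  move=> e e0; have e2 : 0 < e / 2 by rewrite divr_gt0.
  apply: (@le_trans _ _ (\sum_(m < N) tc j r m (s + e / 2) (t + e / 2))).
    apply: ler_sum => m _; rewrite /tc; case: (fam j r m) => // k.
    apply: ler_pM; rewrite ?mulr_ge0 ?exprn_ge0 ?expR_ge0//.
      by rewrite ler_wpM2l ?expR_ge0// lerXn2r ?nnegrE ?addr_ge0 ?(ltW e2)// lerDl ltW.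
    by rewrite lerXn2r ?nnegrE ?addr_ge0 ?(ltW e2)// lerDl ltW.
  apply: le_trans (tc_pos _ _ _ _ _ _ _) _; rewrite ?ltr_wpDl//.
  rewrite ler_wpM2l// lerXn2r ?nnegrE ?hypot_ge0 ?addr_ge0 ?hypot_ge0 ?(ltW e0)//.
  by apply: le_trans (hypot_shift t0 s0 (ltW e2)) _; rewrite lerD2l; lra.
pose u j r i m (z : 'rV[C]_(1 + d.+1)) : C :=
  if fam j r m is Some k then (expR (b j k))%:C * (P k i (rsubmx z) * z 0 0 ^+ (j - k)) else 0.
have u_hol j r i m : holomorphic (u j r i m).
  rewrite /u; case: (fam j r m) => [k|]; last exact: hol_cst.
  apply: holM; first exact: hol_cst.
  by apply: holM; [exact: hol_rsub|apply: holX; exact: hol_coord].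
have u_le j r i m z : normc (u j r i m z) <=
    tc j r m (euclidean_norm (rsubmx z)) (normc (z 0 0)).
  rewrite /u /tc; case: (fam j r m) => [k|]; last by rewrite normc0.
  rewrite !normcM normcX normc_real ger0_norm ?expR_ge0// -mulrA ler_wpM2l ?expR_ge0//.
  by rewrite ler_wpM2r ?exprn_ge0 ?normc_ge0.
have u_sum j r i N z : \sum_(m < N) normc (u j r i m z) <= 5 * euclidean_norm z ^+ j.
  apply: (@le_trans _ _ (\sum_(m < N) tc j r m (euclidean_norm (rsubmx z)) (normc (z 0 0)))).
    by apply: ler_sum => m _; exact: u_le.
  by rewrite (eucl_split z); apply: tc_all; rewrite ?eucl_ge0 ?normc_ge0.
have ser (a : nat * (Fam * I)) : exists f : 'rV[C]_(1 + d.+1) -> C, holomorphic f /\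
    forall z, climit (fun N => \sum_(m < N) u a.1 a.2.1 a.2.2 m z) (f z).
  have [|||f hf fl] := @series_hol R (1 + d.+1) (u a.1 a.2.1 a.2.2) (fun z => 5 * euclidean_norm z ^+ a.1).
  - by move=> m; exact: u_hol.
  - by move=> N z; exact: u_sum.
  - move=> rho; exists (5 * `|rho| ^+ a.1) => z zr; rewrite ler_wpM2l// lerXn2r ?nnegrE ?eucl_ge0//.
    exact: le_trans zr (ler_norm _).
  - by exists f.
have [f Hf] := choice ser.
(* the factor 1/5 restores the upper bound |z|^j *)
pose P' j (ri : Fam * I) z : C := (5^-1 : R)%:C * f (j, ri) z.
have nP' j ri z : normc (P' j ri z) = normc (f (j, ri) z) / 5.
  by rewrite /P' normcM normc_real gtr0_norm ?invr_gt0// mulrC.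
exists (Fam * I)%type, (d2 * q / 160), P'; split; first by rewrite divr_gt0// mulr_gt0.
have P'hol j ri : holomorphic (P' j ri).
  by apply: holM; [exact: hol_cst|exact: (Hf (j, ri)).1].
split => //.
- move=> j ri z; rewrite nP' ler_pdivrMr// mulrC.
  apply: (@series_upper _ (fun m => u j ri.1 ri.2 m z)); last by move=> N; exact: u_sum.
  exact: (Hf (j, ri)).2 z.
- move=> j.
  have generic (z : 'rV[C]_(1 + d.+1)) : z 0 0 != 0 -> rsubmx z != 0 ->
      d2 * q / 160 * euclidean_norm z ^+ j <= \sum_ri normc (P' j ri z).
    move=> z0 zr; set t := normc (z 0 0); set s := euclidean_norm (rsubmx z).
    have t0 : 0 < t by rewrite normc_gt0.
    have s0 : 0 < s by rewrite lt_def eucl_ge0 andbT; apply: contra_neq zr; exact: eucl_eq0.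
    have st0 : 0 < s / t by rewrite divr_gt0.
    have [_ H2] := proj2 (Hfam j) (ln (s / t)).
    have /andP[V1 V2] := psi_h_bounds j st0.
    have T0 : 0 < t ^+ j by rewrite exprn_gt0.
    have v1 r i m : normc (u j r i m z) <= t ^+ j * tterm (b j) (fam j r m) (ln (s / t)).
      by rewrite -tcE//; exact: u_le.
    have v2 r m : delta * (t ^+ j * tterm (b j) (fam j r m) (ln (s / t))) <=
        \sum_i normc (u j r i m z).
      rewrite -tcE// /tc /u; case: (fam j r m) => [k|]; last first.
        by rewrite mulr0 sumr_ge0// => i _; exact: normc_ge0.
      under eq_bigr do rewrite !normcM normcX normc_real (ger0_norm (expR_ge0 _)).
      rewrite -mulr_sumr -mulr_suml -mulrA mulrCA ler_wpM2l ?expR_ge0//.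
      rewrite mulrA ler_wpM2r ?exprn_ge0 ?normc_ge0//; exact: Pl.
    have low := @dominance I delta q _ _ (b j) (fam j) (ln (s / t))
      (fun r i m => u j r i m z) (fun r i => f (j, (r, i)) z) d0 q0 q8 T0 (expR_gt0 _) H2
      v1 v2 (fun r i => (Hf (j, (r, i))).2 z).
    under eq_bigr do rewrite nP'.
    rewrite -mulr_suml ler_pdivlMr//.
    have -> : \sum_ri normc (f (j, ri) z) = \sum_(ri : Fam * I) normc (f (j, (ri.1, ri.2)) z).
      by apply: eq_bigr => -[].
    apply: le_trans low.
    have -> : euclidean_norm z ^+ j = t ^+ j * hypow j (s / t).
      rewrite (eucl_split z) -/t -/s /hypow -exprMn -hypotZ ?(ltW t0)//.
      by rewrite mulr1 mulrCA divff ?mulr1// gt_eqF.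
    have -> : d2 * q / 160 * (t ^+ j * hypow j (s / t)) * 5 =
        d2 * q / 2 * (t ^+ j * (hypow j (s / t) / 16)) by field.
    rewrite ler_wpM2l//; first by rewrite divr_ge0// mulr_ge0// ltW.
    by rewrite ler_wpM2l// ltW.
  move=> z; apply: sum_normc_limit => // r r0.
  have [h [hr zh g1 g2]] := perturb z r0.
  exists h => //; apply: le_trans (generic _ g1 g2).
  rewrite ler_wpM2l//; first by rewrite divr_ge0// mulr_ge0// ltW.
  by rewrite lerXn2r ?nnegrE ?eucl_ge0.
Qed.

Lemma comparable_exists d : exists (I : finType) (delta : R) (P : nat -> I -> 'rV[C]_d.+1 -> C),
  0 < delta /\ comparable_system delta P.
Proof.
elim: d => [|d [I [delta [P [d0 H]]]]]; last exact: comparable_step d0 H.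
exists unit, 1, (fun j _ z => z 0 0 ^+ j); split; [exact: ltr01|exact: comparable_system1].
Qed.

End Step.

(** * Competitors give an equivalent log-tropical weight *)

Section Weights.
Variable R : realType.
Local Notation C := R[i].
Local Notation Fam := ('I_5 * bool + unit)%type.
Variable w : R -> R.
Hypothesis hw : weight_function w.

Lemma weight_gt0 t : 0 <= t -> 0 < w t.
Proof. by case: hw => h _ _ _; exact: h. Qed.

Lemma weight_mono s t : 0 <= s -> s <= t -> w s <= w t.
Proof. by case: hw => _ h _ _; exact: h. Qed.

(** Turns bounds for positive arguments into bounds at 0, where logarithmic
    coordinates do not reach. *)
Lemma weight_right t a : 0 <= t -> (forall s, t < s -> a <= w s) -> a <= w t.
Proof.
move=> t0 H; rewrite leNgt; apply/negP => lt1.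
have wc : {within `[0, +oo[, continuous w} by case: hw.
have e0 : 0 < (a - w t) / 2 by rewrite divr_gt0// subr_gt0.
have [r r0 Hr] := (within_epsP w).1 wc t t0 _ e0.
have tr : t < t + r by rewrite ltrDl.
have /Hr : 0 <= t + r by rewrite addr_ge0// ltW.
rewrite (addrC t) addrK (gtr0_norm r0) lexx addrC => /(_ isT).
have := H _ tr => h1 /ler_normlP[_]; lra.
Qed.

Lemma weight_low : exists2 c, 0 < c & forall t, 0 <= t -> c <= w t.
Proof. by exists (w 0) => [|t t0]; [exact: weight_gt0|exact: weight_mono]. Qed.

Lemma bcoef_le_weight j t : 0 <= t -> bcoef w j * t ^+ j <= w t.
Proof.
move=> t0; apply: weight_right => // s ts.
have s0 : 0 < s by exact: le_lt_trans ts.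
apply: le_trans (bcoef_le weight_gt0 j s0).
by rewrite ler_wpM2l ?(bcoef_ge0 weight_gt0)// lerXn2r ?nnegrE ?(ltW s0) ?(ltW ts).
Qed.

Lemma vmax_ub t j : 0 <= t -> bcoef w j * t ^+ j <= vmax w t.
Proof.
move=> t0; apply: ub_le_sup; last by exists j.
by exists (w t) => _ [i _ <-]; exact: bcoef_le_weight.
Qed.

Lemma vmax_mono s t : 0 <= s -> s <= t -> vmax w s <= vmax w t.
Proof.
move=> s0 st; apply: vmax_le => j; apply: le_trans (vmax_ub j (le_trans s0 st)).
by rewrite ler_wpM2l ?(bcoef_ge0 weight_gt0)// lerXn2r ?nnegrE ?(le_trans s0 st).
Qed.

Lemma vmax_lip s t : 0 <= s -> s <= t -> vmax w t <= vmax w s + (t - s) * vmax w (t + 1).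
Proof.
move=> s0 st; apply: vmax_le => j; have b0 := bcoef_ge0 weight_gt0 j.
have t1 : 0 <= t + 1 by rewrite addr_ge0// (le_trans s0).
have h1 := ler_wpM2l b0 (pow_lip j s0 st).
have h2 := vmax_ub j s0.
have h3 : (t - s) * (bcoef w j * (t + 1) ^+ j) <= (t - s) * vmax w (t + 1).
  by rewrite ler_wpM2l ?subr_ge0//; exact: vmax_ub.
move: h1; rewrite mulrBr mulrCA; lra.
Qed.

Lemma vmax_continuous : {within `[0, +oo[, continuous vmax w}.
Proof.
apply/within_epsP => t t0 e e0.
have v0 : 0 < vmax w (t + 2) by apply: (vmax_gt0 weight_gt0 weight_low); lra.
exists (Num.min 1 (e / vmax w (t + 2))); first by rewrite lt_min ltr01 divr_gt0.
move=> s s0; rewrite le_min => /andP[s1]; rewrite ler_pdivlMr// => s2.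
have near a b : 0 <= a -> a <= b -> b <= t + 1 -> vmax w b - vmax w a <= (b - a) * vmax w (t + 2).
  move=> a0 ab bt; rewrite lerBlDl; apply: le_trans (vmax_lip a0 ab) _.
  rewrite lerD2l ler_wpM2l ?subr_ge0//; apply: vmax_mono; lra.
have [st|ts] := leP s t.
- rewrite ler0_norm ?subr_le0 ?vmax_mono// opprB.
  apply: le_trans s2; rewrite ler0_norm ?subr_le0// opprB; apply: near => //; lra.
- have ts' := ltW ts; rewrite ger0_norm ?subr_ge0 ?vmax_mono//.
  move: s1 s2; rewrite (ger0_norm (_ : 0 <= s - t)) ?subr_ge0// => s1 s2.
  apply: le_trans s2; apply: near => //; lra.
Qed.

(** The supremum of all monomials below w is log-tropical by construction, and
    [dominating_monomial] bounds it from below. *)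
Lemma competitors_tropical (kappa : R) : 0 < kappa ->
  (forall t, 0 < t -> exists d (f : 'rV[C]_d -> C) z, [/\ holomorphic f,
      forall y, normc (f y) <= w (euclidean_norm y), euclidean_norm z = t
    & kappa * w t <= normc (f z)]) ->
  exists v : R -> R, [/\ weight_function v, log_tropical v & equivalent_on [set t | 0 <= t] w v].
Proof.
move=> k0 H; have wc : {within `[0, +oo[, continuous w} by case: hw.
have dom := dominating_monomial weight_gt0 weight_mono (within_left wc) k0 H.
have k16 : 0 < kappa / 16 by rewrite divr_gt0.
have k1 : kappa <= 1.
  have [d [f [z [_ fw zt kf]]]] := H 1 ltr01.
  by have := le_trans kf (fw z); rewrite zt ger_pMl// weight_gt0.
have low t : 0 <= t -> kappa / 16 * w t <= vmax w t.
  move=> t0; have [te|t1] := eqVneq t 0.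
    apply: le_trans (vmax_ub 0 t0); rewrite te expr0 mulr1.
    apply: (@le_trans _ _ (w 0)).
      have := weight_gt0 (lexx 0); nra.
    apply: lb_le_inf; first by exists (w 1 / 1 ^+ 0), 1 => //=.
    by move=> _ [s /= s0 <-]; rewrite expr0 divr1; apply: weight_mono => //; exact: ltW.
  have [|j hj] := dom t; first by rewrite lt_def t1.
  exact: le_trans hj (vmax_ub j t0).
exists (vmax w); split.
- split.
  + move=> t t0; apply: lt_le_trans (low t t0).
    by rewrite mulr_gt0// weight_gt0.
  + exact: vmax_mono.
  + exact: vmax_continuous.
  + move=> M; have [_ _ _ ubd] := hw; have [t t0 Mt] := ubd (M / (kappa / 16)).
    exists t => //; apply: lt_le_trans (low t t0).
    by rewrite mulrC -ltr_pdivrMr.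
- exact: vmax_log_tropical weight_gt0 weight_low.
- exists (kappa / 16), 1; split => // t /= t0; split; first exact: low.
  by rewrite mul1r; apply: vmax_le => j; exact: bcoef_le_weight.
Qed.

End Weights.

(** * The three approximation properties *)

Section Implications.
Variable R : realType.
Local Notation C := R[i].
Local Notation Fam := ('I_5 * bool + unit)%type.

Definition tpow (b : nat -> R) (o : option nat) (s : R) : R :=
  if o is Some k then expR (b k) * s ^+ k else 0.

Lemma tpow_tterm b o s : 0 < s -> tpow b o s = tterm b o (ln s).
Proof. by move=> s0; case: o => //= k; rewrite expR_tline lnK. Qed.

Lemma tpow_ge0 b o s : 0 <= s -> 0 <= tpow b o s.
Proof. by move=> s0; case: o => //= k; rewrite mulr_ge0 ?expR_ge0// exprn_ge0. Qed.

Lemma tpow_mono b o s t : 0 <= s -> s <= t -> tpow b o s <= tpow b o t.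
Proof.
move=> s0 st; case: o => //= k.
by rewrite ler_wpM2l ?expR_ge0// lerXn2r ?nnegrE ?(le_trans s0 st).
Qed.

(** [splitting] for Psi x = log v(e^x), read in the variable s = e^x. *)
Lemma weight_splitting (v : R -> R) (q : R) : weight_function v -> log_tropical v ->
  0 < q -> q <= 1 / 2 ->
  exists (b : nat -> R) (fam : Fam -> nat -> option nat),
    (forall r N s, 0 <= s -> \sum_(m < N) tpow b (fam r m) s <= 5 * v s) /\
    forall s, 0 < s -> exists r p, q * v s <= tpow b (fam r p) s /\
      forall N, \sum_(m < N | (m : nat) != p) tpow b (fam r m) s <= 4 * q ^+ 2 * v s.
Proof.
move=> hv /tropical_lines[E [b [ble batt]]] q0 q1.
have [fam [_ H]] := splitting ble batt q0 q1.
have vE s : 0 < s -> expR (ln (v (expR (ln s)))) = v s.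
  by move=> s0; rewrite !lnK ?posrE// (weight_gt0 hv)// ltW.
exists b, fam; split.
- have pos r N s : 0 < s -> \sum_(m < N) tpow b (fam r m) s <= 5 * v s.
    move=> s0; under eq_bigr do rewrite tpow_tterm//.
    by rewrite -(vE s s0); exact: (H (ln s)).1.
  move=> r N s s0; rewrite -ler_pdivrMl//; apply: (weight_right hv) => // t st.
  rewrite ler_pdivrMl//; apply: le_trans (pos r N t (le_lt_trans s0 st)).
  by apply: ler_sum => m _; apply: tpow_mono => //; exact: ltW.
- move=> s s0; have [r [p [h1 h2]]] := (H (ln s)).2; exists r, p.
  rewrite -(vE s s0) tpow_tterm//; split => // N.
  by under eq_bigr do rewrite tpow_tterm//; exact: h2.
Qed.

(** A term of a lacunary series in which P k stands for the k-th power. *)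
Definition tmono d (b : nat -> R) (o : option nat) (P : nat -> 'rV[C]_d -> C) (z : 'rV[C]_d) : C :=
  if o is Some k then (expR (b k))%:C * P k z else 0.

Lemma tmono_hol d b o (P : nat -> 'rV[C]_d -> C) : (forall k, holomorphic (P k)) ->
  holomorphic (tmono b o P).
Proof.
move=> hP; rewrite /tmono; case: o => [k|]; last exact: hol_cst.
by apply: holM => //; exact: hol_cst.
Qed.

Lemma normc_tmono d b k (P : nat -> 'rV[C]_d -> C) z :
  normc (tmono b (Some k) P z) = expR (b k) * normc (P k z).
Proof. by rewrite normcM normc_real ger0_norm ?expR_ge0. Qed.

Lemma tmono_le d b o (P : nat -> 'rV[C]_d -> C) z :
  (forall k, normc (P k z) <= euclidean_norm z ^+ k) ->
  normc (tmono b o P z) <= tpow b o (euclidean_norm z).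
Proof.
move=> hP; case: o => [k|]; last by rewrite normc0.
by rewrite normc_tmono ler_wpM2l ?expR_ge0.
Qed.

Lemma weight_series d (v : R -> R) b (fam : Fam -> nat -> option nat) (P : nat -> 'rV[C]_d -> C) :
  weight_function v ->
  (forall r N s, 0 <= s -> \sum_(m < N) tpow b (fam r m) s <= 5 * v s) ->
  (forall k, holomorphic (P k)) ->
  (forall k z, normc (P k z) <= euclidean_norm z ^+ k) ->
  exists f : Fam -> 'rV[C]_d -> C, forall r, [/\ holomorphic (f r),
    forall z, climit (fun N => \sum_(m < N) tmono b (fam r m) P z) (f r z)
  & forall z, normc (f r z) <= 5 * v (euclidean_norm z)].
Proof.
move=> hv famle hP Ple.
have usum r N z : \sum_(m < N) normc (tmono b (fam r m) P z) <= 5 * v (euclidean_norm z).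
  apply: le_trans (famle r N _ (eucl_ge0 z)); apply: ler_sum => m _; exact: tmono_le.
have ser r : exists f : 'rV[C]_d -> C, [/\ holomorphic f,
    forall z, climit (fun N => \sum_(m < N) tmono b (fam r m) P z) (f z)
  & forall z, normc (f z) <= 5 * v (euclidean_norm z)].
  have [|||f hf fl] := @series_hol R d (fun m => tmono b (fam r m) P) (fun z => 5 * v (euclidean_norm z)).
  - by move=> m; exact: tmono_hol.
  - by move=> N z; exact: usum.
  - move=> rho; exists (5 * v `|rho|) => z zr; rewrite ler_wpM2l//.
    by apply: (weight_mono hv); [exact: eucl_ge0|exact: le_trans zr (ler_norm _)].
  - by exists f; split => // z; apply: (@series_upper _ (fun m => tmono b (fam r m) P z) _ _ (fl z)) => N; exact: usum.
by have [f Hf] := choice ser; exists f.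
Qed.

Lemma eucl_delta d (a : C) : euclidean_norm (a *: delta_mx 0 0 : 'rV[C]_d.+1) = normc a.
Proof.
rewrite euclZ /euclidean_norm (bigD1 0)//= big1 ?addr0.
  by rewrite mxE !eqxx normc1 expr1n sqrtr1 mulr1.
by move=> j j0; rewrite mxE (negbTE j0) andbF normc0 expr0n.
Qed.

(** The lacunary series of v with |z|^k replaced by the components of a comparable
    system. *)
Lemma tropical_family d (v : R -> R) : weight_function v -> log_tropical v ->
  exists (J : finType) (f : J -> 'rV[C]_d.+1 -> C) (c : R), [/\ 0 < c, (0 < #|J|)%N,
    forall i, holomorphic (f i),
    forall i z, normc (f i z) <= 5 * v (euclidean_norm z)
  & forall z, c * v (euclidean_norm z) <= \sum_i normc (f i z)].
Proof.
move=> hv tv; have [I [delta [P [d0 [hP Pu Pl]]]]] := comparable_exists R d.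
have c0 : (0 : R) < #|I|%:R + 1 by rewrite ltr_wpDl.
pose d2 := delta / (#|I|%:R + 1); have d20 : 0 < d2 by rewrite divr_gt0.
pose q := Num.min (1 / 2) (d2 / 8).
have q0 : 0 < q by rewrite lt_min !divr_gt0.
have q1 : q <= 1 / 2 by rewrite /q ge_min lexx.
have q8 : 8 * q <= d2 by rewrite mulrC -ler_pdivlMr// /q ge_min lexx orbT.
clearbody q; have [b [fam [fle flow]]] := weight_splitting hv tv q0 q1.
have ser i := weight_series hv fle (hP ^~ i) (Pu ^~ i).
have [f Hf] := choice ser.
exists (Fam * I)%type, (fun ri => f ri.2 ri.1), (d2 * q / 2); split.
- by rewrite divr_gt0// mulr_gt0.
- rewrite card_prod muln_gt0; apply/andP; split; first by apply/card_gt0P; exists (inr tt).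
  rewrite lt0n; apply/negP => /eqP I0.
  have := Pl 0%N 0; rewrite expr0 mulr1 big1 ?leNgt ?d0// => i _.
  by have := fintype0 i I0.
- by move=> ri; have [] := Hf ri.2 ri.1.
- by move=> ri z; have [] := Hf ri.2 ri.1.
move=> z; apply: (@sum_normc_limit R _ (Fam * I)%type (fun ri => f ri.2 ri.1)) => [ri|rho rho0]; first by have [] := Hf ri.2 ri.1.
have [h [hr zh]] : exists h, [/\ euclidean_norm h <= rho,
    euclidean_norm z <= euclidean_norm (z + h) & 0 < euclidean_norm (z + h)].
  have [->|z0] := eqVneq z 0.
    exists (rho%:C *: delta_mx 0 0); rewrite add0r eucl_delta eucl0 normc_real gtr0_norm//.
    by split => //; exact: ltW.
  exists 0; rewrite eucl0 addr0 lexx; split => //; first exact: ltW.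
  by rewrite lt_def eucl_ge0 andbT; apply: contra_neq z0; exact: eucl_eq0.
set s := euclidean_norm (z + h) => s0; exists h => //.
apply: (@le_trans _ _ (d2 * q / 2 * v s)).
  rewrite ler_wpM2l//; first by rewrite divr_ge0// mulr_ge0// ltW.
  by apply: (weight_mono hv) => //; exact: eucl_ge0.
have flow' : exists r p, q * v s <= tterm b (fam r p) (ln s) /\
    forall N, \sum_(m < N | (m : nat) != p) tterm b (fam r m) (ln s) <= 4 * q ^+ 2 * v s.
  have [r [p [h1 h2]]] := flow s s0; exists r, p; rewrite -tpow_tterm//; split => // N.
  by under eq_bigr do rewrite -tpow_tterm//; exact: h2.
have v1 r i m : normc (tmono b (fam r m) (P ^~ i) (z + h)) <= 1 * tterm b (fam r m) (ln s).
  by rewrite mul1r -tpow_tterm//; exact: tmono_le.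
have v2 r m : delta * (1 * tterm b (fam r m) (ln s)) <=
    \sum_i normc (tmono b (fam r m) (P ^~ i) (z + h)).
  rewrite mul1r -tpow_tterm//; case: (fam r m) => [k|]; last first.
    by rewrite mulr0 sumr_ge0// => i _; exact: normc_ge0.
  under eq_bigr do rewrite normc_tmono.
  by rewrite -mulr_sumr mulrCA ler_wpM2l ?expR_ge0//; exact: Pl.
have v3 r i : climit (fun N => \sum_(m < N) tmono b (fam r m) (P ^~ i) (z + h)) (f i r (z + h)).
  by have [_ + _] := Hf i r; exact.
have := @dominance R I delta q 1 (v s) b fam (ln s)
  (fun r i m => tmono b (fam r m) (P ^~ i) (z + h)) (fun r i => f i r (z + h)) d0 q0 q8
  ltr01 (weight_gt0 hv (ltW s0)) flow' v1 v2 v3.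
by rewrite mul1r.
Qed.

Lemma climit_Re_ge (u : nat -> C) l (L : R) N : climit u l ->
  (forall n, (N <= n)%N -> L <= Re (u n)) -> L <= Re l.
Proof.
move=> ul H; rewrite leNgt; apply/negP => lt1.
have [|M HM] := ul ((L - Re l) / 2); first by rewrite divr_gt0// subr_gt0.
have := H (maxn M N) (leq_maxr _ _).
have := le_trans (normc_ge_Re _) (HM (maxn M N) (leq_maxl _ _)).
rewrite ReD ReN => /ler_normlP[_]; lra.
Qed.

Lemma row_map_holomorphic d n (f : 'I_n -> 'rV[C]_d -> C) : (forall i, holomorphic (f i)) ->
  holomorphic_map (fun z => \row_i f i z : 'rV[C]_n).
Proof.
move=> hf z.
have -> : (fun z => \row_i f i z) = \sum_i (fun z => f i z *: (delta_mx 0 i : 'rV[C]_n)).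
  by apply/funext => y; rewrite fct_sumE [LHS]row_sum_delta; apply: eq_bigr => i _; rewrite mxE.
apply: differentiable_sum => i; exact: (@differentiableZl _ _ _ (f i) (delta_mx 0 i) z (hf i z)).
Qed.

Lemma map_coord_holomorphic d n (F : 'rV[C]_d -> 'rV[C]_n) i : holomorphic_map F ->
  holomorphic (fun z => F z 0 i).
Proof.
move=> hF z.
exact: (@differentiable_comp _ 'rV[C]_d 'rV[C]_n C^o F (fun y => y 0 i) z (hF z) (hol_coord i _)).
Qed.

Lemma tropical_map d (w v : R -> R) : weight_function v -> log_tropical v ->
  equivalent_on [set t | 0 <= t] w v -> approximable_by_map d.+1 w.
Proof.
move=> hv tv [D1 [D2 [D10 D20 HD]]].
have [J [f [c [c0 J0 hf fu fl]]]] := tropical_family d hv tv.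
exists #|J|; split => //.
pose n : R := #|J|%:R; have n0 : 0 < n by rewrite ltr0n.
exists (fun z => \row_i f (enum_val i) z); split; first by apply: row_map_holomorphic.
have sumE z : \sum_(k < #|J|) normc ((\row_i f (enum_val i) z) 0 k) = \sum_j normc (f j z).
  rewrite (reindex (@enum_val J (mem J))) /=; last first.
    by exists enum_rank => x _; [exact: enum_valK|exact: enum_rankK].
  by apply: eq_bigr => k _; rewrite mxE.
exists (D2 * n * 5)^-1, (n / (c * D1)); split.
- by rewrite invr_gt0 !mulr_gt0.
- by rewrite divr_gt0// mulr_gt0.
move=> z _; have [h1 h2] := HD _ (eucl_ge0 z); split.
- rewrite mulrC ler_pdivrMr ?mulr_gt0//.
  apply: le_trans (eucl_le_sum _) _; rewrite sumE.
  apply: (@le_trans _ _ (\sum_(j : J) 5 * v (euclidean_norm z))); first by apply: ler_sum => j _.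
  have -> : \sum_(j : J) 5 * v (euclidean_norm z) = n * (5 * v (euclidean_norm z)).
    by rewrite sumr_const [RHS]mulr_natl.
  have -> : w (euclidean_norm z) * (D2 * n * 5) = n * 5 * (D2 * w (euclidean_norm z)) by ring.
  by rewrite mulrA ler_wpM2l// mulr_ge0// ltW.
- rewrite mulrAC ler_pdivlMr ?mulr_gt0//.
  apply: le_trans (sum_le_eucl _); rewrite sumE; apply: le_trans (fl z).
  by rewrite mulrC -mulrA ler_wpM2l// ltW.
Qed.

(** The common form to which approximation by maps and essentiality are reduced. *)
Definition competitive d (w : R -> R) := exists2 kappa, 0 < kappa & forall z : 'rV[C]_d,
  exists f : 'rV[C]_d -> C, [/\ holomorphic f,
    forall y, normc (f y) <= w (euclidean_norm y)
  & kappa * w (euclidean_norm z) <= normc (f z)].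

(** The largest component of the map at z competes there, after normalization. *)
Lemma map_competitive d (w : R -> R) : weight_function w -> approximable_by_map d w -> competitive d w.
Proof.
move=> hw [n [n0 [F [hF [C1 [C2 [C10 C20 H]]]]]]].
exists (C1 * (1 / (#|'I_n|%:R + 1) / C2)).
  by rewrite mulr_gt0// divr_gt0// divr_gt0// ltr_wpDl.
move=> z; have [_ h2] := H z I.
have w0 := weight_gt0 hw (eucl_ge0 z).
have [|i hi] := @pigeonhole R 'I_n (fun i => normc (F z 0 i)) 1 _ ltr01 (divr_gt0 w0 C20).
  rewrite mul1r ler_pdivrMr// mulrC; apply: le_trans h2 _.
  by rewrite ler_wpM2l ?(ltW C20)//; exact: eucl_le_sum.
exists (fun z => C1%:C * F z 0 i); split.
- by apply: holM; [exact: hol_cst|exact: map_coord_holomorphic].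
- move=> y; have [h1 _] := H y I; rewrite normcM normc_real gtr0_norm//.
  by apply: le_trans h1; rewrite ler_wpM2l ?(ltW C10)//; exact: eucl_coord.
- rewrite normcM normc_real gtr0_norm// -!mulrA ler_wpM2l ?(ltW C10)//.
  by apply: le_trans hi; rewrite -mulrA (mulrC C2^-1).
Qed.

Lemma competitive_essential d (w : R -> R) : weight_function w -> competitive d w -> essential d w.
Proof.
move=> hw [kappa k0 H]; exists 1, kappa^-1; split; rewrite ?invr_gt0// => z _.
have ub : has_ubound [set normc (f z) | f in
    [set f : 'rV[C]_d -> C | holomorphic f /\ forall y, normc (f y) <= w (euclidean_norm y)]].
  by exists (w (euclidean_norm z)) => _ [f [_ fw] <-].
have [f [hf fw fz]] := H z; split.
- rewrite mul1r; apply: ge_sup; first by exists (normc (f z)), f.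
  by move=> _ [g [_ gw] <-].
- rewrite mulrC ler_pdivlMr// mulrC; apply: le_trans fz _.
  by apply: ub_le_sup => //; exists f.
Qed.

Lemma essential_competitive d (w : R -> R) : weight_function w -> essential d w -> competitive d w.
Proof.
move=> hw [C1 [C2 [C10 C20 H]]]; exists (C2^-1 / 2); first by rewrite divr_gt0// invr_gt0.
move=> z; have [_ h2] := H z I; have w0 := weight_gt0 hw (eucl_ge0 z).
have h3 : w (euclidean_norm z) / C2 <= associated_weight w z by rewrite ler_pdivrMr// mulrC.
have h4 : w (euclidean_norm z) / C2 / 2 < associated_weight w z.
  have : 0 < w (euclidean_norm z) / C2 by rewrite divr_gt0.
  lra.
have [] := sup_gt _ h4; last first.
  move=> _ [f [hf fw] <-] hz; exists f; split => //.
  by apply: le_trans (ltW hz); rewrite mulrC mulrA.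
exists 0, (fun=> 0); last by rewrite normc0.
split; first exact: hol_cst.
by move=> y; rewrite normc0 ltW// (weight_gt0 hw)// eucl_ge0.
Qed.

Lemma competitive_tropical d (w : R -> R) : weight_function w -> competitive d.+1 w ->
  exists v : R -> R, [/\ weight_function v, log_tropical v & equivalent_on [set t | 0 <= t] w v].
Proof.
move=> hw [kappa k0 H]; apply: (competitors_tropical hw k0) => t t0.
have [f [hf fw fz]] := H (t%:C *: delta_mx 0 0).
exists d.+1, f, (t%:C *: delta_mx 0 0); split => //.
  by rewrite eucl_delta normc_real gtr0_norm.
by move: fz; rewrite eucl_delta normc_real gtr0_norm.
Qed.

(** Since w > 0, [max_modulus] f is not the value 0 that [sup] gives to unbounded sets;
    hence it bounds f on spheres and is approached there. *)
Lemma max_modulus_tropical d (w : R -> R) : weight_function w -> approximable_by_max_modulus d w ->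
  exists v : R -> R, [/\ weight_function v, log_tropical v & equivalent_on [set t | 0 <= t] w v].
Proof.
move=> hw [f [hf [C1 [C2 [C10 C20 H]]]]].
have mpos t : 0 <= t -> 0 < max_modulus f t.
  move=> t0; have [_ h] := H t t0; have := lt_le_trans (weight_gt0 hw t0) h.
  by rewrite pmulr_rgt0.
have hs t : 0 <= t -> has_sup [set normc (f z) | z in [set z | euclidean_norm z = t]].
  move=> t0; apply: contrapT => /sup_out h0; have := mpos t t0.
  by rewrite /max_modulus h0 ltxx.
apply: (competitors_tropical hw (kappa := C1 / (2 * C2))); first by rewrite divr_gt0// mulr_gt0.
move=> t t0; have M0 := mpos t (ltW t0).
have : max_modulus f t / 2 < max_modulus f t by lra.
move=> /(sup_gt (hs t (ltW t0)).1)[_ [z zt <-] hz].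
exists d, (fun y => C1%:C * f y), z; split; [| |exact: zt|].
- by apply: holM => //; exact: hol_cst.
- move=> y; rewrite normcM normc_real gtr0_norm//.
  have [h1 _] := H _ (eucl_ge0 y); apply: le_trans h1; rewrite ler_wpM2l ?(ltW C10)//.
  by apply: ub_le_sup; [exact: (hs _ (eucl_ge0 y)).2|exists y].
- rewrite normcM normc_real gtr0_norm//.
  have [_ h2] := H t (ltW t0).
  have -> : C1 / (2 * C2) * w t = C1 * (w t / C2 / 2) by field; rewrite gt_eqF.
  rewrite ler_wpM2l ?(ltW C10)//; apply: le_trans (ltW hz).
  by rewrite ler_pM2r ?invr_gt0// ler_pdivrMr// mulrC.
Qed.

(** On the positive real axis of the first coordinate all terms are nonnegative, so no
    cancellation occurs and the sum of the eleven lacunary series is large there. *)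
Lemma tropical_max_modulus d (w v : R -> R) : weight_function v -> log_tropical v ->
  equivalent_on [set t | 0 <= t] w v -> approximable_by_max_modulus d.+1 w.
Proof.
move=> hv tv [D1 [D2 [D10 D20 HD]]].
have [b [fam [fle flow]]] := @weight_splitting v (1 / 2) hv tv ltac:(lra) (lexx _).
pose P k (z : 'rV[C]_d.+1) := z 0 0 ^+ k.
have hP k : holomorphic (P k) by apply: holX; exact: hol_coord.
have Pu k z : normc (P k z) <= euclidean_norm z ^+ k.
  by rewrite normcX lerXn2r ?nnegrE ?normc_ge0 ?eucl_ge0 ?eucl_coord.
have [f Hf] := weight_series hv fle hP Pu.
pose F z := \sum_r f r z; pose n : R := #|{: Fam}|%:R.
have hF : holomorphic F by apply: hol_sum => r; have [] := Hf r.
have Fu z : normc (F z) <= n * (5 * v (euclidean_norm z)).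
  apply: le_trans (normc_sum _ _ _) _; rewrite /n mulr_natl -sumr_const.
  by apply: ler_sum => r _; have [] := Hf r.
pose e t : 'rV[C]_d.+1 := t%:C *: delta_mx 0 0.
have eN t : 0 <= t -> euclidean_norm (e t) = t by move=> t0; rewrite eucl_delta normc_real ger0_norm.
have termE r m t : tmono b (fam r m) P (e t) = (tpow b (fam r m) t)%:C.
  rewrite /tmono /tpow; case: (fam r m) => [k|//].
  by rewrite /P !mxE !eqxx mulr1 rmorphM rmorphXn.
have Rel r t L N : (forall n, (N <= n)%N -> L <= \sum_(m < n) tpow b (fam r m) t) -> L <= Re (f r (e t)).
  move=> HL; have [_ fl _] := Hf r; apply: (climit_Re_ge (fl (e t)) (N := N)) => n' nN.
  under eq_bigr do rewrite termE.
  by rewrite -rmorph_sum/=; exact: HL.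
have Fl t : 0 <= t -> v t / 2 <= normc (F (e t)).
  have pos s : 0 < s -> v s / 2 <= normc (F (e s)).
    move=> s0; apply: le_trans (le_trans (ler_norm _) (normc_ge_Re _)).
    have -> : Re (F (e s)) = \sum_r Re (f r (e s)).
      by rewrite /F; elim/big_rec2: _ => // r x y _ <-; rewrite ReD.
    have [r [p [h1 _]]] := flow s s0; rewrite (bigD1 r)//=.
    apply: (@le_trans _ _ (Re (f r (e s)))).
      apply: (Rel r s _ p.+1) => n' pn.
      rewrite (bigD1 (Ordinal pn))//=; apply: (@le_trans _ _ (tpow b (fam r p) s)); first lra.
      by rewrite lerDl sumr_ge0// => i _; apply: tpow_ge0; exact: ltW.
    rewrite lerDl sumr_ge0// => r' _; apply: (Rel r' s _ 0%N) => n' _.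
    by rewrite sumr_ge0// => i _; apply: tpow_ge0; exact: ltW.
  move=> t0; have : v t / 2 <= \sum_(i : unit) normc (F (e t)).
    apply: (@sum_normc_limit R _ unit (fun _ => F)) => // rho rho0.
    exists (e rho); first by rewrite (eN _ (ltW rho0)).
    have -> : e t + e rho = e (t + rho) by rewrite /e -scalerDl rmorphD.
    rewrite big_const card_unit/= addr0; apply: le_trans (pos _ _); last exact: ltr_wpDl.
    by rewrite ler_pM2r ?invr_gt0//; apply: (weight_mono hv) => //; rewrite lerDl ltW.
  by rewrite big_const card_unit/= addr0.
have n0 : 0 < n by rewrite ltr0n; apply/card_gt0P; exists (inr tt).
exists F; split => //; exists (D2 * n * 5)^-1, (2 / D1); split.
- by rewrite invr_gt0 !mulr_gt0.
- by rewrite divr_gt0.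
move=> t /= t0; have [h1 h2] := HD _ t0; split.
- rewrite mulrC ler_pdivrMr ?mulr_gt0//.
  apply: (@le_trans _ _ (n * (5 * v t))).
    apply: ge_sup; first by exists (normc (F (e t))), (e t) => //=; rewrite eN.
    by move=> _ [z /= <- <-].
  have -> : w t * (D2 * n * 5) = n * (5 * (D2 * w t)) by ring.
  by rewrite ler_pM2l// ler_pM2l.
- rewrite mulrAC ler_pdivlMr//.
  apply: (@le_trans _ _ (v t)); first by rewrite mulrC.
  rewrite -ler_pdivrMl// mulrC; apply: le_trans (Fl t t0) _.
  apply: ub_le_sup; last by exists (e t) => //=; rewrite eN.
  by exists (n * (5 * v t)) => _ [z /= <- <-].
Qed.

End Implications.

Theorem theorem8 (R : realType) (w : R -> R) (hw : weight_function w) :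
  [<-> forall d : nat, (1 <= d)%N -> approximable_by_map d w;
       exists2 d : nat, (1 <= d)%N & approximable_by_map d w;
       forall d : nat, (1 <= d)%N -> approximable_by_max_modulus d w;
       exists2 d : nat, (1 <= d)%N & approximable_by_max_modulus d w;
       forall d : nat, (1 <= d)%N -> essential d w;
       exists2 d : nat, (1 <= d)%N & essential d w;
       exists v : R -> R, [/\ weight_function v, log_tropical v
                            & equivalent_on [set t | 0 <= t] w v]].
Proof.
tfae.
- by move=> H; exists 1%N => //; exact: H.
- move=> [[//|d] _ /(map_competitive hw)/(competitive_tropical hw)[v [hv tv wv]]] [//|d'] _.
  exact: tropical_max_modulus hv tv wv.
- by move=> H; exists 1%N => //; exact: H.
- move=> [d _ /(max_modulus_tropical hw)[v [hv tv wv]]] [//|d'] _.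
  by apply: (competitive_essential hw); apply: (map_competitive hw); exact: tropical_map hv tv wv.
- by move=> H; exists 1%N => //; exact: H.
- by move=> [[//|d] _ /(essential_competitive hw)/(competitive_tropical hw)].
- by move=> [v [hv tv wv]] [//|d] _; exact: tropical_map hv tv wv.
Qed.
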